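(* For each $n\ge 2$ let $\mathbf{D}_n=(\mathbf{D}_n(i))_{i=1}^n$ be an exchangeable random degree sequence with values in $\mathcal{D}_n$, and let $\mathbf{T}(\mathbf{D}_n)$ be the associated random labeled tree on the vertex set $[n]$. Then the following are equivalent: (i) the random tree sequence $\mathbf{T}(\mathbf{D}_n)$ converges to an infinite random tree, i.e. there is a probability measure $\rho$ on $\mathcal{T}$ such that for every $\epsilon>0$, every positive integer $R$ and every finite rooted graph $F$, $$\lim_{n\to\infty}\mathbb{P}\bigl(|p(R,F,U(\mathbf{T}(\mathbf{D}_n)))-p(R,F,\rho)|>\epsilon\bigr)=0;$$ (ii) $\mathbf{D}_n\to\mathbf{D}$, where $\mathbf{D}=(\mathbf{D}(i))_{i=1}^\infty$ is an infinite sequence of independent random variables, all distributed as a random variable $\mathbf{D}_0$ with values in the positive integers, and $\mathbb{E}(\mathbf{D}_0)=2$.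
   Context: $[n]=\{1,\dots,n\}$. $\mathcal{D}_n$ is the set of all possible degree sequences $(D(i))_{i=1}^n$ of labeled trees on the vertex set $[n]$. A random degree sequence $\mathbf{D}_n$ is a random variable with values in $\mathcal{D}_n$; it is exchangeable if $(\mathbf{D}_n(i))_{i=1}^n$ and $(\mathbf{D}_n(\sigma(i)))_{i=1}^n$ have the same distribution for every permutation $\sigma\in S_n$. $\mathbf{T}(\mathbf{D}_n)$ is the random labeled tree on $[n]$ which, conditionally on $\mathbf{D}_n=D$, is uniformly distributed over all labeled trees on $[n]$ in which each vertex $i$ has degree $D(i)$. Convergence of degree sequences: for an infinite random sequence $\mathbf{D}=(\mathbf{D}(i))_{i=1}^\infty$, $\mathbf{D}_n\to\mathbf{D}$ means that for every $k\in\mathbb{N}$ the random vectors $(\mathbf{D}_n(i))_{i=1}^k$ converge in distribution to $(\mathbf{D}(i))_{i=1}^k$ as $n\to\infty$. Neighborhood statistics: for a graph $G$ and a vertex $v$, $B_G(v,R)$ is the subgraph induced by the vertices at distance at most $R$ from $v$, rooted at $v$. Two rooted graphs are rooted isomorphic if there is an isomorphism between them mapping root to root. For a probability distribution $\rho$ on rooted graphs, $p(R,F,\rho)$ is the probability that the $R$-ball around the root of a $\rho$-random rooted graph is rooted isomorphic to $F$. For a finite graph $G$, $U(G)$ is the distribution of the rooted graph obtained by choosing a uniformly random vertex of $G$ as root, so $p(R,F,U(G))=|\{v\in V(G): B_G(v,R)\text{ is rooted isomorphic to }F\}|/|V(G)|$; for random $G$ this is a random variable. $\mathcal{T}$ is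 the set of (rooted isomorphism classes of) countable, connected, locally finite infinite rooted trees, equipped with the $\sigma$-algebra generated by the sets $\mathcal{T}(F)=\{T\in\mathcal{T}: \text{the }R\text{-ball around the root of }T\text{ is rooted isomorphic to }F\}$, where $F$ is a finite rooted tree whose largest distance from the root is $R$. An infinite random tree is a probability measure on $\mathcal{T}$. *)

(* Defs.v *)
From HB Require Import structures.
From mathcomp Require Import all_boot all_order all_algebra.
From mathcomp Require Import generic_quotient perm finmap.
From mathcomp Require Import all_classical all_reals all_analysis.

Set Implicit Arguments.
Unset Strict Implicit.
Unset Printing Implicit Defensive.

Import Order.TTheory GRing.Theory Num.Theory.
Import numFieldNormedType.Exports.

Local Open Scope classical_set_scope.
Local Open Scope ring_scope.

Record sgraph (V : eqType) := SGraph {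
  adj :> rel V;
  adj_sym : symmetric adj;
  adj_irr : irreflexive adj
}.

Section SimpleGraphs.
Context {V : eqType}.
Variable G : sgraph V.

(* y is at distance at most r from x; size p is the number of edges of the
   walk x :: p *)
Definition dist_le (r : nat) (x y : V) : Prop :=
  exists p : seq V, [/\ path G x p, last x p = y & (size p <= r)%N].

Definition connected_graph : Prop := forall x y : V, exists r, dist_le r x y.

(* A simple cycle of a graph has at least three vertices; ucycle also accepts
   the degenerate cases [::] and [:: x; y] with x, y adjacent. *)
Definition acyclic : Prop := forall c : seq V, ucycle G c -> (size c <= 2)%N.

Definition is_tree : Prop := connected_graph /\ acyclic.

Definition locally_finite_graph : Prop :=
  forall x : V, finite_set [set y | adj G x y].

Lemma dist_le_refl r x : dist_le r x x.
Proof. by exists [::]. Qed.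

End SimpleGraphs.

Record rooted_graph := RootedGraph {
  rooted_vertex : eqType;
  rooted_sgraph : sgraph rooted_vertex;
  rooted_root : rooted_vertex
}.

Definition finite_rooted_graph (F : rooted_graph) : Prop :=
  finite_set [set: rooted_vertex F].

(* r is the largest distance from the root in F *)
Definition has_height (F : rooted_graph) (r : nat) : Prop :=
  (forall x, dist_le (rooted_sgraph F) r (rooted_root F) x) /\
  (exists x, forall q,
     dist_le (rooted_sgraph F) q (rooted_root F) x -> (r <= q)%N).

Definition rooted_iso (F H : rooted_graph) : Prop :=
  exists f : rooted_vertex F -> rooted_vertex H,
    [/\ bijective f, f (rooted_root F) = rooted_root H &
        forall x y,
          adj (rooted_sgraph H) (f x) (f y) = adj (rooted_sgraph F) x y].

Lemma rooted_iso_refl F : rooted_iso F F.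
Proof. by exists id; split => //; exists id. Qed.

Lemma rooted_iso_sym F H : rooted_iso F H -> rooted_iso H F.
Proof.
case=> f [[g fK gK] f0 fadj]; exists g; split; first by exists f.
  by rewrite -f0 fK.
by move=> x y; rewrite -fadj !gK.
Qed.

Lemma rooted_iso_trans F H K :
  rooted_iso F H -> rooted_iso H K -> rooted_iso F K.
Proof.
case=> f [bf f0 fadj] [g [bg g0 gadj]]; exists (g \o f); split.
- exact: bij_comp.
- by rewrite /= f0.
- by move=> x y /=; rewrite gadj fadj.
Qed.

Section Balls.
Context {V : eqType}.
Variables (G : sgraph V) (v : V) (r : nat).

Definition ball_vertex : eqType := {y : V | `[< dist_le G r v y >]}.

Definition ball_adj : rel ball_vertex := fun x y => G (val x) (val y).

Lemma ball_adj_sym : symmetric ball_adj.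
Proof. by move=> x y; apply: adj_sym. Qed.

Lemma ball_adj_irr : irreflexive ball_adj.
Proof. by move=> x; apply: adj_irr. Qed.

Definition ball_root : ball_vertex := exist _ v (asboolT (dist_le_refl G r v)).

Definition graph_ball : rooted_graph :=
  RootedGraph (SGraph ball_adj_sym ball_adj_irr) ball_root.

End Balls.

Definition simple_adjacency (n : nat) (E : {ffun 'I_n * 'I_n -> bool}) : bool :=
  `[< symmetric (fun x y => E (x, y)) /\ irreflexive (fun x y => E (x, y)) >].

(* The finite type of simple graphs on the vertex set 'I_n, given by their
   adjacency matrices. *)
Record lgraph (n : nat) := LGraph {
  lgraph_adj : {ffun 'I_n * 'I_n -> bool};
  lgraph_simple : simple_adjacency lgraph_adj
}.

HB.instance Definition _ n := [isSub for @lgraph_adj n].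
HB.instance Definition _ n := [Finite of lgraph n by <:].

Section LabeledGraphs.
Variable n : nat.

Definition lgraph_sgraph (t : lgraph n) : sgraph 'I_n :=
  SGraph (proj1 (asboolW (lgraph_simple t)))
         (proj2 (asboolW (lgraph_simple t))).

Coercion lgraph_sgraph : lgraph >-> sgraph.

Lemma edgeless_simple :
  simple_adjacency ([ffun=> false] : {ffun 'I_n * 'I_n -> bool}).
Proof. by apply/asboolP; split=> [x y | x]; rewrite !ffunE. Qed.

Definition edgeless : lgraph n := LGraph edgeless_simple.

HB.instance Definition _ := isPointed.Build (lgraph n) edgeless.
HB.instance Definition _ := @isMeasurable.Build default_measure_display
  (lgraph n) discrete_measurable discrete_measurable0
  discrete_measurableC discrete_measurableU.

Definition degree (t : lgraph n) (i : 'I_n) : nat := #|[pred j | t i j]|.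

Definition trees_with_degrees (d : 'I_n -> nat) : {set lgraph n} :=
  [set t : lgraph n | `[< is_tree t /\ forall i, degree t i = d i >]]%SET.

Definition degree_sequences : set ('I_n -> nat) :=
  [set d | exists t : lgraph n, is_tree t /\ forall i, degree t i = d i].

(* p(r, F, U(t)) *)
Definition ball_frequency (R : realType) (r : nat) (F : rooted_graph)
    (t : lgraph n) : R :=
  #|[pred v : 'I_n | `[< rooted_iso (graph_ball t v r) F >]]|%:R / n%:R.

End LabeledGraphs.

(* Every countably infinite graph has an isomorphic copy with vertex set nat,
   so isomorphism classes are taken among rooted trees on nat. The root is an
   arbitrary vertex. *)
Record itree := ITree {
  itree_graph : sgraph nat;
  itree_root : nat;
  itree_is_tree : is_tree itree_graph;
  itree_locally_finite : locally_finite_graph itree_graph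
}.

HB.instance Definition _ := gen_eqMixin itree.
HB.instance Definition _ := gen_choiceMixin itree.

Definition itree_rooted (t : itree) : rooted_graph :=
  RootedGraph (itree_graph t) (itree_root t).

Definition itree_iso : rel itree :=
  fun s t => `[< rooted_iso (itree_rooted s) (itree_rooted t) >].

Lemma itree_iso_refl : reflexive itree_iso.
Proof. by move=> t; apply/asboolP; exact: rooted_iso_refl. Qed.

Lemma itree_iso_sym : symmetric itree_iso.
Proof. by move=> s t; apply/asboolP/asboolP; exact: rooted_iso_sym. Qed.

Lemma itree_iso_trans : transitive itree_iso.
Proof.
move=> s t u /asboolP st /asboolP tu; apply/asboolP.
exact: rooted_iso_trans tu.
Qed.

Canonical itree_iso_equiv :=
  EquivRel itree_iso itree_iso_refl itree_iso_sym itree_iso_trans.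

Definition itree_class : Type := {eq_quot itree_iso}%qT.

HB.instance Definition _ := Choice.on itree_class.
HB.instance Definition _ := EqQuotient.on itree_class.

(* The one-ended infinite path, only used to show that itree_class is
   inhabited. *)
Definition ray_adj : rel nat := fun x y => (x.+1 == y) || (y.+1 == x).

Lemma ray_adj_sym : symmetric ray_adj.
Proof. by move=> x y; rewrite /ray_adj orbC. Qed.

Lemma ray_adj_irr : irreflexive ray_adj.
Proof. by move=> x; rewrite /ray_adj orbb gtn_eqF. Qed.

Definition ray_graph : sgraph nat := SGraph ray_adj_sym ray_adj_irr.

Lemma ray_dist_le0 x : dist_le ray_graph x 0%N x /\ dist_le ray_graph x x 0%N.
Proof.
split.
  exists (iota 1 x); split; last by rewrite size_iota.
    suff H m : path ray_graph m (iota m.+1 x) by exact: H.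
    by elim: x m => //= x IH m; rewrite IH /= /ray_adj eqxx.
  suff H m : last m (iota m.+1 x) = (m + x)%N by rewrite H.
  by elim: x m => [|x IH] m /=; rewrite ?addn0// IH addSnnS.
elim: x => [|x [p [px pl ps]]]; first by exists [::].
by exists (x :: p); split=> //=; rewrite /ray_adj eqxx orbT.
Qed.

Lemma ray_is_tree : is_tree ray_graph.
Proof.
split=> [x y|c].
  have [_ [p [px pl _]]] := ray_dist_le0 x.
  have [[q [qx ql _]] _] := ray_dist_le0 y.
  exists (size (p ++ q)), (p ++ q); split=> //.
    by rewrite cat_path px pl.
  by rewrite last_cat pl.
case: c => [|x0 c0]; first by [].
set c := x0 :: c0 => /andP[cc uc].
have [m mc mmax] : exists2 m, m \in c & forall x, x \in c -> (x <= m)%N.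
  have x0c : x0 \in c by rewrite mem_head.
  exists (\max_(x <- c) x)%N; last by move=> x xc; exact: leq_bigmax_seq.
  by rewrite /c; elim: (c0) x0 {c cc uc x0c} => [|y s IH] x;
    rewrite big_cons ?big_nil ?maxn0 ?mem_head//;
    case: (leqP x (\max_(j <- y :: s) j)%N) => _;
    rewrite in_cons ?eqxx// IH orbT.
have [i s Es] := rot_to mc.
rewrite -(size_rot i) Es.
have : cycle ray_graph (m :: s) by rewrite -Es rot_cycle.
have : uniq (m :: s) by rewrite -Es rot_uniq.
have smax x : x \in s -> (x <= m)%N.
  by move=> xs; apply: mmax; rewrite -(mem_rot i) Es in_cons xs orbT.
case: s {Es} smax => // a; case/lastP=> // s b smax.
have am : (a <= m)%N by apply: smax; rewrite mem_head.
have bm : (b <= m)%N by apply: smax; rewrite in_cons mem_rcons mem_head orbT.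
rewrite /= rcons_path last_rcons => /and3P[_ + _] /and3P[+ _ +].
rewrite mem_rcons in_cons negb_or => /andP[+ _].
rewrite /ray_adj => ab /orP[/eqP ma|/eqP ma].
  by rewrite -ma ltnn in am.
case/orP => [/eqP mb|/eqP mb]; last by rewrite -mb ltnn in bm.
by move: ab; rewrite -(inj_eq succn_inj) ma mb eqxx.
Qed.

Lemma ray_locally_finite : locally_finite_graph ray_graph.
Proof.
move=> x; apply: (@sub_finite_set _ _ `I_x.+2) (finite_II _) => y /=.
by rewrite /ray_adj => /orP[/eqP <-|/eqP <-] //; rewrite ltnW// ltnW.
Qed.

Definition ray : itree := ITree 0 ray_is_tree ray_locally_finite.

HB.instance Definition _ := isPointed.Build itree_class
  (\pi_itree_class ray)%qT.

(* The trees whose r-ball around the root is rooted isomorphic to F. The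
   condition does not depend on the representative of the class t. *)
Definition cylinder (r : nat) (F : rooted_graph) : set itree_class :=
  [set t | rooted_iso
     (graph_ball (itree_graph (repr t)) (itree_root (repr t)) r) F].

Definition cylinders : set (set itree_class) :=
  [set A | exists (r : nat) (F : rooted_graph),
    [/\ finite_rooted_graph F, is_tree (rooted_sgraph F), has_height F r &
        A = cylinder r F]].

Definition infinite_trees := g_sigma_algebraType cylinders.

(* p(r, F, rho) *)
Definition ball_probability (R : realType) (rho : probability infinite_trees R)
    (r : nat) (F : rooted_graph) : R :=
  fine (rho (cylinder r F)).

Section RandomTrees.
Context {R : realType} {d : measure_display} {Om : measurableType d}.
Variables (P : probability Om R) (n : nat).

Definition random_degree_sequence (D : 'I_n -> {RV P >-> nat}) : Prop :=
  forall w, degree_sequences (fun i => D i w).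

(* All subsets of the countable set nat^n are measurable. *)
Definition exchangeable (D : 'I_n -> {RV P >-> nat}) : Prop :=
  forall (s : 'S_n) (A : set ('I_n -> nat)),
    P [set w | A (fun i => D (s i) w)] = P [set w | A (fun i => D i w)].

(* Conditionally on D = x, the random graph T is uniformly distributed over the
   trees with degree sequence x. *)
Definition uniform_tree_given (D : 'I_n -> {RV P >-> nat})
    (T : {RV P >-> lgraph n}) : Prop :=
  forall (x : 'I_n -> nat) (t : lgraph n),
    P [set w | T w = t /\ forall i, D i w = x i] =
    (P [set w | forall i, D i w = x i] *
     ((t \in trees_with_degrees x)%:R / #|trees_with_degrees x|%:R)%:E)%E.

End RandomTrees.

Definition same_distribution {R : realType} {d1 d2 d' : measure_display}
    {T1 : measurableType d1} {T2 : measurableType d2} {E : measurableType d'}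
    {P1 : probability T1 R} {P2 : probability T2 R}
    (X : {RV P1 >-> E}) (Y : {RV P2 >-> E}) : Prop :=
  forall A : set E, measurable A -> distribution P1 X A = distribution P2 Y A.

Definition mutually_independent {R : realType} {d d' : measure_display}
    {T : measurableType d} {E : measurableType d'} {P : probability T R}
    {I : choiceType} (X : I -> {RV P >-> E}) : Prop :=
  forall (J : {fset I}) (A : I -> set E),
    (forall i, measurable (A i)) ->
    P (\bigcap_(i in [set` J]) (X i @^-1` A i)) =
    (\prod_(i <- J) P (X i @^-1` A i))%E.

Definition cvg_in_distribution {R : realType} {k : nat}
    {d : nat -> measure_display} {T : forall n, measurableType (d n)}
    (P : forall n, probability (T n) R) (X : forall n, T n -> 'rV[R]_k)
    {d' : measure_display} {T' : measurableType d'}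
    (Q : probability T' R) (Y : T' -> 'rV[R]_k) : Prop :=
  forall f : 'rV[R]_k -> R, continuous f -> bounded_fun f ->
    ('E_(P n)[f \o X n])%E @[n --> \oo] --> ('E_Q[f \o Y])%E.

(* The first k terms of the n-th sequence make sense for n >= k only: hence the
   shift of the index n by k. *)
Definition cvg_degree_sequences {R : realType}
    {d : nat -> measure_display} {T : forall n, measurableType (d n)}
    (P : forall n, probability (T n) R)
    (D : forall n, 'I_n -> {RV (P n) >-> nat})
    {d' : measure_display} {T' : measurableType d'}
    (Q : probability T' R) (D' : nat -> {RV Q >-> nat}) : Prop :=
  forall k : nat,
    cvg_in_distribution (fun n => P (k + n)%N)
      (fun n w => \row_(i < k) (D (k + n)%N (lshift n i) w)%:R)
      Q (fun w => \row_(i < k) (D' i w)%:R).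

Definition cvg_to_infinite_random_tree {R : realType}
    {d : nat -> measure_display} {Om : forall n, measurableType (d n)}
    (P : forall n, probability (Om n) R)
    (T : forall n, {RV (P n) >-> lgraph n}) : Prop :=
  exists rho : probability infinite_trees R,
    forall (eps : R) (r : nat) (F : rooted_graph),
      0 < eps -> (0 < r)%N -> finite_rooted_graph F ->
      P n [set w | `|ball_frequency R r F (T n w) - ball_probability rho r F|
                   > eps]
        @[n --> \oo] --> 0%E.

Definition cvg_to_iid_of_mean_two {R : realType}
    {d : nat -> measure_display} {Om : forall n, measurableType (d n)}
    (P : forall n, probability (Om n) R)
    (D : forall n, 'I_n -> {RV (P n) >-> nat}) : Prop :=
  exists (d0 : measure_display) (Om0 : measurableType d0)
         (P0 : probability Om0 R) (D0 : {RV P0 >-> nat})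
         (d' : measure_display) (Om' : measurableType d')
         (Q : probability Om' R) (D' : nat -> {RV Q >-> nat}),
    [/\ (forall w, (0 < D0 w)%N) /\ ('E_P0[fun w => (D0 w)%:R] = 2%:E)%E,
        mutually_independent D',
        forall i, same_distribution (D' i) D0 &
        cvg_degree_sequences D D'].

(* Main.v *)
Require Import Defs.
From HB Require Import structures.
From mathcomp Require Import all_boot all_order all_algebra.
From mathcomp Require Import perm finmap generic_quotient.
From mathcomp Require Import all_classical all_reals all_analysis.
From mathcomp Require Import measurable_realfun.
From mathcomp Require Import zify lra.

Set Implicit Arguments.
Unset Strict Implicit.
Unset Printing Implicit Defensive.

Import Order.TTheory GRing.Theory Num.Theory.
Import numFieldNormedType.Exports.

(** Given its degrees the tree is uniform, so the probability that it contains a prescribed forest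
    is a quotient of two numbers of trees. These numbers have a closed form ([count_trees_over]):
    for a forest with m+1 components, m > 0, and residual degrees r_v, the number of trees over it
    with the given degrees, times the product of the r_v!, is (m-1)! times the product over the
    components of their total residual degrees. The proof double counts pairs of a tree and an edge
    of it outside the forest.

    From degrees to trees. A rooted tree explored in breadth-first order is coded by the word of its
    child counts. The frequency of a ball F is a finite sum, over words that code F, of the number
    of embeddings of the word divided by the number of orderings ([ball_frequency_exploration]). By
    the counting formula and exchangeability, the moments of the number of embeddings reduce to the
    joint law of finitely many degrees ([mean_embeddings], [mean_embeddings2]); overlapping pairs of
    embeddings number only O(n). When the degrees become independent with law p, the frequency of a
    word therefore converges in mean square to [word_limit]: the product of the p(degree) times b/s,
    where s is the root degree and b is the number of vertices discovered but not yet explored at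
    the end of the word ([word_frequency_L2]). After the root, b is a random walk with steps D - 2,
    so mean two makes it harmonic, and the limits are the word probabilities of this walk
    transformed by b, which never dies out. A random sequence with these probabilities
    ([realization]) codes an infinite random tree with the right ball probabilities
    ([infinite_random_tree]).

    From trees to degrees. Balls of radius one are stars, so the degree frequencies converge in
    probability to numbers a(k). Up to epsilon the limit law is carried by finitely many ball types
    of any given radius, so few vertices have large balls ([large_balls_tight]), and a sums to one.
    For the mean, all edges at vertices of degree at least K lie inside the set of vertices whose
    2-ball has more than K elements; a forest has fewer edges than vertices, so these degrees sum to
    at most twice the size of that set ([sum_large_degree]), and no positive part of the total
    degree 2n-2 escapes ([degree_limit_mean]). Finally, exchangeability makes the first degrees a
    sample of the vertices without replacement, asymptotically the same as one with replacement
    ([degree_prob_cvg]), so they become independent with law a. For integer vectors, convergence of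
    the point probabilities to a probability law gives convergence in distribution
    ([cvg_in_distribution_points]). *)

(** * Forests as edge sets with a labelling of the components *)

Section Forests.
Variable V : finType.
Implicit Types (F G : {set V * V}) (c : V -> V) (x y u v : V).

Definition add_edge F x y : {set V * V} := F :|: [set (x, y); (y, x)].

Definition merge_label c x y : V -> V := fun v => if c v == c y then c x else c v.

(* [forest F c]: the symmetric set [F] of ordered pairs is the edge set of a
   forest, and [c] sends a vertex to a representative of its component *)
Inductive forest : {set V * V} -> (V -> V) -> Prop :=
| forest0 : forest finset.set0 id
| forest_add F c x y :
    forest F c -> c x != c y -> forest (add_edge F x y) (merge_label c x y).

Definition edge_rel F : rel V := fun x y => (x, y) \in F.

Definition components c : {set V} := [set c v | v in V].

Definition acyclic_edges F : Prop :=
  forall s : seq V, ucycle (edge_rel F) s -> size s <= 2.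

Lemma in_add_edge F x y u v : ((u, v) \in add_edge F x y) =
  [|| (u, v) \in F, (u == x) && (v == y) | (u == y) && (v == x)].
Proof. by rewrite !inE !xpair_eqE. Qed.

Lemma forest_sym F c : forest F c -> symmetric (edge_rel F).
Proof.
elim=> [|{}F {}c x y _ IH _] u v; rewrite /edge_rel; first by rewrite !inE.
rewrite !in_add_edge -!/(edge_rel _ _ _) (IH u v); congr (_ || _).
by rewrite orbC; congr (_ || _); rewrite andbC.
Qed.

Lemma forest_irr F c : forest F c -> irreflexive (edge_rel F).
Proof.
elim=> [|{}F {}c x y _ IH xy] u; rewrite /edge_rel; first by rewrite inE.
rewrite in_add_edge -/(edge_rel _ _ _) IH /=; apply/negbTE.
rewrite negb_or; apply/andP; split; apply/negP => /andP[/eqP ux /eqP uy];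
  by move: xy; rewrite -ux -uy eqxx.
Qed.

Lemma forest_edge F c x y : forest F c -> (x, y) \in F -> c x = c y.
Proof.
move=> H; elim: H x y => [|{}F {}c x y _ IH xy] u v; first by rewrite inE.
rewrite in_add_edge /merge_label => /or3P[/IH -> //|/andP[/eqP -> /eqP ->]|/andP[/eqP -> /eqP ->]].
  by rewrite eqxx (negbTE xy).
by rewrite eqxx (negbTE xy).
Qed.

Lemma forest_connect_eq F c x y : forest F c -> connect (edge_rel F) x y -> c x = c y.
Proof.
move=> Fc /connectP[p]; elim: p x => [|z p IH] x /=; first by move=> _ ->.
by case/andP => xz pz yl; rewrite (forest_edge Fc xz); exact: IH.
Qed.

Lemma sub_connect_edge F G x y : F \subset G ->
  connect (edge_rel F) x y -> connect (edge_rel G) x y.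
Proof.
move=> FG; apply: connect_sub => u v uv; apply: connect1.
exact: (fintype.subsetP FG).
Qed.

Lemma add_edge_sub F x y : F \subset add_edge F x y.
Proof. exact: finset.subsetUl. Qed.

Lemma forest_connect F c x y : forest F c -> c x = c y -> connect (edge_rel F) x y.
Proof.
move=> H; elim: H x y => [|{}F {}c x y Fc IH xy] u v; first by move=> /= ->.
have sF w z : c w = c z -> connect (edge_rel (add_edge F x y)) w z.
  by move=> wz; apply: sub_connect_edge (IH _ _ wz); exact: add_edge_sub.
have xyF : connect (edge_rel (add_edge F x y)) x y.
  by apply: connect1; rewrite /edge_rel in_add_edge !eqxx orbT.
have yxF : connect (edge_rel (add_edge F x y)) y x.
  by apply: connect1; rewrite /edge_rel in_add_edge !eqxx !orbT.
rewrite /merge_label; case: eqP => uy; case: eqP => vy.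
- by move=> _; apply: sF; rewrite uy vy.
- by move=> xv; apply: (connect_trans (sF _ _ uy)); apply: (connect_trans yxF); exact: sF.
- move=> xu; apply: (connect_trans (sF _ _ xu)); apply: (connect_trans xyF).
  by apply: sF; rewrite vy.
- exact: sF.
Qed.

Lemma components_merge c x y : c x != c y ->
  components (merge_label c x y) = components c :\ c y.
Proof.
move=> xy; apply/setP => z; rewrite !inE; apply/imsetP/idP => [[v _ ->]|].
  rewrite /merge_label; case: (boolP (c v == c y)) => [_|->]; last by rewrite imset_f.
  by rewrite xy imset_f.
by case/andP => zy /imsetP[v _ zv]; exists v => //; rewrite /merge_label -zv (negbTE zy).
Qed.

Lemma mem_components c x : c x \in components c.
Proof. exact: imset_f. Qed.

Lemma card_components_merge c x y : c x != c y ->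
  #|components c| = #|components (merge_label c x y)|.+1.
Proof. by move=> xy; rewrite components_merge// (cardsD1 (c y)) mem_components. Qed.

Lemma add_edge_notin F c x y : forest F c -> c x != c y ->
  (x, y) \notin F /\ (y, x) \notin F.
Proof.
by move=> Fc xy; split; apply/negP => /(forest_edge Fc) e; move: xy; rewrite e eqxx.
Qed.

Lemma card_add_edge F c x y : forest F c -> c x != c y ->
  #|add_edge F x y| = #|F| + 2.
Proof.
move=> Fc xy; have [h1 h2] := add_edge_notin Fc xy.
rewrite cardsU cards2 xpair_eqE.
have -> : F :&: [set (x, y); (y, x)] = finset.set0.
  apply/setP => -[u v]; rewrite !inE !xpair_eqE; apply/negP => /andP[uvF].
  by case/orP => /andP[/eqP ux /eqP vy]; move: h1 h2; rewrite -ux -vy uvF.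
have -> : (x == y) = false.
  by apply/negP => /eqP e; move: xy; rewrite e eqxx.
by rewrite cards0 subn0.
Qed.

(** Each added edge contributes two ordered pairs to [F] and merges two components into one. *)
Lemma card_forest F c : forest F c -> #|F| + 2 * #|components c| = 2 * #|V|.
Proof.
elim=> [|{}F {}c x y Fc IH xy].
  have -> : components id = [set: V]%SET.
    by apply/setP => v; rewrite inE; apply/imsetP; exists v.
  by rewrite cards0 cardsT.
by rewrite (card_add_edge Fc xy) -IH (card_components_merge xy); lia.
Qed.

Lemma path_sub_rel F G x s : {in x :: s &, forall u v, (u, v) \in G -> (u, v) \in F} ->
  path (edge_rel G) x s -> path (edge_rel F) x s.
Proof.
elim: s x => //= y s IH x H /andP[xy ps]; apply/andP; split.
  by apply: H => //; rewrite !inE eqxx ?orbT.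
by apply: IH ps => u v us vs; apply: H; rewrite inE ?us ?vs orbT.
Qed.

Lemma forest_path_const F c x s : forest F c -> path (edge_rel F) x s ->
  c x = c (last x s).
Proof.
move=> Fc; elim: s x => //= y s IH x /andP[xy /IH <-].
exact: forest_edge xy.
Qed.

(** A cycle that avoids [x] lies in the old forest. Otherwise rotate it to start at [x], with
    neighbours [a] and [b] on the cycle: the arc from [a] to [b] lies in the old forest, so
    [c a = c b], and if one of the two edges at [x] were the new one, [c x = c y] or [a = b] would
    follow. *)
Lemma forest_acyclic F c : forest F c -> acyclic_edges F.
Proof.
elim=> [|{}F {}c x y Fc IH xy] s.
  by case: s => // a [|b s]//= /andP[/andP[]]; rewrite /edge_rel inE.
have [xs|xs] := boolP (x \in s); last first.
  case: s xs => // a s xs /andP[/= cs us]; apply: (IH (a :: s)); apply/andP; split=> //=.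
  apply: path_sub_rel cs => u v us' vs'; rewrite in_add_edge.
  have sub w : w \in a :: rcons s a -> w != x.
    rewrite inE mem_rcons inE orbA orbb => ws; apply: contra xs => /eqP <-.
    by rewrite inE.
  by rewrite (negbTE (sub _ us')) (negbTE (sub _ vs')) /= andbF orbF.
have [i s' Es] := rot_to xs.
rewrite -(size_rot i) /ucycle -(rot_uniq i) -(rot_cycle i) Es.
case: s' {Es} => // a; case/lastP => // s' b.
case/andP=> /=; rewrite rcons_path last_rcons => /and3P[xa pab bx].
case/andP; rewrite inE mem_rcons inE !negb_or => /and3P[xna xnb xns].
case/andP; rewrite mem_rcons inE negb_or => /andP[ab ans] us.
have pF : path (edge_rel F) a (rcons s' b).
  apply: path_sub_rel pab => u v us' vs'; rewrite in_add_edge.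
  have sub w : w \in a :: rcons s' b -> w != x.
    rewrite inE mem_rcons inE => /or3P[/eqP->|/eqP->|ws]; [by rewrite eq_sym|by rewrite eq_sym|].
    by apply: contra xns => /eqP <-.
  by rewrite (negbTE (sub _ us')) (negbTE (sub _ vs')) /= andbF orbF.
have cab : c a = c b by rewrite (forest_path_const Fc pF) last_rcons.
move: xa bx; rewrite /edge_rel !in_add_edge !eqxx /= (eq_sym b x) (negbTE xnb) /=.
rewrite (eq_sym a x) (negbTE xna) !andbF !orbF !andbT.
case/orP=> [xa|/eqP ay].
  case/orP=> [bx|/eqP byy].
    have : ucycle (edge_rel F) (x :: a :: rcons s' b).
      apply/andP; split=> /=.
        by rewrite rcons_path last_rcons pF /edge_rel xa bx.
      rewrite inE mem_rcons inE !negb_or xna xnb xns /=.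
      by rewrite mem_rcons inE negb_or ab ans us.
    exact: (IH (x :: a :: rcons s' b)).
  by move: xy; rewrite (forest_edge Fc xa) cab byy eqxx.
case/orP=> [bx|/eqP byy].
  by move: xy; rewrite -(forest_edge Fc bx) -cab ay eqxx.
by move: ab; rewrite ay byy eqxx.
Qed.

(** A simple path from [x] to [y] in [F], closed by the edge of [G], would be a cycle; it has at
    least three vertices because the edge itself is not in [F]. *)
Lemma acyclic_no_connect F x y G : F \subset G -> symmetric (edge_rel G) ->
  acyclic_edges G -> (x, y) \in G -> (x, y) \notin F -> x != y ->
  ~~ connect (edge_rel F) x y.
Proof.
move=> FG sG aG xyG xyF xy; apply/negP => /connectP[p pp yl].
case/shortenP: pp yl => q pq uq _ yl.
have : ucycle (edge_rel G) (x :: q).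
  apply/andP; split=> //=; rewrite rcons_path; apply/andP; split.
    by apply: path_sub_rel pq => u v _ _; apply: (fintype.subsetP FG).
  by rewrite -yl sG.
move/aG; case: q pq yl uq => [|z [|? ?]] //=.
  by move=> _ e _ _; move: xy; rewrite e eqxx.
by rewrite andbT => xz yz _ _; move: xyF; rewrite yz -[_ \in _]/(edge_rel F x z) xz.
Qed.

(** Induction on the number of edges: after removal of an edge its ends are no longer connected, so
    putting it back is a step of [forest]. *)
Lemma acyclic_forest F : symmetric (edge_rel F) -> irreflexive (edge_rel F) ->
  acyclic_edges F -> exists c, forest F c.
Proof.
have [n] := ubnP #|F|; elim: n F => // n IH F Fn sF iF aF.
have [->|/finset.set0Pn[[x y] xyF]] := eqVneq F finset.set0.
  by exists id; exact: forest0.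
have yxF : (y, x) \in F by rewrite -[_ \in _]/(edge_rel F y x) sF.
have xy : x != y.
  by apply/negP => /eqP e; move: xyF; rewrite e -[_ \in _]/(edge_rel F y y) iF.
pose F' := F :\: [set (x, y); (y, x)].
have F'F : F' \subset F by exact: finset.subsetDl.
have inF' u v : ((u, v) \in F') = ((u, v) \in F) &&
    ~~ ((u == x) && (v == y) || (u == y) && (v == x)).
  by rewrite !inE !xpair_eqE andbC.
have [||||c Fc] := IH F'.
- have : F' \proper F.
    apply/properP; split=> //; exists (x, y) => //.
    by rewrite inF' !eqxx andbF.
  by move/proper_card => h; move: Fn; rewrite ltnS; exact: leq_trans.
- move=> u v; rewrite /edge_rel !inF' -!/(edge_rel F _ _) sF.
  by congr (_ && ~~ _); rewrite orbC; congr (_ || _); rewrite andbC.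
- by move=> u; rewrite /edge_rel inF' -/(edge_rel F _ _) iF.
- move=> s /andP[cs us]; apply: (aF s); apply/andP; split=> //.
  case: s cs {us} => //= a s; apply: path_sub_rel => u v _ _.
  exact: (fintype.subsetP F'F).
have cxy : c x != c y.
  have : ~~ connect (edge_rel F') x y.
    by apply: (acyclic_no_connect F'F sF aF xyF) => //; rewrite inF' !eqxx andbF.
  by apply: contra => /eqP; exact: forest_connect.
exists (merge_label c x y); suff -> : F = add_edge F' x y by exact: forest_add.
apply/setP => -[u v]; rewrite in_add_edge inF'.
have [/andP[/eqP -> /eqP ->]|_] := boolP ((u == x) && (v == y)).
  by rewrite xyF orbT.
have [/andP[/eqP -> /eqP ->]|_] := boolP ((u == y) && (v == x)).
  by rewrite yxF.
by rewrite /= andbT orbF.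
Qed.

Lemma forest_acyclic_neq F c x y G : forest F c -> F \subset G ->
  symmetric (edge_rel G) -> irreflexive (edge_rel G) -> acyclic_edges G ->
  (x, y) \in G -> (x, y) \notin F -> c x != c y.
Proof.
move=> Fc FG sG iG aG xyG xyF.
have xy : x != y.
  by apply/negP => /eqP e; move: xyG; rewrite e -[_ \in _]/(edge_rel G y y) iG.
have := acyclic_no_connect FG sG aG xyG xyF xy.
by apply: contra => /eqP; exact: forest_connect.
Qed.

End Forests.

(** * Counting labeled trees with given degrees that contain a given forest *)

(** Grouping the ends of an edge by component: this produces the total residual degrees of
    components in the tree count. *)
Lemma sum_pairs_components (V : finType) (R : comNzRingType) (c : V -> V) (r : V -> R)
    (W : V -> V -> R) (b := fun j => (\sum_(v | c v == j) r v)%R) :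
  (\sum_x \sum_(y | c x != c y) r x * r y * W (c x) (c y) =
   \sum_(j in components c) \sum_(k in components c | j != k) b j * b k * W j k)%R.
Proof.
rewrite (partition_big c (mem (components c))) /=; last by move=> x _; exact: imset_f.
apply: eq_bigr => j _.
transitivity (\sum_(x | c x == j) r x * \sum_(k in components c | j != k) b k * W j k)%R.
  apply: eq_bigr => x /eqP cx.
  rewrite (partition_big c (fun k => (k \in components c) && (j != k))) /=; last first.
    by move=> y; rewrite cx => ->; rewrite imset_f.
  rewrite big_distrr /=; apply: eq_bigr => k /andP[_ jk].
  rewrite /b !big_distrl big_distrr /=; apply: eq_big => y.
    by rewrite cx; case: (eqVneq (c y) k) => [->|]; rewrite ?jk ?andbF.
  by rewrite cx => /andP[_ /eqP ->]; rewrite mulrA.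
rewrite -big_distrl /= -/(b j) big_distrr /=.
by apply: eq_bigr => k _; rewrite mulrA.
Qed.

Lemma prodD2 (V : finType) (R : comNzRingType) (C : {set V}) (b : V -> R) j k :
  j \in C -> k \in C -> j != k ->
  (\prod_(l in C) b l = b j * b k * \prod_(l in C :\ k :\ j) b l)%R.
Proof.
move=> jC kC jk; rewrite (big_setD1 k kC) /= (big_setD1 j) /=; last by rewrite !inE jk jC.
by rewrite mulrCA mulrA.
Qed.

Section TreeCount.
Variable n : nat.
Notation V := 'I_n.
Implicit Types (t : lgraph n) (F G : {set V * V}) (c : V -> V) (d : V -> nat).

Definition edges t : {set V * V} := [set p | lgraph_adj t p]%SET.

Lemma in_edges t x y : ((x, y) \in edges t) = t x y.
Proof. by rewrite inE. Qed.

Lemma edges_sym t : symmetric (edge_rel (edges t)).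
Proof. by move=> x y; rewrite /edge_rel !in_edges adj_sym. Qed.

Lemma edges_irr t : irreflexive (edge_rel (edges t)).
Proof. by move=> x; rewrite /edge_rel in_edges adj_irr. Qed.

Lemma edge_rel_edges t : edge_rel (edges t) =2 t.
Proof. by move=> x y; rewrite /edge_rel in_edges. Qed.

Lemma edges_inj : injective edges.
Proof.
move=> t u tu; apply: val_inj; apply/ffunP => -[x y].
by have /setP/(_ (x, y)) := tu; rewrite !inE.
Qed.

Lemma edges_surj F : symmetric (edge_rel F) -> irreflexive (edge_rel F) ->
  exists t, edges t = F.
Proof.
move=> sF iF.
have h : simple_adjacency [ffun p : V * V => p \in F].
  apply/asboolP; split=> [x y|x]; rewrite !ffunE; first exact: sF.
  exact: iF.
by exists (LGraph h); apply/setP => -[x y]; rewrite inE ffunE.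
Qed.

Lemma acyclic_edges_acyclic t : acyclic_edges (edges t) <-> acyclic t.
Proof.
split=> H s /andP[cs us]; apply: (H s); apply/andP; split=> //.
  by rewrite (eq_cycle (edge_rel_edges t)).
by rewrite -(eq_cycle (edge_rel_edges t)).
Qed.

Lemma tree_forest t : is_tree t ->
  exists2 c, forest (edges t) c & forall x y, c x = c y.
Proof.
case=> con /acyclic_edges_acyclic ac.
have [c Fc] := acyclic_forest (@edges_sym t) (@edges_irr t) ac.
exists c => // x y; apply: (forest_connect_eq Fc).
have [r [p [px pl _]]] := con x y.
by apply/connectP; exists p => //; rewrite (eq_path (edge_rel_edges t)).
Qed.

Lemma forest_tree t c : forest (edges t) c -> (forall x y, c x = c y) -> is_tree t.
Proof.
move=> Fc cc; split; last by apply/acyclic_edges_acyclic; exact: forest_acyclic Fc.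
move=> x y; have /connectP[p pp pl] := forest_connect Fc (cc x y).
exists (size p), p; split=> //; by rewrite -(eq_path (edge_rel_edges t)).
Qed.

Lemma const_components c : 0 < n -> (forall x y, c x = c y) -> #|components c| = 1.
Proof.
move=> n0 cc; apply/eqP/cards1P; exists (c (Ordinal n0)).
apply/setP => z; rewrite inE; apply/imsetP/eqP => [[v _ ->]//|->].
by exists (Ordinal n0).
Qed.

Lemma card1_components c : #|components c| = 1 -> forall x y, c x = c y.
Proof.
move/eqP/cards1P => [z cz] x y.
have := mem_components c x; have := mem_components c y.
by rewrite cz !inE => /eqP -> /eqP ->.
Qed.

Lemma card_tree t : 0 < n -> is_tree t -> #|edges t| + 2 = 2 * n.
Proof.
move=> n0 /tree_forest[c Fc cc].
by have := card_forest Fc; rewrite (const_components n0 cc) card_ord.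
Qed.

Definition nbrs F v : {set V} := [set u | (v, u) \in F]%SET.

Lemma in_nbrs F v u : (u \in nbrs F v) = ((v, u) \in F).
Proof. by rewrite finset.in_set. Qed.

Definition fdegree F v : nat := #|nbrs F v|.

Lemma sum_fdegree F : \sum_v fdegree F v = #|F|.
Proof.
rewrite -sum1_card (partition_big (fun p : V * V => p.1) predT) //=.
apply: eq_bigr => v _; rewrite /fdegree -sum1_card.
rewrite (reindex_onto (fun u => (v, u)) (fun p => p.2)) /=; last first.
  by move=> [a b] /andP[_ /eqP /= ->].
by apply: eq_bigl => u; rewrite in_nbrs !eqxx !andbT.
Qed.

Lemma fdegree_edges t v : fdegree (edges t) v = degree t v.
Proof. by apply: eq_card => u; rewrite in_nbrs in_edges. Qed.

Lemma sum_degree t : 0 < n -> is_tree t -> \sum_v degree t v + 2 = 2 * n.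
Proof.
move=> n0 tt; rewrite -(card_tree n0 tt) -sum_fdegree.
by congr (_ + _); apply: eq_bigr => v _; rewrite fdegree_edges.
Qed.

Lemma fdegree_sub F G v : F \subset G -> fdegree F v <= fdegree G v.
Proof.
move=> FG; apply: subset_leq_card; apply/fintype.subsetP => u.
by rewrite !in_nbrs; exact: (fintype.subsetP FG).
Qed.

Lemma fdegree_add F c x y v : forest F c -> c x != c y ->
  fdegree (add_edge F x y) v = fdegree F v + (v == x) + (v == y).
Proof.
move=> Fc cxy; have [xyF yxF] := add_edge_notin Fc cxy.
have xy : x != y by apply: contra cxy => /eqP ->.
rewrite /fdegree; have [->|vx] := eqVneq v x.
  rewrite (negbTE xy) addn0 addn1.
  have -> : nbrs (add_edge F x y) x = y |: nbrs F x.
    by apply/setP => u; rewrite in_setU1 !in_nbrs in_add_edge eqxx (negbTE xy) /= orbF orbC.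
  by rewrite cardsU1 in_nbrs xyF.
have [->|vy] := eqVneq v y.
  rewrite addn0 addn1.
  have -> : nbrs (add_edge F x y) y = x |: nbrs F y.
    apply/setP => u; rewrite in_setU1 !in_nbrs in_add_edge eqxx [y == x]eq_sym.
    by rewrite (negbTE xy) /= orbC.
  by rewrite cardsU1 in_nbrs yxF.
rewrite !addn0; apply: eq_card => u.
by rewrite !in_nbrs in_add_edge (negbTE vx) (negbTE vy) /= orbF.
Qed.

Definition trees_over d F : {set lgraph n} :=
  [set t in trees_with_degrees d | F \subset edges t]%SET.

Lemma in_trees_over d F t : (t \in trees_over d F) =
  `[< is_tree t /\ forall i, degree t i = d i >] && (F \subset edges t).
Proof. by rewrite !finset.in_set. Qed.

Lemma trees_over_add d F t x y :
  (t \in trees_over d (add_edge F x y)) = (t \in trees_over d F) && t x y.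
Proof.
rewrite !in_trees_over -andbA; congr (_ && _).
rewrite /add_edge finset.subUset; congr (_ && _).
rewrite finset.subUset !finset.sub1set !in_edges.
by rewrite [t y x]adj_sym andbb.
Qed.

(** An edge of [t] outside [F] joins different components of [F], since otherwise it would close a
    cycle in [t]. *)
Lemma trees_over_adj d F c t x y : forest F c -> t \in trees_over d F ->
  t x y && (c x != c y) = ((x, y) \in edges t :\: F).
Proof.
move=> Fc; rewrite in_trees_over => /andP[/asboolP[[_ ac] _] Ft].
rewrite finset.in_setD in_edges andbC; case xy : (t x y); rewrite ?andbF// !andbT.
have [xyF|xyF] := boolP ((x, y) \in F); first by rewrite (forest_edge Fc xyF) eqxx.
rewrite (forest_acyclic_neq Fc Ft) ?in_edges//.
- exact: edges_sym.
- exact: edges_irr.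
- exact/acyclic_edges_acyclic.
Qed.

(** Both sides count pairs of a tree over [F] and an ordered edge of it outside [F]. A tree has
    2(n-1) ordered edges and [F] has 2(n-1-m), which leaves 2m for each tree. *)
Lemma double_count_trees d F c m : forest F c -> #|components c| = m.+1 ->
  0 < n ->
  \sum_x \sum_(y | c x != c y) #|trees_over d (add_edge F x y)| =
  2 * m * #|trees_over d F|.
Proof.
move=> Fc cm n0.
transitivity (\sum_(t in trees_over d F) 2 * m); last first.
  by rewrite sum_nat_const mulnC.
transitivity (\sum_x \sum_(y | c x != c y) \sum_(t in trees_over d F | t x y) 1).
  apply: eq_bigr => x _; apply: eq_bigr => y cxy; rewrite -sum1_card.
  by apply: eq_bigl => t; rewrite trees_over_add.
under eq_bigr => x _.
  rewrite (exchange_big_dep (mem (trees_over d F))) /=; last by move=> ? ? _ /andP[].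
  over.
rewrite exchange_big /=; apply: eq_bigr => t tF.
transitivity #|edges t :\: F|.
  rewrite -sum1_card (partition_big (fun p : V * V => p.1) predT) //=.
  apply: eq_bigr => x _.
  rewrite [RHS](reindex_onto (fun u => (x, u)) (fun p => p.2)) /=; last first.
    by move=> [a b] /andP[_ /eqP /= ->].
  apply: eq_bigl => y; rewrite !eqxx !andbT tF /= -(trees_over_adj _ _ Fc tF).
  by rewrite andbC.
move: tF; rewrite in_trees_over => /andP[/asboolP[tt _] Ft].
have := card_tree n0 tt; have := card_forest Fc; rewrite cm card_ord.
by rewrite cardsD (finset.setIidPr Ft); move: (#|F|) (#|edges t|) => a b; lia.
Qed.

Lemma trees_over_deg0 d F x : d x < fdegree F x -> trees_over d F = finset.set0.
Proof.
move=> h; apply/setP => t; rewrite in_trees_over inE; apply/negP.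
move=> /andP[/asboolP[_ dt] Ft]; have := fdegree_sub x Ft.
by rewrite fdegree_edges dt leqNgt h.
Qed.

Lemma card_trees_over1 d F c : 0 < n -> forest F c -> #|components c| = 1 ->
  (forall v, fdegree F v = d v) -> #|trees_over d F| = 1.
Proof.
move=> n0 Fc c1 Fd; have [t tF] := edges_surj (forest_sym Fc) (forest_irr Fc).
apply/eqP/cards1P; exists t; apply/setP => u; rewrite in_trees_over inE.
apply/idP/eqP => [/andP[/asboolP[ut _] Fu]|->].
  apply: edges_inj; rewrite tF; apply/esym/eqP; rewrite eqEcard Fu /=.
  have := card_tree n0 ut; have := card_forest Fc; rewrite c1 card_ord.
  by move: (#|F|) (#|edges u|) => a b; lia.
rewrite tF fintype.subxx andbT; apply/asboolP; split.
  by apply: (@forest_tree _ c); [rewrite tF|exact: card1_components].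
by move=> i; rewrite -fdegree_edges tF.
Qed.

End TreeCount.

Section TreeCountFormula.
Variable n : nat.
Notation V := 'I_n.
Implicit Types (t : lgraph n) (F : {set V * V}) (c : V -> V) (d r : V -> nat).

Local Open Scope ring_scope.

Definition residual d F v : nat := (d v - fdegree F v)%N.

Definition component_residual c r (j : V) : int := \sum_(v | c v == j) (r v)%:R.

(** Here [m] stands for the number of components minus one. The case 0 is apart: the forest is then
    already a tree. *)
Definition tree_count c r (m : nat) : int :=
  if m is m'.+1 then m'`!%:R * \prod_(j in components c) component_residual c r j
  else 1.

Lemma sum_component_residual c r :
  \sum_(j in components c) component_residual c r j = \sum_v (r v)%:R.
Proof.
rewrite [RHS](partition_big c (mem (components c))) //= => v _; exact: imset_f.
Qed.

Lemma residual_add d F c x y v : forest F c -> c x != c y ->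
  (fdegree F x < d x)%N -> (fdegree F y < d y)%N -> (fdegree F v <= d v)%N ->
  (residual d (add_edge F x y) v)%:R =
  (residual d F v)%:R - (v == x)%:R - (v == y)%:R :> int.
Proof.
move=> Fc cxy dx dy dv; rewrite /residual (fdegree_add _ Fc cxy).
have xy : x != y by apply: contra cxy => /eqP ->.
have [vx|vx] := eqVneq v x; have [vy|vy] := eqVneq v y;
  subst; rewrite ?eqxx ?(negbTE xy) ?(eq_sym y x) in xy *; lia.
Qed.

Lemma prod_fact_residual d F c x y : forest F c -> c x != c y ->
  (fdegree F x < d x)%N -> (fdegree F y < d y)%N ->
  (\prod_v (residual d F v)`! =
   residual d F x * residual d F y * \prod_v (residual d (add_edge F x y) v)`!)%N.
Proof.
move=> Fc cxy dx dy.
have xy : x != y by apply: contra cxy => /eqP ->.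
rewrite (bigD1 x) //= (bigD1 y) /=; last by rewrite eq_sym.
rewrite [in RHS](bigD1 x) //= [in RHS](bigD1 y) /=; last by rewrite eq_sym.
have e v : residual d (add_edge F x y) v = (residual d F v - (v == x) - (v == y))%N.
  by rewrite /residual (fdegree_add _ Fc cxy) !subnDA.
rewrite !e !eqxx (negbTE xy) eq_sym (negbTE xy) !subn0 !subn1.
have h v : (fdegree F v < d v)%N -> (residual d F v)`! = (residual d F v * (residual d F v).-1`!)%N.
  by rewrite /residual -subn_gt0; case: (d v - _)%N.
rewrite (h x dx) (h y dy) !mulnA.
have -> : (\prod_(i < n | (i != x) && (i != y)) (residual d (add_edge F x y) i)`! =
  \prod_(i < n | (i != x) && (i != y)) (residual d F i)`!)%N.
  by apply: eq_bigr => i /andP[/negbTE ix /negbTE iy]; rewrite e ix iy !subn0.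
by do 2 congr (_ * _)%N; exact: mulnAC.
Qed.

Lemma sum_indic_eq (P : pred V) x :
  \sum_(v | P v) ((v == x)%:R : int) = (P x)%:R.
Proof.
rewrite big_mkcond (bigD1 x) //= eqxx big1 ?addr0; last first.
  by move=> v /negbTE ->; case: ifP.
by case: (P x).
Qed.

Lemma component_residual_add d F c x y : forest F c -> c x != c y ->
  (fdegree F x < d x)%N -> (fdegree F y < d y)%N -> (forall v, (fdegree F v <= d v)%N) ->
  component_residual (merge_label c x y) (residual d (add_edge F x y)) (c x) =
  component_residual c (residual d F) (c x) + component_residual c (residual d F) (c y) - 2.
Proof.
move=> Fc cxy dx dy dF; rewrite /component_residual.
rewrite (eq_bigr _ (fun v _ => residual_add Fc cxy dx dy (dF v))).
rewrite 2!big_split /= !sumrN !sum_indic_eq.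
have mE v : (merge_label c x y v == c x) = (c v == c x) || (c v == c y).
  by rewrite /merge_label; case: (eqVneq (c v) (c y)) => [->|]; rewrite ?eqxx ?orbT ?orbF.
rewrite !mE !eqxx orbT /=.
rewrite (eq_bigl (fun v => (c v == c x) || (c v == c y))) //.
rewrite (bigID (fun v => c v == c x)) /=.
rewrite (eq_bigl (fun v => c v == c x)); last by move=> v; case: (c v == c x); rewrite ?andbF.
rewrite [X in _ + X - _ - _](eq_bigl (fun v => c v == c y)); last first.
  move=> v; case: (eqVneq (c v) (c x)) => [->|]; rewrite ?(negbTE cxy)//= ?andbT//.
lra.
Qed.

Lemma component_residual_other d F c x y j : forest F c -> c x != c y ->
  (fdegree F x < d x)%N -> (fdegree F y < d y)%N -> (forall v, (fdegree F v <= d v)%N) ->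
  j != c x -> j != c y ->
  component_residual (merge_label c x y) (residual d (add_edge F x y)) j =
  component_residual c (residual d F) j.
Proof.
move=> Fc cxy dx dy dF jx jy; rewrite /component_residual.
rewrite (eq_bigr _ (fun v _ => residual_add Fc cxy dx dy (dF v))).
have mE v : (merge_label c x y v == j) = (c v == j).
  rewrite /merge_label; case: (eqVneq (c v) (c y)) => [->|] //.
  by rewrite eq_sym (negbTE jx) eq_sym (negbTE jy).
rewrite (eq_bigl (fun v => c v == j)) // 2!big_split /= !sumrN !sum_indic_eq.
by rewrite eq_sym (negbTE jx) eq_sym (negbTE jy) !subr0.
Qed.

(** The value of [tree_count] after an edge has joined the components [j] and [k], as a function of
    the components alone. The joined component has lost two units of residual degree, hence the -2;
    values are in [int] so that this does not truncate. *)
Definition merge_weight c r m (j k : V) : int :=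
  (\prod_(l in components c :\ k :\ j) component_residual c r l) *
  (if m is m'.+1 then m'`!%:R * (component_residual c r j + component_residual c r k - 2) else 1).

Lemma tree_count_merge d F c x y m : forest F c -> c x != c y ->
  (fdegree F x < d x)%N -> (fdegree F y < d y)%N -> (forall v, (fdegree F v <= d v)%N) ->
  (m = 0%N -> #|components c| = 2%N) ->
  tree_count (merge_label c x y) (residual d (add_edge F x y)) m =
  merge_weight c (residual d F) m (c x) (c y).
Proof.
move=> Fc cxy dx dy dF m0; rewrite /tree_count /merge_weight.
have cxC : c x \in components c :\ c y by rewrite !inE cxy mem_components.
case: m m0 => [/(_ erefl) c2|m _].
  rewrite mulr1 big_pred0 // => l; apply/negbTE.
  have : #|components c :\ c y :\ c x| = 0%N.
    have := cardsD1 (c y) (components c); rewrite mem_components c2.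
    have := cardsD1 (c x) (components c :\ c y); rewrite cxC; lia.
  by move/eqP; rewrite cards_eq0 => /eqP ->; rewrite inE.
rewrite components_merge // (big_setD1 (c x) cxC) /=.
rewrite (component_residual_add Fc)//.
rewrite [X in _ * (_ * X) = _](eq_bigr (component_residual c (residual d F))); last first.
  by move=> l; rewrite !inE => /and3P[lx ly _]; apply: (component_residual_other Fc).
by rewrite mulrA mulrC.
Qed.

(** The factor b_j b_k completes the product over all components, and what remains is the sum of b_j
    + b_k - 2 over ordered pairs of distinct components. With m+2 components of total residual
    2(m+1) this sum is 2(m+1)m. *)
Lemma sum_merge_weight c r m : #|components c| = m.+2 ->
  (\sum_v (r v)%:R = (2 * m.+1)%:R :> int) ->
  \sum_(j in components c) \sum_(k in components c | j != k)
    component_residual c r j * component_residual c r k * merge_weight c r m j k =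
  (2 * m.+1)%:R * tree_count c r m.+1.
Proof.
move=> Cm sr; set b := component_residual c r; set C := components c in Cm *.
pose e j k := if m is m'.+1 then m'`!%:R * (b j + b k - 2) else 1 : int.
transitivity (\prod_(l in C) b l * \sum_(j in C) \sum_(k in C | j != k) e j k).
  rewrite big_distrr; apply: eq_bigr => j jC; rewrite big_distrr; apply: eq_bigr => k /andP[kC jk].
  by rewrite (prodD2 b jC kC jk) /= /merge_weight -/b -/C mulrA.
have cC j : j \in C -> #|[pred k | (k \in C) && (j != k)]| = m.+1.
  move=> jC; have := cardsD1 j C; rewrite jC Cm => -[->].
  by apply: eq_card => k; rewrite !inE andbC eq_sym.
suff -> : \sum_(j in C) \sum_(k in C | j != k) e j k = (2 * m.+1 * m`!)%:R.
  by rewrite /tree_count -/b -/C mulrC natrM -mulrA.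
rewrite /e; case: m Cm sr @e cC => [|m] Cm sr _ cC.
  transitivity (\sum_(j in C) (1 : int)).
    by apply: eq_bigr => j jC; rewrite sumr_const cC.
  by rewrite sumr_const Cm.
transitivity (m`!%:R * \sum_(j in C) \sum_(k in C | j != k) (b j + b k - 2)).
  by rewrite big_distrr; apply: eq_bigr => j _; rewrite big_distrr.
have sb : \sum_(j in C) b j = (2 * m.+2)%:R by rewrite sum_component_residual.
have -> : \sum_(j in C) \sum_(k in C | j != k) (b j + b k - 2) =
    \sum_(j in C) (m.+1%:R * b j + (2 * m.+2)%:R - (2 * m.+2)%:R).
  apply: eq_bigr => j jC; rewrite 2!big_split /= !sumr_const (cC _ jC).
  have -> : \sum_(k in C | j != k) b k = (2 * m.+2)%:R - b j.
    rewrite -sb (big_setD1 j jC) /= addrAC subrr add0r.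
    by apply: eq_bigl => k; rewrite !inE andbC eq_sym.
  rewrite -mulr_natl -[(-2) *+ _]mulr_natr !natrM -!natr1; lra.
rewrite (eq_bigr (fun j => m.+1%:R * b j)); last by move=> j _; rewrite addrK.
rewrite -big_distrr /= sb factS !natrM; lra.
Qed.

(** Induction on the number of components: the double count expresses the number of trees over [F]
    by the numbers over [F] with one more edge. For the empty forest and positive degrees this is
    the classical value (n-2)! divided by the product of the (d_v - 1)!. *)
Theorem count_trees_over d F c m : (0 < n)%N -> forest F c ->
  #|components c| = m.+1 -> (forall v, (fdegree F v <= d v)%N) ->
  (\sum_v d v + 2 = 2 * n)%N ->
  #|trees_over d F|%:R * (\prod_v (residual d F v)`!)%:R =
  tree_count c (residual d F) m.
Proof.
move=> n0; elim: m F c => [|m IH] F c Fc cm dF sd.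
  have sr : (\sum_v residual d F v = 0)%N.
    rewrite sumnB// sum_fdegree; have := card_forest Fc; rewrite cm card_ord.
    by move: (#|F|) => a; lia.
  have r0 v : residual d F v = 0%N.
    by apply/eqP; move/eqP: sr; rewrite sum_nat_eq0 => /forallP/(_ v).
  rewrite (card_trees_over1 n0 Fc cm); last first.
    by move=> v; apply/eqP; rewrite eqn_leq dF /= -subn_eq0 -/(residual d F v) r0.
  by rewrite big1 // => v _; rewrite r0.
have m20 : (2 * m.+1)%:R != 0 :> int by rewrite pnatr_eq0.
have sr : \sum_v (residual d F v)%:R = (2 * m.+1)%:R :> int.
  rewrite -natr_sum; congr (_%:R); rewrite sumnB// sum_fdegree.
  have := card_forest Fc; rewrite cm card_ord.
  by move: (#|F|) => a; lia.
apply: (mulfI m20); rewrite -sum_merge_weight// -sum_pairs_components mulrA -natrM.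
rewrite -(double_count_trees d Fc cm n0) natr_sum big_distrl; apply: eq_bigr => x _.
rewrite natr_sum big_distrl; apply: eq_bigr => y cxy /=.
(* If an end has no residual degree, no tree contains the new edge, and the factor on the other side
   is zero as well. *)
have [dx|dx] := ltnP (fdegree F x) (d x); last first.
  rewrite (@trees_over_deg0 _ _ _ x); last first.
    by rewrite (fdegree_add _ Fc cxy) eqxx; move: dx (dF x); lia.
  by rewrite cards0 /residual (eqP dx) !mul0r.
have [dy|dy] := ltnP (fdegree F y) (d y); last first.
  rewrite (@trees_over_deg0 _ _ _ y); last first.
    by rewrite (fdegree_add _ Fc cxy) eqxx; move: dy (dF y); lia.
  by rewrite cards0 /residual (eqP dy) mulr0 !mul0r.
have cm' : #|components (merge_label c x y)| = m.+1.
  by have := card_components_merge cxy; rewrite cm => -[].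
rewrite (prod_fact_residual Fc cxy dx dy) natrM mulrCA.
rewrite (IH _ _ (forest_add Fc cxy) cm')//; last first.
  move=> v; rewrite (fdegree_add _ Fc cxy).
  have xy : x != y by apply: contra cxy => /eqP ->.
  have [->|vx] := eqVneq v x; first by rewrite (negbTE xy); lia.
  by have [->|vy] := eqVneq v y; [lia | rewrite !addn0].
rewrite (tree_count_merge Fc)// ?natrM//.
by move=> m0; rewrite cm m0.
Qed.

(* The component of an isolated vertex [y] is [y] itself, so the formula for the
   number of trees changes only by the factors attached to [x] and [y]. *)
Lemma trees_over_add_isolated d F c x y m : (0 < n)%N -> forest F c ->
  #|components c| = m.+2 -> (forall v, (fdegree F v <= d v)%N) ->
  (\sum_v d v + 2 = 2 * n)%N -> c x != c y ->
  (fdegree F x < d x)%N -> (0 < d y)%N -> (forall v, c v = c y -> v = y) ->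
  #|trees_over d (add_edge F x y)|%:R * component_residual c (residual d F) (c x) * m%:R =
  #|trees_over d F|%:R * (residual d F x)%:R *
    (component_residual c (residual d F) (c x) + (d y)%:R - 2).
Proof.
move=> n0 Fc cm dF sd cxy dx dy yi.
have Fy0 : fdegree F y = 0%N.
  apply/eqP; rewrite /fdegree cards_eq0; apply/eqP/setP => u; rewrite in_nbrs inE.
  apply/negP => yu; have uy := yi u (esym (forest_edge Fc yu)).
  by move: yu (forest_irr Fc y); rewrite uy -/(edge_rel F y y) => ->.
have dy' : (fdegree F y < d y)%N by rewrite Fy0.
have cm' : #|components (merge_label c x y)| = m.+1.
  by have := card_components_merge cxy; rewrite cm => -[].
have dF' v : (fdegree (add_edge F x y) v <= d v)%N.
  rewrite (fdegree_add _ Fc cxy).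
  have xy : x != y by apply: contra cxy => /eqP ->.
  have [->|vx] := eqVneq v x; first by rewrite (negbTE xy); lia.
  by have [->|vy] := eqVneq v y; [lia | rewrite !addn0].
have N1 := count_trees_over n0 (forest_add Fc cxy) cm' dF' sd.
have N0 := count_trees_over n0 Fc cm dF sd.
rewrite (tree_count_merge Fc)// in N1; last by move=> m0; rewrite cm m0.
have ry : residual d F y = d y by rewrite /residual Fy0 subn0.
have by' : component_residual c (residual d F) (c y) = (d y)%:R.
  rewrite /component_residual (big_pred1 y) ?ry// => v; apply/eqP/eqP => [/yi//|->//].
have rE := prod_fact_residual Fc cxy dx dy'.
have sr : \sum_v (residual d F v)%:R = (2 * m.+1)%:R :> int.
  rewrite -natr_sum; congr (_%:R); rewrite sumnB// sum_fdegree.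
  have := card_forest Fc; rewrite cm card_ord.
  by move: (#|F|) => a; lia.
have P0 : (\prod_v (residual d (add_edge F x y) v)`!)%:R != 0 :> int.
  by rewrite pnatr_eq0 -lt0n prodn_gt0// => v; exact: fact_gt0.
have dy0 : (d y)%:R != 0 :> int by rewrite pnatr_eq0 -lt0n.
have rx0 : (residual d F x)%:R != 0 :> int by rewrite pnatr_eq0 -lt0n subn_gt0.
move: N0; rewrite rE ry /tree_count !natrM.
rewrite (prodD2 _ (mem_components c x) (mem_components c y) cxy) by'.
move: N1; rewrite /merge_weight by'.
set b := component_residual _ _ (c x); set P := \prod_(l in _) _.
set N1 := #|_|%:R; set N0 := #|_|%:R; set Q := (\prod_v _)%:R in P0 *.
move=> h1 h0; apply: (mulIf P0); apply: (mulIf dy0).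
(* With only two components the residual degrees sum to 2, so [b + (d y)%:R - 2] vanishes and both
   sides are zero. *)
case: m cm cm' sr h1 h0 => [|m] cm cm' sr h1 h0.
  rewrite mulr0 !mul0r.
  suff -> : b + (d y)%:R - 2 = 0 by rewrite mulr0 !mul0r.
  have := sum_component_residual c (residual d F); rewrite sr.
  rewrite (big_setD1 (c x) (mem_components c x)) /= (big_setD1 (c y)) /=; last first.
    by rewrite !inE eq_sym cxy mem_components.
  rewrite big_pred0; last first.
    move=> l; apply/negbTE.
    have : #|components c :\ c x :\ c y| = 0%N.
      have := cardsD1 (c x) (components c); rewrite mem_components cm.
      have := cardsD1 (c y) (components c :\ c x); rewrite !inE mem_components eq_sym cxy.
      by move: (#|_ :\ _|) (#|_ :\ _ :\ _|) => ? ?; lia.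
    by move/eqP; rewrite cards_eq0 => /eqP ->; rewrite inE.
  by rewrite by' -/b addr0 => ->; rewrite subrr.
transitivity (N1 * Q * (b * m.+1%:R * (d y)%:R)); first lra.
rewrite h1; apply: (mulIf rx0).
transitivity (N0 * ((residual d F x)%:R * (d y)%:R * Q) *
  (residual d F x)%:R * (b + (d y)%:R - 2)); last by lra.
rewrite h0 factS natrM; lra.
Qed.

End TreeCountFormula.

(** * Breadth-first codes of rooted trees *)

Section BreadthFirst.
Implicit Types (s : nat -> nat) (w : seq nat).

(** Vertices are numbered in breadth-first order and [s i] is the number of children of vertex [i].
    After the first [k] vertices are explored the numbers below [discovered s k] are in use, so the
    children of [k] occupy the interval from there to [discovered s k.+1]. *)
Definition discovered s k : nat := (\sum_(i < k) s i).+1.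

(** The vertex whose block of children contains [j]. The search stops before [j], and its value is
    [j] when nothing is found, as for the root. *)
Definition parent s j : nat := find (fun i => j < discovered s i.+1) (iota 0 j).

(** The number of vertices at distance less than [d] from the root: their children end at
    [discovered s (frontier s d)]. *)
Definition frontier s d : nat := iter d (discovered s) 0.

Lemma discoveredS s k : discovered s k.+1 = discovered s k + s k.
Proof. by rewrite /discovered big_ord_recr. Qed.

Lemma leq_discovered s i j : i <= j -> discovered s i <= discovered s j.
Proof.
move=> ij; rewrite -(subnK ij); elim: (j - i) => // m IH.
by rewrite addSn discoveredS (leq_trans IH)// leq_addr.
Qed.

Lemma eq_discovered s s' k j : (forall i, i < k -> s i = s' i) -> j <= k ->
  discovered s j = discovered s' j.
Proof.
move=> e jk; congr _.+1; apply: eq_bigr => i _; apply: e.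
exact: leq_trans (ltn_ord i) jk.
Qed.

Lemma frontierS s d : frontier s d.+1 = discovered s (frontier s d).
Proof. by []. Qed.

Lemma leq_frontierS s d : frontier s d <= frontier s d.+1.
Proof. by elim: d => // d IH; rewrite !frontierS leq_discovered. Qed.

Lemma leq_frontier s d e : d <= e -> frontier s d <= frontier s e.
Proof.
move=> de; rewrite -(subnK de); elim: (e - d) => // m IH.
by rewrite addSn (leq_trans IH)// leq_frontierS.
Qed.

(** A frontier is computed from the entries before the previous one, so the two can differ only
    after both have passed [k]. *)
Lemma eq_frontier s s' k d : (forall i, i < k -> s i = s' i) ->
  frontier s d = frontier s' d \/ k < frontier s d /\ k < frontier s' d.
Proof.
move=> e; elim: d => [|d [IH|[h1 h2]]]; first by left.
  have [dk|kd] := leqP (frontier s d) k.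
    by left; rewrite !frontierS -IH; exact: eq_discovered e dk.
  by right; split; [|rewrite IH in kd];
    apply: (leq_trans kd); rewrite leq_frontierS.
by right; split; apply: leq_trans (leq_frontierS _ _).
Qed.

(** If [frontier s d] is at most [j], then [frontier s d.+1] is at most [discovered s j] by
    monotonicity. A number below some frontier is thus one at which the exploration has not died
    out. *)
Lemma frontier_discovered s d j : j < frontier s d -> j < discovered s j.
Proof.
elim: d => // d IH jd; have [|/leq_discovered h] := ltnP j (frontier s d); first exact: IH.
by apply: (leq_trans jd); rewrite frontierS h.
Qed.

Lemma parent_ltn s j : 0 < j -> j < discovered s j -> parent s j < j.
Proof.
move=> j0 jd; have : has (fun i => j < discovered s i.+1) (iota 0 j).
  by apply/hasP; exists j.-1; rewrite ?mem_iota/= prednK// leqnn.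
by rewrite has_find size_iota.
Qed.

Lemma ltn_discovered_parent s j : 0 < j -> j < discovered s j ->
  j < discovered s (parent s j).+1.
Proof.
move=> j0 jd; have pj := parent_ltn j0 jd.
have h : has (fun i => j < discovered s i.+1) (iota 0 j).
  by rewrite has_find size_iota.
by have := nth_find 0 h; rewrite nth_iota.
Qed.

Lemma leq_discovered_parent s j : 0 < j -> j < discovered s j ->
  discovered s (parent s j) <= j.
Proof.
move=> j0 jd; case Ep : (parent s j) => [|p]; first by rewrite /discovered big_ord0.
have pj := parent_ltn j0 jd.
have := @before_find _ 0 (fun i => j < discovered s i.+1) (iota 0 j) p.
rewrite -/(parent s j) Ep nth_iota ?add0n//; last by move: pj; rewrite Ep; exact: ltnW.
by move=> /(_ (leqnn _)) /negbT; rewrite -leqNgt.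
Qed.

Lemma parent_unique s i j : i < j -> discovered s i <= j -> j < discovered s i.+1 ->
  parent s j = i.
Proof.
move=> ij ij1 ij2; have j0 : 0 < j by exact: leq_ltn_trans ij.
have jd : j < discovered s j by apply: (leq_trans ij2); exact: leq_discovered.
have h1 := ltn_discovered_parent j0 jd; have h2 := leq_discovered_parent j0 jd.
apply/eqP; rewrite eqn_leq; apply/andP; split; rewrite leqNgt; apply/negP => h.
  by have := leq_trans ij2 (leq_trans (leq_discovered s h) h2); rewrite ltnn.
by have := leq_trans h1 (leq_trans (leq_discovered s h) ij1); rewrite ltnn.
Qed.

Lemma parent_eqE s i j : 0 < j -> j < discovered s j ->
  (parent s j == i) = (discovered s i <= j < discovered s i.+1) && (i < j).
Proof.
move=> j0 jd; apply/eqP/idP => [<-|/andP[/andP[h1 h2] h3]]; last exact: parent_unique.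
by rewrite leq_discovered_parent// ltn_discovered_parent// parent_ltn.
Qed.

Lemma parent_ltn_of s k j : 0 < j -> j < discovered s j -> j < discovered s k ->
  parent s j < k.
Proof.
move=> j0 jd jk; rewrite ltnNge; apply/negP => /leq_discovered h.
by have := leq_trans jk (leq_trans (h s) (leq_discovered_parent j0 jd)); rewrite ltnn.
Qed.

Lemma eq_parent s s' k j : (forall i, i < k -> s i = s' i) -> 0 < j ->
  j < discovered s j -> j < discovered s k -> parent s j = parent s' j.
Proof.
move=> e j0 jd jk; have pk := parent_ltn_of j0 jd jk.
apply/esym/parent_unique; first exact: parent_ltn.
  by rewrite -(eq_discovered e (ltnW pk)) leq_discovered_parent.
by rewrite -(eq_discovered e pk) ltn_discovered_parent.
Qed.

Definition bfs_adj s : rel nat :=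
  fun i j => (i < j) && (parent s j == i) || (j < i) && (parent s i == j).

Lemma bfs_adj_sym s : symmetric (bfs_adj s).
Proof. by move=> i j; rewrite /bfs_adj orbC. Qed.

Lemma bfs_adj_irr s : irreflexive (bfs_adj s).
Proof. by move=> i; rewrite /bfs_adj ltnn. Qed.

Definition bfs_graph s : sgraph nat := SGraph (@bfs_adj_sym s) (@bfs_adj_irr s).

Lemma eq_bfs_adj s s' k i j : (forall i, i < k -> s i = s' i) ->
  (forall j, j < discovered s k -> j < discovered s j) ->
  i < discovered s k -> j < discovered s k -> bfs_adj s i j = bfs_adj s' i j.
Proof.
move=> e al ik jk; rewrite /bfs_adj.
congr (_ || _); apply: andb_id2l => h.
  by rewrite (eq_parent e _ (al _ jk) jk)//; exact: leq_ltn_trans h.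
by rewrite (eq_parent e _ (al _ ik) ik)//; exact: leq_ltn_trans h.
Qed.

Notation wsize w := (discovered (nth 0 w) (size w)).

Section BfsBall.
Variable w : seq nat.

Definition word_adj : rel 'I_(wsize w) := fun i j => bfs_adj (nth 0 w) i j.

Lemma word_adj_sym : symmetric word_adj.
Proof. by move=> i j; exact: bfs_adj_sym. Qed.

Lemma word_adj_irr : irreflexive word_adj.
Proof. by move=> i; exact: bfs_adj_irr. Qed.

(** The vertices are all those discovered by [w], including the last ones, whose own children [w]
    does not list. *)
Definition word_tree : rooted_graph :=
  RootedGraph (SGraph word_adj_sym word_adj_irr) (Ordinal (ltn0Sn _)).

End BfsBall.

Section DistLe.
Context {V : eqType}.
Variable G : sgraph V.

Lemma dist_leW r r' x y : r <= r' -> dist_le G r x y -> dist_le G r' x y.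
Proof. by move=> rr' [p [px pl ps]]; exists p; split=> //; exact: leq_trans rr'. Qed.

Lemma dist_le_rcons r x y z : dist_le G r x y -> G y z -> dist_le G r.+1 x z.
Proof.
move=> [p [px pl ps]] yz; exists (rcons p z); split.
- by rewrite rcons_path px pl.
- by rewrite last_rcons.
- by rewrite size_rcons.
Qed.

Lemma dist_le0 x y : dist_le G 0 x y -> y = x.
Proof. by move=> [[|? ?] [_ /= <- //]]. Qed.

Lemma dist_leS r x y : dist_le G r.+1 x y ->
  dist_le G r x y \/ exists2 z, dist_le G r x z & G z y.
Proof.
move=> [p]; case/lastP: p => [|p z]; first by move=> [_ /= -> _]; left; exact: dist_le_refl.
move=> [+ + +]; rewrite rcons_path last_rcons size_rcons => /andP[px pz] <- ps.
by right; exists (last x p) => //; exists p; split.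
Qed.

End DistLe.

Lemma inj_surj_bij (N : nat) (V : eqType) (f : 'I_N -> V) :
  injective f -> (forall y, exists j, f j = y) -> bijective f.
Proof.
move=> fi fs; case: N f fi fs => [|N] f fi fs.
  have h (y : V) : False by have [[]] := fs y.
  exists (fun y => match h y with end) => [j|y]; last by case: (h y).
  by have := ltn_ord j.
exists (fun y => odflt ord0 [pick j | f j == y]) => [j|y].
  by case: pickP => [i /eqP /fi //|/(_ j)]; rewrite eqxx.
by case: pickP => [i /eqP //|]; have [j <-] := fs y => /(_ j); rewrite eqxx.
Qed.

(** By induction on [d], the vertices at distance at most [d] from [v] are the images of the numbers
    below [frontier (nth 0 w) d.+1]. Explored vertices have no neighbours outside the image, and
    since [w] explores everything at distance less than [r], this suffices up to [r]. *)
Lemma word_tree_iso_ball (V : eqType) (G : sgraph V) (v : V) r w (f : 'I_(wsize w) -> V) :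
  injective f -> (forall j, val j = 0 -> f j = v) ->
  (forall i j, G (f i) (f j) = word_adj i j) ->
  (forall (i : 'I_(wsize w)) y, i < size w -> G (f i) y -> exists j, y = f j) ->
  size w = frontier (nth 0 w) r ->
  rooted_iso (word_tree w) (graph_ball G v r).
Proof.
move=> fi f0 fadj fnb wr.
have al j : j < wsize w -> j < discovered (nth 0 w) j.
  rewrite wr -frontierS; exact: frontier_discovered.
have fdist d : forall j : 'I_(wsize w), j < frontier (nth 0 w) d.+1 -> dist_le G d v (f j).
  elim: d => [|d IH] j.
    rewrite /frontier /= /discovered big_ord0 ltnS leqn0 => /eqP j0.
    by rewrite f0//; exact: dist_le_refl.
  rewrite frontierS => jd; have [j0|j0] := posnP (val j).
    by rewrite f0//; exact: dist_le_refl.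
  have jj := al _ (ltn_ord j).
  have pj := parent_ltn j0 jj.
  have pd : parent (nth 0 w) j < frontier (nth 0 w) d.+1 by exact: parent_ltn_of.
  have pw : parent (nth 0 w) j < wsize w by exact: ltn_trans (ltn_ord j).
  apply: (dist_le_rcons (IH (Ordinal pw) pd)).
  by rewrite fadj /word_adj /bfs_adj /= pj eqxx.
have fsurj d : d <= r -> forall y, dist_le G d v y ->
    exists2 j, f j = y & j < frontier (nth 0 w) d.+1.
  elim: d => [_|d IH dr] y.
    move=> /dist_le0 ->; exists (Ordinal (ltn0Sn _)); first exact: f0.
    by rewrite /frontier/= /discovered.
  move=> /dist_leS[/(IH (ltnW dr))[j jy jd]|[z /(IH (ltnW dr))[j jz jd]]].
    by exists j => //; apply: leq_trans (leq_frontierS _ _).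
  rewrite -jz => jy; have jw : j < size w.
    exact: leq_trans jd (leq_trans (leq_frontier _ dr) (eq_leq (esym wr))).
  have [k yk] := fnb _ _ jw jy; exists k => //; move: jy; rewrite yk fadj /word_adj.
  case/orP=> /andP[jk /eqP pk].
    have k0 : 0 < (k : nat) by exact: leq_ltn_trans jk.
    have := ltn_discovered_parent k0 (al _ (ltn_ord k)); rewrite pk => h.
    by rewrite frontierS; apply: (leq_trans h); exact: leq_discovered.
  by apply: (ltn_trans jk); apply: (leq_trans jd); exact: leq_frontierS.
have fr j : dist_le G r v (f j).
  by apply: fdist; rewrite frontierS -wr.
pose F (j : rooted_vertex (word_tree w)) : rooted_vertex (graph_ball G v r) :=
  exist _ (f j) (asboolT (fr j)).
exists F; split.
- apply: inj_surj_bij => [i j [/fi //]|[y yr]].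
  have /asboolP yr' := yr.
  by have [j jy _] := fsurj _ (leqnn _) _ yr'; exists j; apply: val_inj.
- by apply: val_inj => /=; exact: f0.
- by move=> i j; exact: fadj.
Qed.

End BreadthFirst.

Section CountAdjacent.
Implicit Types (s : nat -> nat) (w : seq nat).

Lemma sum_ltn_interval K a b : \sum_(j < K) (a <= j < b) = minn K b - a.
Proof.
elim: K => [|K IH]; first by rewrite big_ord0 min0n.
by rewrite big_ord_recr /= IH; lia.
Qed.

(** The neighbours of [i] are its parent, unless [i] is the root, and its block of children, cut off
    at [K]. *)
Lemma sum_bfs_adj s K i : (forall j, 0 < j < K -> j < discovered s j) -> i < K ->
  \sum_(j < K) bfs_adj s i j = (0 < i) + (minn K (discovered s i.+1) - discovered s i).
Proof.
move=> al iK.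
transitivity (\sum_(j < K) ((j < i) && (parent s i == j)) +
              \sum_(j < K) ((i < j) && (parent s j == i))).
  rewrite -big_split; apply: eq_bigr => j _; rewrite /bfs_adj /=.
  by case: ltngtP; rewrite ?andbF ?addn0 ?orbF.
congr (_ + _).
  have [->|i0] := posnP i; first by rewrite big1.
  have ip : parent s i < i by apply: parent_ltn => //; apply: al; rewrite i0.
  rewrite (bigD1 (Ordinal (ltn_trans ip iK))) //= ip eqxx big1 // => j jp.
  apply/eqP; rewrite eqb0 negb_and orbC; apply/orP; left.
  by apply: contra jp => /eqP e; apply/eqP/val_inj.
rewrite -sum_ltn_interval; apply: eq_bigr => j _; congr nat_of_bool.
apply/andP/idP => [[ij]|/andP[h1 h2]].
  rewrite parent_eqE; [by move=> /andP[]|exact: leq_ltn_trans ij|].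
  by apply: al; rewrite ltn_ord (leq_ltn_trans _ ij).
have ij : i < j.
  apply: leq_trans h1; have [->|i0] := posnP i; first by rewrite /discovered.
  by apply: al; rewrite i0.
split=> //; rewrite parent_eqE ?h1 ?h2 ?ij//.
  exact: leq_ltn_trans ij.
by apply: al; rewrite ltn_ord (leq_ltn_trans _ ij).
Qed.

Lemma sum_index (T : finType) (p : seq T) (Q : nat -> bool) : uniq p ->
  #|[pred u | (u \in p) && Q (index u p)]| = \sum_(j < size p) Q j.
Proof.
move=> up; rewrite -sum1_card big_mkcondr /= -big_uniq //=.
case: p up => [|x0 p'] up; first by rewrite big_nil big_ord0.
set p := x0 :: p' in up *.
rewrite (big_nth x0) big_mkord; apply: eq_bigr => j _.
by rewrite index_uniq//; case: (Q j).
Qed.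

End CountAdjacent.

Section Words.
Implicit Types (w : seq nat).

Notation disc w := (discovered (nth 0 w)).
Notation par w := (parent (nth 0 w)).

Lemma nth_rcons_lt w s i : i < size w -> nth 0 (rcons w s) i = nth 0 w i.
Proof. by move=> h; rewrite nth_rcons h. Qed.

(** Some discovered vertex is unexplored at every stage, including the end: the word can be
    continued. *)
Definition alive w := forall j, j <= size w -> j < disc w j.

Lemma disc_rcons w s j : j <= size w -> disc (rcons w s) j = disc w j.
Proof. by move=> h; apply: (@eq_discovered _ _ (size w)) => // i; exact: nth_rcons_lt. Qed.

Lemma disc_rconsS w s : disc (rcons w s) (size w).+1 = disc w (size w) + s.
Proof. by rewrite discoveredS disc_rcons// nth_rcons ltnn eqxx. Qed.

Lemma alive_rcons w s : alive (rcons w s) -> alive w.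
Proof.
by move=> h j jw; rewrite -(disc_rcons s jw); apply: h; rewrite size_rcons leqW.
Qed.

Lemma par_rcons w s j : alive w -> 0 < j <= size w -> par (rcons w s) j = par w j.
Proof.
move=> al /andP[j0 jw]; apply/esym/(@eq_parent _ _ (size w)) => //.
- by move=> i iw; rewrite nth_rcons_lt.
- exact: al.
- by apply: leq_trans (al _ jw) _; apply: leq_discovered.
Qed.

(** The next vertex has number [size w]; this counts the children of its parent that are still to be
    numbered. *)
Definition branch w := disc w (par w (size w)).+1 - size w.

Lemma par_lt w : alive w -> 0 < size w -> par w (size w) < size w.
Proof. by move=> al k0; apply: parent_ltn => //; exact: al. Qed.

Lemma branch_gt0 w : alive w -> 0 < size w -> 0 < branch w.
Proof.
by move=> al k0; rewrite subn_gt0 ltn_discovered_parent//; exact: al.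
Qed.

(** When siblings may be taken in any order, position j has [branch (take j w)] candidates, so a
    random exploration produces each list of vertices coded by [w] with probability one over
    [orders w]. *)
Definition orders w := \prod_(1 <= j < size w) branch (take j w).

Lemma orders_rcons w s : 0 < size w -> orders (rcons w s) = orders w * branch w.
Proof.
move=> k0; rewrite /orders size_rcons big_nat_recr //=; congr (_ * _).
  apply: eq_big_nat => j /andP[_ jk]; congr branch.
  by rewrite -cats1 takel_cat// ltnW.
by rewrite -cats1 take_size_cat.
Qed.

Lemma alive_take w j : alive w -> alive (take j w).
Proof.
elim/last_ind: w => [|w s IH]; first by rewrite take_oversize.
move=> al; have [jk|kj] := leqP j (size w).
  by rewrite -cats1 takel_cat//; apply/IH/alive_rcons/al.
by rewrite take_oversize// size_rcons.
Qed.

Lemma orders_gt0 w : alive w -> 0 < orders w.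
Proof.
move=> al; rewrite /orders big_seq prodn_cond_gt0// => j; rewrite mem_index_iota => /andP[j0 jk].
apply: branch_gt0; first exact: alive_take.
by rewrite size_take jk.
Qed.

(** Letters count children; a vertex other than the root has in addition the edge to its parent. *)
Definition word_degrees w : seq nat := if w is s :: w' then s :: map succn w' else [::].

Lemma size_word_degrees w : size (word_degrees w) = size w.
Proof. by case: w => //= s w; rewrite size_map. Qed.

Lemma word_degrees_rcons w s : 0 < size w ->
  word_degrees (rcons w s) = rcons (word_degrees w) s.+1.
Proof. by case: w => //= a w _; rewrite map_rcons. Qed.

Lemma nth_word_degrees w i : i < size w -> nth 0 (word_degrees w) i = nth 0 w i + (0 < i).
Proof.
case: w => // a w; case: i => [|i] /= h; first by rewrite addn0.
by rewrite (nth_map 0)// addn1.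
Qed.

End Words.

Notation disc w := (discovered (nth 0 w)).
Notation par w := (parent (nth 0 w)).

(** * The forest that a word prescribes on a list of vertices, and the trees over it *)

Section Patterns.
Variable n : nat.
Notation V := 'I_n.+1.
Implicit Types (t : lgraph n.+1) (F : {set V * V}) (c : V -> V) (d : V -> nat)
  (p : seq V) (w : seq nat).

Notation nthp p i := (nth ord0 p i).

Definition pattern w p : {set V * V} :=
  [set q | [&& q.1 \in p, q.2 \in p & bfs_adj (nth 0 w) (index q.1 p) (index q.2 p)]]%SET.

Lemma in_pattern w p x y : ((x, y) \in pattern w p) =
  [&& x \in p, y \in p & bfs_adj (nth 0 w) (index x p) (index y p)].
Proof. by rewrite inE. Qed.

Lemma pattern1 a x : pattern [:: a] [:: x] = finset.set0.
Proof.
apply/setP => -[u v]; rewrite in_pattern !inE.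
by apply/negP => /and3P[/eqP -> /eqP ->]; rewrite bfs_adj_irr.
Qed.

Lemma index_rcons_notin p x y : y \notin p -> x \in rcons p y ->
  index x (rcons p y) = if x == y then size p else index x p.
Proof.
move=> yp; rewrite mem_rcons inE -cats1 index_cat => /orP[/eqP ->|xp].
  by rewrite (negbTE yp) eqxx /= eqxx addn0.
by rewrite xp; case: eqP => // xy; move: yp; rewrite -xy xp.
Qed.

Lemma bfs_adj_rcons w s i j : alive w -> i <= size w -> j <= size w ->
  bfs_adj (nth 0 (rcons w s)) i j = bfs_adj (nth 0 w) i j.
Proof.
move=> al iw jw; rewrite /bfs_adj.
by congr (_ || _); apply: andb_id2l => h; rewrite par_rcons// ?iw ?jw andbT;
  exact: leq_ltn_trans h.
Qed.

Lemma bfs_adj_last w i : i < size w ->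
  bfs_adj (nth 0 w) i (size w) = (par w (size w) == i).
Proof. by move=> h; rewrite /bfs_adj h ltnNge (ltnW h) orbF. Qed.

Lemma pattern_rcons w s p y : alive w -> 0 < size w -> size p = size w ->
  uniq p -> y \notin p ->
  pattern (rcons w s) (rcons p y) = add_edge (pattern w p) (nthp p (par w (size w))) y.
Proof.
move=> al k0 pk up yp; have pw := par_lt al k0.
have xE u : u \in p -> (u == nthp p (par w (size w))) = (par w (size w) == index u p).
  move=> hu; apply/eqP/eqP => [->|->]; first by rewrite index_uniq// pk.
  by rewrite nth_index.
apply/setP => -[u v]; rewrite in_add_edge !in_pattern !mem_rcons !inE.
have ix u' : u' \in p -> index u' (rcons p y) = index u' p.
  move=> h; rewrite index_rcons_notin// ?mem_rcons ?inE ?h ?orbT//.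
  by case: eqP => // e; move: yp; rewrite -e h.
have iy : index y (rcons p y) = size w.
  by rewrite index_rcons_notin// ?mem_rcons ?inE eqxx.
have iw u' : index u' p <= size w by rewrite -pk index_size.
have [->|uy] := eqVneq u y; have [->|vy] := eqVneq v y.
- rewrite /= bfs_adj_irr (negbTE yp) /=.
  have : nthp p (par w (size w)) \in p by rewrite mem_nth// pk.
  rewrite andbT [y == _]eq_sym; case: eqP => // -> ; by rewrite (negbTE yp).
- rewrite (negbTE yp) /= andbF /=; have [vp|vp] := boolP (v \in p); last first.
    by rewrite /=; apply/esym/negP => /eqP e; move: vp; rewrite e mem_nth// pk.
  rewrite /= (ix v vp) iy bfs_adj_sym bfs_adj_rcons//.
  by rewrite bfs_adj_last ?xE// -pk index_mem.
- rewrite (negbTE yp) andbF /= andbT orbF; have [up'|up'] := boolP (u \in p); last first.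
    by rewrite /=; apply/esym/negP => /eqP e; move: up'; rewrite e mem_nth// pk.
  rewrite /= (ix u up') iy bfs_adj_rcons//.
  by rewrite bfs_adj_last ?xE// -pk index_mem.
- rewrite /= andbF !orbF; apply: andb_id2l => up'; apply: andb_id2l => vp.
  by rewrite !ix// bfs_adj_rcons// -pk ltnW// index_mem.
Qed.

Lemma fdegree_pattern F0 w p i : uniq p -> size p = size w -> alive w -> i < size w ->
  discovered (nth 0 w) i <= size w <= discovered (nth 0 w) i.+1 ->
  (forall u, (nthp p i, u) \notin F0) ->
  fdegree (F0 :|: pattern w p) (nthp p i) = (0 < i) + (size w - disc w i).
Proof.
move=> up pk al ik /andP[h1 h2] iso.
have -> : fdegree (F0 :|: pattern w p) (nthp p i) = \sum_(j < size w) bfs_adj (nth 0 w) i j.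
  transitivity (\sum_(j < size p) bfs_adj (nth 0 w) i j); last by rewrite pk.
  rewrite -sum_index//; apply: eq_card => u.
  rewrite in_nbrs finset.in_setU (negbTE (iso u)) /= in_pattern inE /= mem_nth ?pk//.
  by rewrite index_uniq// pk.
rewrite sum_bfs_adj//; last by move=> j /andP[_ jk]; apply/al/ltnW.
by rewrite (minn_idPl h2).
Qed.

End Patterns.

Section PatternForest.
Variable n : nat.
Notation V := 'I_n.+1.
Implicit Types (t : lgraph n.+1) (F : {set V * V}) (c : V -> V) (d : V -> nat)
  (p : seq V) (w : seq nat).
Notation nthp p i := (nth ord0 p i).

(** Unlike [alive], this lets the exploration be complete exactly at the end of the word. *)
Definition prealive w := forall j, j < size w -> j < disc w j.

Lemma prealive_rcons w s : prealive (rcons w s) <-> alive w.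
Proof.
split=> h j jw; first by rewrite -(disc_rcons s jw); apply: h; rewrite size_rcons ltnS.
by move: jw; rewrite size_rcons ltnS => jw; rewrite disc_rcons//; exact: h.
Qed.

Lemma alive_prealive w : alive w -> prealive w.
Proof. by move=> h j /ltnW; exact: h. Qed.

Definition isolated c p := forall x u, x \in p -> c u = c x -> u = x.

Lemma isolated_edge F c p x u : forest F c -> isolated c p -> x \in p -> (x, u) \notin F.
Proof.
move=> Fc ip xp; apply/negP => xu.
have := ip x u xp (esym (forest_edge Fc xu)) => e.
by move: (forest_irr Fc x); rewrite /edge_rel -{2}e xu.
Qed.

Lemma mem_nthp_par w p : alive w -> 0 < size w -> size p = size w ->
  nthp p (par w (size w)) \in p.
Proof. by move=> al k0 pk; rewrite mem_nth// pk par_lt. Qed.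

Local Open Scope ring_scope.

Lemma combine_counts (N N' N0 b m v P o r e : int) :
  N * v * P = N0 * o * b -> N' * b * m = N * r * e ->
  N' * v * (P * m) * b = N0 * (o * r) * e * b.
Proof.
move=> cnt key; transitivity (N' * b * m * (v * P)); first by rewrite -!mulrA; lia.
rewrite key; transitivity (N * v * P * (r * e)); first by lia.
by rewrite cnt; lia.
Qed.

(** The vertices of [p] are attached one by one. Each is isolated when its turn comes, and its
    parent has residual degree [branch], so by [trees_over_add_isolated] the count is multiplied by
    [branch] times b'/(b m), where b and b' are the residual degrees of the growing component before
    and after. The b telescope: the first is the root letter, the last is [disc w (size w)] minus
    [size w]. A general starting forest [F0] allows a second pattern to be added to a first one. *)
Lemma pattern_forest d F0 c0 w p :
  forest F0 c0 -> (forall v, (fdegree F0 v <= d v)%N) ->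
  (\sum_v d v + 2 = 2 * n.+1)%N ->
  prealive w -> (0 < size w)%N -> size p = size w -> uniq p -> isolated c0 p ->
  [seq d x | x <- p] = word_degrees w ->
  let F := F0 :|: pattern w p in
  exists c, [/\ forest F c, {in p, forall x, c x = c (nthp p 0)},
    forall u, c u = c (nthp p 0) -> u \in p,
    forall u, u \notin p -> c u = c0 u &
    (#|components c| + size w = (#|components c0|).+1)%N] /\
    [/\ forall v, (fdegree F v <= d v)%N,
     component_residual c (residual d F) (c (nthp p 0)) = (disc w (size w))%:R - (size w)%:R &
     #|trees_over d F|%:R * (nth 0 w 0)%N%:R *
       \prod_(1 <= j < size w) (#|components c0|%:R - 1 - j%:R) =
     #|trees_over d F0|%:R * (orders w)%:R * ((disc w (size w))%:R - (size w)%:R) :> int].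
Proof.
move=> Fc0 dF0 sd; elim/last_ind: w p => // w s IH p /prealive_rcons al _.
case/lastP: p => [|p y]; rewrite !size_rcons => // -[pk].
rewrite rcons_uniq => /andP[yp up] iso; rewrite map_rcons.
case: (posnP (size w)) => [w0|k0].
  have pn : p = [::] by apply/nilP; rewrite /nilp pk w0.
  have wn : w = [::] by apply/nilP; rewrite /nilp w0.
  subst p w => /= -[dy].
  rewrite pattern1 finset.setU0; exists c0; split; split=> //.
  - by move=> x; rewrite inE => /eqP ->.
  - by move=> u e; rewrite inE; apply/eqP; exact: (iso y u (mem_head _ _) e).
  - by rewrite addn1.
  - rewrite /component_residual (big_pred1 y); last first.
      by move=> v; apply/eqP/eqP => [e|-> //]; exact: (iso y v (mem_head _ _) e).
    rewrite /residual /fdegree (_ : nbrs F0 y = finset.set0) ?cards0; last first.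
      apply/setP => u; rewrite in_nbrs inE; apply/negbTE.
      exact: (isolated_edge u Fc0 iso (mem_head y [::])).
    by rewrite subn0 dy discoveredS /discovered big_ord0 /=; lia.
  - rewrite big_geq // mulr1 /orders big_geq // mulr1 discoveredS /discovered big_ord0 /=.
    by congr (_ * _); lia.
rewrite word_degrees_rcons// => /eqP; rewrite eqseq_rcons => /andP[/eqP dp /eqP dy].
have isop : isolated c0 p by move=> x u xp; apply: iso; rewrite mem_rcons inE xp orbT.
have [c [[Fc cp cp' cn cm] [dF cb cnt]]] := IH p (alive_prealive al) k0 pk up isop dp.
have p0 : nthp p 0 \in p by rewrite mem_nth// pk.
have e0 : nthp (rcons p y) 0 = nthp p 0 by rewrite nth_rcons pk k0.
set x := nthp p (par w (size w)).
have xp : x \in p by exact: mem_nthp_par.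
have cy : c y = c0 y by exact: cn.
have cyi v : c v = c y -> v = y.
  move=> e; have [vp|vp] := boolP (v \in p).
    by move: yp; rewrite cp' // -e cp.
  by apply: iso; rewrite ?mem_rcons ?mem_head// -cy -e cn.
have cxy : c x != c y.
  by apply/negP => /eqP e; move: yp; rewrite -(cyi _ e) xp.
have FE : F0 :|: pattern (rcons w s) (rcons p y) = add_edge (F0 :|: pattern w p) x y.
  by rewrite pattern_rcons// /add_edge finset.setUA.
have hw : (disc w (par w (size w)) <= size w < disc w (par w (size w)).+1)%N.
  by rewrite leq_discovered_parent ?ltn_discovered_parent//; exact: al.
(* So far the parent has the edge to its own parent, if any, and the children numbered below
   [size w]. *)
have resx : residual d (F0 :|: pattern w p) x = branch w.
  rewrite /residual (fdegree_pattern up pk al).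
  - have -> : d x = nth 0%N (word_degrees w) (par w (size w)).
      by rewrite -dp (nth_map ord0) ?pk// par_lt.
    rewrite nth_word_degrees ?par_lt// /branch discoveredS.
    by move: hw; rewrite discoveredS; lia.
  - exact: par_lt.
  - by case/andP: hw => -> /ltnW ->.
  - by move=> u; exact: (isolated_edge _ Fc0 isop).
have bw0 := branch_gt0 al k0.
have dx : (fdegree (F0 :|: pattern w p) x < d x)%N by rewrite -subn_gt0 -/(residual _ _ _) resx.
have Fy0 : fdegree (F0 :|: pattern w p) y = 0%N.
  apply/eqP; rewrite /fdegree cards_eq0; apply/eqP/setP => u; rewrite in_nbrs finset.in_set0.
  apply/negP => yu; have uy := cyi u (esym (forest_edge Fc yu)).
  by move: yu (forest_irr Fc y); rewrite uy -/(edge_rel _ y y) => ->.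
have dy' : (fdegree (F0 :|: pattern w p) y < d y)%N by rewrite Fy0 dy.
have ry : component_residual c (residual d (F0 :|: pattern w p)) (c y) = s.+1%:R.
  rewrite /component_residual (big_pred1 y) => [|v]; last first.
    by apply/eqP/eqP => [/cyi|->].
  by rewrite /residual Fy0 subn0 dy.
have mE : merge_label c x y (nthp p 0) = c x.
  by rewrite /merge_label; case: ifP => //; rewrite (cp x xp).
rewrite FE e0; exists (merge_label c x y); split; split.
- exact: forest_add.
- move=> v; rewrite mE mem_rcons inE /merge_label => /orP[/eqP ->|vp].
    by rewrite eqxx.
  by case: ifP => // _; rewrite (cp x xp) cp.
- move=> u; rewrite mE mem_rcons inE /merge_label.
  case: eqP => [/cyi -> _|_ e]; first by rewrite eqxx.
  by rewrite cp' ?orbT// e cp.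
- move=> u; rewrite mem_rcons inE negb_or => /andP[uy up']; rewrite /merge_label.
  by case: eqP => [/cyi /eqP|]; rewrite ?(negbTE uy)// cn.
- by have := card_components_merge cxy; move: cm; lia.
- move=> v; rewrite (fdegree_add _ Fc cxy).
  have xy : x != y by apply: contra cxy => /eqP ->.
  have [->|vx] := eqVneq v x; first by rewrite (negbTE xy); lia.
  by have [->|vy] := eqVneq v y; [lia | rewrite !addn0].
- rewrite mE (component_residual_add Fc)// (cp x xp) cb ry disc_rconsS; lia.
have n0 : (0 < n.+1)%N by [].
have [m cm2] : exists m, #|components c| = m.+2.
  have h : (1 < #|components c|)%N.
    have <- : #|[set c x; c y]%SET| = 2%N by rewrite cards2 cxy.
    apply: subset_leq_card; apply/fintype.subsetP => z; rewrite !inE.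
    by case/orP => /eqP ->; exact: mem_components.
  by exists (#|components c| - 2)%N; lia.
have dy0 : (0 < d y)%N by rewrite dy.
have := trees_over_add_isolated n0 Fc cm2 dF sd cxy dx dy0 cyi.
rewrite (cp x xp) cb resx dy => key.
have mk : #|components c0|%:R - 1 - (size w)%:R = m%:R :> int by move: cm; rewrite cm2; lia.
rewrite disc_rconsS big_nat_recr //= mk orders_rcons// nth_rcons k0.
have b0 : (disc w (size w))%:R - (size w)%:R != 0 :> int.
  by have := al _ (leqnn (size w)); lia.
apply: (mulIf b0).
set b := _ - (size w)%:R in cnt key b0 *.
have bE : (disc w (size w) + s)%:R - (size w).+1%:R = b + s.+1%:R - 2 by rewrite /b; lia.
rewrite bE; move: cnt key; set P := \prod_(1 <= j < _) _.
set N' := #|trees_over _ (add_edge _ _ _)|%:R; set N := #|trees_over _ (_ :|: _)|%:R.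
set N0 := #|trees_over _ _|%:R => cnt key.
by rewrite natrM; exact: combine_counts cnt key.
Qed.

End PatternForest.

(** * Embeddings of words in finite trees *)

Section Embeddings.
Variable n : nat.
Notation V := 'I_n.+1.
Implicit Types (t : lgraph n.+1) (p : seq V) (w : seq nat).
Notation nthp p i := (nth ord0 p i).

Definition embeds t w p : bool :=
  [&& size p == size w, uniq p, [seq degree t x | x <- p] == word_degrees w &
      pattern w p \subset edges t].

Lemma embeds_size t w p : embeds t w p -> size p = size w.
Proof. by case/and4P => /eqP. Qed.

Lemma embeds_uniq t w p : embeds t w p -> uniq p.
Proof. by case/and4P. Qed.

Lemma degree_embeds t w p i : embeds t w p -> i < size w ->
  degree t (nthp p i) = nth 0 w i + (0 < i).
Proof.
case/and4P => /eqP pk _ /eqP dp _ ik.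
by rewrite -nth_word_degrees// -dp (nth_map ord0)// pk.
Qed.

Lemma embeds_rcons t w s p y : alive w -> 0 < size w ->
  embeds t (rcons w s) (rcons p y) =
  [&& embeds t w p, y \notin p, t (nthp p (par w (size w))) y & degree t y == s.+1].
Proof.
move=> al k0; rewrite /embeds !size_rcons eqSS rcons_uniq map_rcons.
case: eqP => //= pk; rewrite word_degrees_rcons// eqseq_rcons.
case up : (uniq p); rewrite ?andbF//= andbT.
have [yp|yp] := boolP (y \in p); rewrite /= ?andbF//.
rewrite pattern_rcons// /add_edge finset.subUset [X in _ && (_ && X)]finset.subUset.
rewrite !finset.sub1set !in_edges [t y _]adj_sym andbb.
by rewrite -!andbA; congr (_ && _); rewrite andbC -andbA.
Qed.

Lemma embeds_forest t w p : is_tree t -> prealive w -> 0 < size w -> embeds t w p ->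
  exists2 c, forest (pattern w p) c & {in p, forall x, c x = c (nthp p 0)}.
Proof.
move=> tt al k0 /and4P[/eqP pk up /eqP dp _].
have d0 v : fdegree finset.set0 v <= degree t v.
  rewrite /fdegree (_ : nbrs finset.set0 v = finset.set0) ?cards0//.
  by apply/setP => u; rewrite in_nbrs !finset.in_set0.
have iso : isolated id p by move=> x u _ /=.
have [c [[Fc cp _ _ _] _]] :=
  pattern_forest (forest0 V) d0 (sum_degree (ltn0Sn n) tt) al k0 pk up iso dp.
by exists c => //; rewrite finset.set0U in Fc.
Qed.

(** An embedding is automatically induced: the pattern is connected, so an extra edge of [t] between
    its vertices would close a cycle. *)
Lemma embeds_adj t w p i j : is_tree t -> prealive w -> embeds t w p ->
  i < size w -> j < size w -> t (nthp p i) (nthp p j) = bfs_adj (nth 0 w) i j.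
Proof.
move=> tt al e ik jk; have k0 : 0 < size w by exact: leq_ltn_trans ik.
have [c Fc cp] := embeds_forest tt al k0 e.
have pk := embeds_size e; have up := embeds_uniq e.
have ip : nthp p i \in p by rewrite mem_nth ?pk.
have jp : nthp p j \in p by rewrite mem_nth ?pk.
have <- : ((nthp p i, nthp p j) \in pattern w p) = bfs_adj (nth 0 w) i j.
  by rewrite in_pattern ip jp /= !index_uniq ?pk.
have [_ _ _ sub] := and4P e; apply/idP/idP => [tij|/(fintype.subsetP sub)]; last first.
  by rewrite in_edges.
apply: contraT => npat.
have tij' : (nthp p i, nthp p j) \in edges t by rewrite in_edges.
have ac := (acyclic_edges_acyclic t).2 tt.2.
have := forest_acyclic_neq Fc sub (@edges_sym _ t) (@edges_irr _ t) ac tij' npat.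
by rewrite (cp _ ip) (cp _ jp) eqxx.
Qed.

Lemma card_embeds_nbrs t w p i : is_tree t -> prealive w -> embeds t w p ->
  i < size w -> #|[pred u | (u \in p) && t (nthp p i) u]| =
    (0 < i) + (minn (size w) (disc w i.+1) - disc w i).
Proof.
move=> tt al e ik; have pk := embeds_size e; have up := embeds_uniq e.
rewrite -sum_bfs_adj//; last by move=> j /andP[_ jk]; exact: al.
transitivity (\sum_(j < size p) bfs_adj (nth 0 w) i j); last by rewrite pk.
rewrite -sum_index//; apply: eq_card => u; rewrite !inE; apply: andb_id2l => hu.
by rewrite -(embeds_adj tt al e ik) ?nth_index// -pk index_mem.
Qed.

(** The degree of the parent is fixed by [w], and its neighbours inside [p] are known because the
    embedding is induced; the others are the candidates. *)
Lemma card_embeds_extend t w p : is_tree t -> alive w -> 0 < size w -> embeds t w p ->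
  #|[pred y | (y \notin p) && t (nthp p (par w (size w))) y]| = branch w.
Proof.
move=> tt al k0 e; set i := par w (size w).
have ik : i < size w by exact: par_lt.
have := card_embeds_nbrs tt (alive_prealive al) e ik.
have hi : disc w i <= size w by apply: leq_discovered_parent => //; exact: al.
have hi' : size w < disc w i.+1 by apply: ltn_discovered_parent => //; exact: al.
rewrite (minn_idPl (ltnW hi')) => h1.
have := cardID (mem p) (t (nthp p i)).
have -> : #|[predI t (nthp p i) & mem p]| = #|[pred u | (u \in p) && t (nthp p i) u]|.
  by apply: eq_card => u; rewrite !inE andbC.
have -> : #|[predD t (nthp p i) & mem p]| = #|[pred y | (y \notin p) && t (nthp p i) y]|.
  by apply: eq_card => u; rewrite !inE.
rewrite h1.
have -> : #|t (nthp p i)| = degree t (nthp p i) by [].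
rewrite (degree_embeds e ik) /branch -/i discoveredS in hi' *.
by move: (#|_|) => a; lia.
Qed.

Lemma degree_gt0 t x y : t x y -> 0 < degree t y.
Proof. by move=> xy; apply/card_gt0P; exists x; rewrite inE adj_sym. Qed.

Lemma disc_cat w u j : j <= size w -> disc (w ++ u) j = disc w j.
Proof.
move=> jk; apply: (@eq_discovered _ _ (size w)) => // i ik.
by rewrite nth_cat ik.
Qed.

Lemma prealive_cat w u : prealive w -> size (w ++ u) <= disc w (size w) -> prealive (w ++ u).
Proof.
move=> al sz j jk; have [jw|wj] := ltnP j (size w).
  by rewrite disc_cat ?al// ltnW.
apply: leq_trans jk (leq_trans sz _).
by rewrite -(disc_cat u (leqnn _)) leq_discovered.
Qed.

(** As long as a discovered vertex is not in the list, [branch] is positive and a vertex of [t] can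
    be appended; its letter is its degree minus one. *)
Lemma embeds_fill t w p K : is_tree t -> prealive w -> 0 < size w -> embeds t w p ->
  size w + K <= disc w (size w) ->
  exists u q, embeds t (w ++ u) (p ++ q) /\ size u = K.
Proof.
move=> tt al k0 e; elim: K => [|K IH] hK; first by exists [::], [::]; rewrite !cats0.
have [|u [q [e' uK]]] := IH; first by apply: leq_trans hK; rewrite leq_add2l.
have al' : alive (w ++ u).
  apply/(prealive_rcons _ 0); rewrite -cats1 -catA; apply: prealive_cat => //.
  by rewrite !size_cat /= uK addn1.
have k0' : 0 < size (w ++ u) by rewrite size_cat ltn_addr.
have : 0 < branch (w ++ u) by exact: branch_gt0.
rewrite -(card_embeds_extend tt al' k0' e') => /card_gt0P[y]; rewrite inE => /andP[yp ty].
exists (rcons u (degree t y).-1), (rcons q y); rewrite -!rcons_cat size_rcons uK.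
by rewrite embeds_rcons// e' yp ty /= prednK ?eqxx//; exact: degree_gt0 ty.
Qed.

(** The embedding is extended to all discovered vertices, which gives the map required by
    [word_tree_iso_ball]. *)
Theorem embeds_ball_iso t w p r : is_tree t -> 0 < size w -> embeds t w p ->
  size w = frontier (nth 0 w) r ->
  rooted_iso (word_tree w) (graph_ball t (nthp p 0) r).
Proof.
move=> tt k0 e wr.
have al : prealive w by move=> j jk; apply: (@frontier_discovered _ r); rewrite -wr.
have alN j : j < disc w (size w) -> j < disc w j.
  by move=> h; apply: (@frontier_discovered _ r.+1); rewrite frontierS -wr.
have kN : size w <= disc w (size w).
  by rewrite {1}wr; apply: (leq_trans (leq_frontierS _ _)); rewrite frontierS -wr.
have [|u [q [e' uK]]] := @embeds_fill t w p (disc w (size w) - size w) tt al k0 e.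
  by rewrite subnKC.
have sz : size (w ++ u) = disc w (size w) by rewrite size_cat uK subnKC.
have al' : prealive (w ++ u) by apply: prealive_cat => //; rewrite sz.
have pk := embeds_size e.
pose f (j : 'I_(disc w (size w))) := nthp (p ++ q) j.
have fadj i j : t (f i) (f j) = word_adj i j.
  rewrite (embeds_adj tt al' e') ?sz//; apply/esym/(@eq_bfs_adj _ _ (size w)) => // k kw.
  by rewrite nth_cat kw.
apply: (@word_tree_iso_ball _ t (nthp p 0) r w f) => //.
- move=> i j fij; apply/val_inj/eqP; rewrite -(nth_uniq ord0 _ _ (embeds_uniq e')) ?(embeds_size e') ?sz ?ltn_ord//.
  by apply/eqP; exact: fij.
- by move=> j j0; rewrite /f [nat_of_ord j]j0 nth_cat pk k0.
- move=> i y ik ty; have iN : i < size (w ++ u) by rewrite sz.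
  have dE : disc (w ++ u) i.+1 = disc w i.+1 by exact: disc_cat.
  have := card_embeds_nbrs tt al' e' iN; rewrite dE (disc_cat _ (ltnW ik)) sz.
  rewrite (minn_idPr _); last exact: leq_discovered.
  rewrite discoveredS addKn => h.
  (* The neighbours of an explored vertex inside the embedding already make up its full degree, so
     it has no others. *)
  have : [pred u0 | (u0 \in p ++ q) && t (nthp (p ++ q) i) u0] \subset t (nthp (p ++ q) i).
    by apply/fintype.subsetP => z; rewrite inE => /andP[].
  move/subset_cardP => hs.
  have : #|[pred u0 | (u0 \in p ++ q) && t (nthp (p ++ q) i) u0]| = #|t (nthp (p ++ q) i)|.
    rewrite h; have -> : #|t (nthp (p ++ q) i)| = degree t (nthp (p ++ q) i) by [].
    by rewrite (degree_embeds e' iN) nth_cat ik addnC.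
  move=> hc; have /esym := hs hc y; rewrite inE [X in X = _]ty => /esym/andP[yp _].
  have iy : index y (p ++ q) < disc w (size w) by rewrite -sz -(embeds_size e') index_mem.
  by exists (Ordinal iy); rewrite /f /= nth_index.
Qed.

End Embeddings.

(** * Enumeration of the words that describe a ball *)

Section Explore.
Implicit Types (w u : seq nat) (r B f : nat).

Definition active r w : bool := size w < frontier (nth 0 w) r.

Lemma active_alive r w : active r w -> alive w.
Proof. by move=> a j jw; apply: (@frontier_discovered _ r); exact: leq_ltn_trans a. Qed.

Lemma frontier_rcons r w s : active r w -> size w < frontier (nth 0 (rcons w s)) r.
Proof.
move=> a; have [|e|[]//] := @eq_frontier (nth 0 w) (nth 0 (rcons w s)) (size w) r _.
  by move=> i iw; rewrite nth_rcons iw.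
by rewrite -e.
Qed.

(** All continuations of [w] by letters below [B], stopped when the ball of radius [r] is complete;
    [f] bounds the number of added letters. *)
Fixpoint explore r B f w : seq (seq nat) :=
  if f is f'.+1 then
    if active r w then flatten [seq explore r B f' (rcons w s) | s <- iota 0 B]
    else [:: w]
  else [:: w].

Lemma explore_sum (R : nmodType) r B f w (g : seq nat -> R) :
  (forall u, active r u -> g u = (\sum_(s < B) g (rcons u s))%R) ->
  (\sum_(u <- explore r B f w) g u)%R = g w.
Proof.
move=> gS; elim: f w => [|f IH] w /=; first by rewrite big_seq1.
case: ifPn => aw; last by rewrite big_seq1.
rewrite big_flatten big_map (gS _ aw) /= -(big_mkord xpredT (fun s => g (rcons w s))).
by rewrite /index_iota subn0; apply: eq_bigr.
Qed.

Lemma mem_explore r B f w u : size w <= frontier (nth 0 w) r -> u \in explore r B f w ->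
  size u <= frontier (nth 0 u) r /\ (active r u -> size u = size w + f).
Proof.
elim: f w => [|f IH] w wr /=; first by rewrite inE => /eqP ->; rewrite addn0.
case: ifPn => aw; last first.
  by rewrite inE => /eqP ->; rewrite (negbTE aw).
case/flattenP => s /mapP[i _ ->] /IH[]; first by rewrite size_rcons frontier_rcons.
by rewrite size_rcons addSnnS.
Qed.

Definition complete r w : bool := size w == frontier (nth 0 w) r.

Lemma complete_prealive r w : complete r w -> prealive w.
Proof. by move=> /eqP wr j jk; apply: (@frontier_discovered _ r); rewrite -wr. Qed.

Lemma complete_gt0 r w : 0 < r -> complete r w -> 0 < size w.
Proof.
move=> r0 /eqP ->; apply: (@leq_trans (frontier (nth 0 w) 1)); first by [].
exact: leq_frontier.
Qed.

Definition ball_words r B (Q : pred (seq nat)) : seq (seq nat) :=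
  [seq u <- explore r B B.+1 [::] | complete r u && Q u].

(** A weight that splits over the next letter has total equal to the weight of the empty word. Words
    cut off by the bound have length [B.+1] and weight zero. *)
Lemma ball_words_sum (R : pzSemiRingType) r B (Q : pred (seq nat)) (g : seq nat -> R) :
  g [::] = 1%R ->
  (forall u, active r u -> g u = (\sum_(s < B) g (rcons u s))%R) ->
  (forall u, active r u -> B < size u -> g u = 0%R) ->
  (forall u, complete r u -> ~~ Q u -> g u = 0%R) ->
  (\sum_(u <- ball_words r B Q) g u)%R = 1%R.
Proof.
move=> g0 gS gB gQ; rewrite /ball_words big_filter -g0.
rewrite -(explore_sum B.+1 [::] gS) [RHS](bigID (fun u => complete r u && Q u)).
rewrite -[LHS]addr0; congr (_ + _)%R; apply/esym; rewrite big_seq_cond.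
apply: big1 => u /andP[ue].
have [] := mem_explore _ ue; first by [].
rewrite add0n leq_eqVlt => /orP[cu _|au].
  by rewrite [complete r u]cu /= => /(gQ _ cu).
by move=> /(_ au) su _; apply: gB => //; rewrite su.
Qed.

Lemma ball_words_sum0 (R : nmodType) r B (Q : pred (seq nat)) (g : seq nat -> R) :
  (forall u, complete r u -> Q u -> g u = 0%R) ->
  (\sum_(u <- ball_words r B Q) g u)%R = 0%R.
Proof. by move=> h; rewrite big_filter big1// => u /andP[]; exact: h. Qed.

Lemma complete_ball_words r B Q u : u \in ball_words r B Q -> complete r u && Q u.
Proof. by rewrite mem_filter => /andP[]. Qed.

End Explore.

Section SumTuples.
Variables (T : finType) (R : nmodType).
Local Open Scope ring_scope.

(** The summand is a function of plain lists, so that the length may be an expression such as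
    [size w] and tuples grow by [rcons]. *)
Definition sum_tuples k (F : seq T -> R) : R := \sum_(p : k.-tuple T) F p.

Lemma sum_tuples0 F : sum_tuples 0 F = F [::].
Proof.
rewrite /sum_tuples (big_pred1 [tuple]) //= => p; by apply/esym/eqP; rewrite tuple0.
Qed.

Lemma sum_tuplesS k F :
  sum_tuples k.+1 F = sum_tuples k (fun p => \sum_y F (rcons p y)).
Proof.
rewrite /sum_tuples pair_big /=.
pose h (q : k.-tuple T * T) : k.+1.-tuple T := [tuple of rcons q.1 q.2].
have hK (p : k.+1.-tuple T) : exists q, h q = p.
  case: p => s; case/lastP: s => // s y sz.
  have sk : size s == k by move: sz; rewrite size_rcons.
  by exists (Tuple sk, y); apply: val_inj.
have hi : injective h.
  move=> [q1 y1] [q2 y2] /(congr1 val) /= /eqP; rewrite eqseq_rcons.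
  by move=> /andP[/eqP e /eqP ->]; congr pair; apply: val_inj.
have hb : bijective h.
  by apply: inj_card_bij => //; rewrite card_prod !card_tuple expnSr.
rewrite (reindex h) /=; last by exact: onW_bij.
by apply: eq_bigr => -[q y] _.
Qed.

Lemma eq_sum_tuples k F G : (forall p, size p = k -> F p = G p) ->
  sum_tuples k F = sum_tuples k G.
Proof. by move=> h; apply: eq_bigr => p _; apply: h; rewrite size_tuple. Qed.

End SumTuples.

(** * Ball frequencies as weighted counts of embeddings *)

Definition size_bound (F : rooted_graph) M : Prop :=
  exists h : rooted_vertex F -> 'I_M, injective h.

Lemma finite_size_bound F : finite_rooted_graph F -> exists M, size_bound F M.
Proof.
move=> /finite_setP[M /card_set_bijP[f [fM fi _]]].
have fM' x : f x < M by exact: (fM x).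
exists M, (fun x => Ordinal (fM' x)) => x y /(congr1 val) /= fxy.
by apply: fi; rewrite ?inE.
Qed.

Lemma size_bound_iso F H M : rooted_iso H F -> size_bound F M -> size_bound H M.
Proof.
by move=> [f [bf _ _]] [h hi]; exists (h \o f); apply: inj_comp => //; exact: bij_inj.
Qed.

Lemma word_tree_size_bound w M : size_bound (word_tree w) M -> disc w (size w) <= M.
Proof. by move=> [h hi]; have := leq_card h hi; rewrite !card_ord. Qed.

Section TreeWeight.
Variable (R : realType) (n : nat).
Notation V := 'I_n.+1.
Implicit Types (t : lgraph n.+1) (p : seq V) (w : seq nat) (v : V).
Notation nthp p i := (nth ord0 p i).

Lemma embeds_dist t w p d j : prealive w -> embeds t w p ->
  j < size w -> j < frontier (nth 0 w) d.+1 -> dist_le t d (nthp p 0) (nthp p j).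
Proof.
move=> al e; have pk := embeds_size e; have [_ _ _ sub] := and4P e.
elim: d j => [|d IH] j jk.
  rewrite /frontier /= /discovered big_ord0 ltnS leqn0 => /eqP ->; exact: dist_le_refl.
rewrite frontierS => jd; have [->|j0] := posnP j; first exact: dist_le_refl.
have jj := al _ jk; have pj := parent_ltn j0 jj.
have pd : par w j < frontier (nth 0 w) d.+1 by exact: parent_ltn_of.
have pw : par w j < size w by exact: ltn_trans jk.
apply: (dist_le_rcons (IH _ pw pd)).
rewrite -in_edges; apply: (fintype.subsetP sub); rewrite in_pattern !mem_nth ?pk//=.
by rewrite !index_uniq ?pk// ?(embeds_uniq e)// /bfs_adj pj eqxx.
Qed.

Definition ball_set t v r : {set V} := [set y | `[< dist_le t r v y >]]%SET.

Lemma in_ball_set t v r y : reflect (dist_le t r v y) (y \in ball_set t v r).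
Proof. by rewrite inE; exact: asboolP. Qed.

Lemma card_ball_set t v r F M : rooted_iso (graph_ball t v r) F -> size_bound F M ->
  #|ball_set t v r| <= M.
Proof.
move=> /size_bound_iso h /h[f fi].
pose g (y : V) : rooted_vertex (graph_ball t v r) := insubd (ball_root t v r) y.
have gK y : y \in ball_set t v r -> val (g y) = y.
  by move=> /in_ball_set yb; rewrite val_insubd; case: asboolP.
have fgi : {in ball_set t v r &, injective (f \o g)}.
  by move=> x y xb yb /fi /(congr1 val); rewrite !gK.
by rewrite -(card_in_imset fgi) (leq_trans (max_card _))// card_ord.
Qed.

Lemma degree_lt_ball t v r y : dist_le t r v y -> degree t y < #|ball_set t v r.+1|.
Proof.
move=> vy; have <- : #|y |: nbrs (edges t) y| = (degree t y).+1.
  by rewrite cardsU1 in_nbrs in_edges adj_irr -fdegree_edges.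
apply: subset_leq_card; apply/fintype.subsetP => z; rewrite in_setU1 in_nbrs in_edges.
move=> /orP[/eqP ->|yz]; apply/in_ball_set; first exact: dist_leW vy.
exact: dist_le_rcons vy yz.
Qed.

Local Open Scope ring_scope.

Definition embeddings t w : R :=
  sum_tuples (size w) (fun p : seq V => (embeds t w p)%:R).

Definition rooted_embeddings t v w : R :=
  sum_tuples (size w) (fun p : seq V => (embeds t w p && (nthp p 0 == v))%:R).

(* the probability that [w] is the beginning of the word of degrees read off in
   breadth-first order from [v], when the children are ordered at random *)
Definition exploration_weight t v w : R :=
  if w is [::] then 1 else rooted_embeddings t v w / (orders w)%:R.

Lemma sum_exploration_weight t w : (0 < size w)%N ->
  \sum_v exploration_weight t v w = embeddings t w / (orders w)%:R.
Proof.
case: w => // s w' _; rewrite -big_distrl /=; congr (_ / _).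
rewrite /rooted_embeddings /embeddings /sum_tuples exchange_big; apply: eq_bigr => p _.
rewrite (bigD1 (nthp p 0)) //= eqxx andbT big1 ?addr0// => v /negbTE.
by rewrite eq_sym => ->; rewrite andbF.
Qed.

Lemma rooted_embeddings_neq0 t v w : rooted_embeddings t v w != 0 ->
  exists2 p, embeds t w p & nthp p 0 = v.
Proof.
have [[p ep pv]|h] := pselect (exists2 p, embeds t w p & nthp p 0 = v).
  by move=> _; exists p.
case/eqP; rewrite /rooted_embeddings /sum_tuples big1// => p _.
by case: andP => // -[ep /eqP pv]; case: h; exists p.
Qed.

Lemma exploration_weight_neq0 t v w : (0 < size w)%N -> exploration_weight t v w != 0 ->
  exists2 p, embeds t w p & nthp p 0 = v.
Proof.
case: w => // s w _ h; apply: rooted_embeddings_neq0.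
by apply: contra h => /eqP h; rewrite /exploration_weight h mul0r.
Qed.

Lemma rooted_embeddings_rcons t v w s : alive w -> (0 < size w)%N ->
  rooted_embeddings t v (rcons w s) =
  sum_tuples (size w) (fun p : seq V => (embeds t w p && (nthp p 0 == v))%:R *
     \sum_y [&& y \notin p, t (nthp p (par w (size w))) y & degree t y == s.+1]%:R).
Proof.
move=> al k0; rewrite /rooted_embeddings size_rcons sum_tuplesS.
apply: eq_sum_tuples => p pk; rewrite mulr_sumr; apply: eq_bigr => y _.
rewrite embeds_rcons// nth_rcons pk k0 -natrM mulnb; congr (_%:R); congr nat_of_bool.
exact: andbAC.
Qed.

(** Each embedding of [w] extends in exactly [branch w] ways, and [orders] grows by the same
    factor. *)
Lemma exploration_weight_step t v w r M : is_tree t -> (0 < r)%N ->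
  (#|ball_set t v r| <= M)%N -> active r w ->
  exploration_weight t v w = \sum_(s < M) exploration_weight t v (rcons w s).
Proof.
case: r => // r tt _ bM aw; have al := active_alive aw.
have [w0|k0] := posnP (size w).
  have -> : w = [::] by apply/nilP; rewrite /nilp w0.
  have dM : (degree t v < M)%N.
    by apply: leq_trans bM; apply: degree_lt_ball; exact: dist_le_refl.
  rewrite /= (bigD1 (Ordinal dM)) //= big1 ?addr0 => [|s sd].
    rewrite /rooted_embeddings sum_tuplesS sum_tuples0 /orders big_geq// divr1.
    rewrite (bigD1 v) //= big1 ?addr0 => [|y /negbTE yv]; last by rewrite yv andbF.
    by rewrite /embeds /= pattern1 finset.sub0set !eqxx.
  rewrite /rooted_embeddings sum_tuplesS sum_tuples0 big1 ?mul0r// => y _.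
  rewrite /embeds /=; case: (eqVneq y v) => [->|]; rewrite ?andbF// andbT.
  case: eqP => // -[e]; move: sd; rewrite -e => /eqP[]; exact/val_inj.
have -> : exploration_weight t v w = rooted_embeddings t v w / (orders w)%:R.
  by case: w k0 {aw al}.
rewrite (eq_bigr (fun s : 'I_M => rooted_embeddings t v (rcons w s) /
    (orders w * branch w)%:R)); last first.
  move=> s _; rewrite -(orders_rcons s k0).
  by case: w k0 {aw al}.
rewrite -big_distrl /= natrM invfM mulrA; apply: (canRL (mulfK _)).
  by rewrite pnatr_eq0 -lt0n branch_gt0.
rewrite mulrAC; congr (_ / _).
rewrite (eq_bigr _ (fun s _ => rooted_embeddings_rcons t v _ al k0)).
rewrite /rooted_embeddings /sum_tuples exchange_big big_distrl; apply: eq_bigr => p _ /=.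
rewrite -mulr_sumr; have [/andP[ep /eqP pv]|_] := boolP (embeds _ _ _ && _); last by rewrite !mul0r.
congr (_ * _); rewrite exchange_big -(card_embeds_extend tt al k0 ep) -sum1_card natr_sum.
rewrite big_mkcond; apply: eq_bigr => y _; rewrite inE.
have [/andP[yp ty]|h] := boolP (_ && _); last first.
  by rewrite big1// => s _; rewrite andbA (negbTE h).
have [p_ pk'] : (degree t y).-1.+1 = degree t y /\ size p = size w.
  by rewrite prednK ?(degree_gt0 ty)// size_tuple.
(* The new vertex is still at distance less than the radius, so all its neighbours lie in the ball,
   which has at most [M] vertices. *)
have dM : ((degree t y).-1 < M)%N.
  rewrite p_; apply: leq_trans bM; apply: ltnW; apply: degree_lt_ball; rewrite -pv.
  have ep' : embeds t (rcons w (degree t y).-1) (rcons p y).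
    by rewrite embeds_rcons// ep yp ty p_ eqxx.
  have -> : nthp p 0 = nthp (rcons p y) 0 by rewrite nth_rcons pk' k0.
  have {2}-> : y = nthp (rcons p y) (size w) by rewrite nth_rcons pk' ltnn eqxx.
  apply: (embeds_dist _ ep'); first by apply/prealive_rcons.
    by rewrite size_rcons.
  exact: frontier_rcons.
have /= ty' := ty.
rewrite (bigD1 (Ordinal dM)) // yp ty' /= p_ eqxx big1 ?addr0// => s sd.
case: eqP => //= e; move: sd => /eqP[]; apply/val_inj => /=.
by rewrite e.
Qed.

(** An embedding of an active word consists of distinct vertices of the ball. *)
Lemma exploration_weight_large t v w r M : (#|ball_set t v r| <= M)%N -> (0 < r)%N ->
  active r w -> (M < size w)%N -> exploration_weight t v w = 0.
Proof.
case: r => // r bM _ aw Mk; apply/eqP/negPn/negP.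
move=> /(exploration_weight_neq0 (leq_ltn_trans (leq0n _) Mk))[p ep pv].
have : (size p <= #|ball_set t v r.+1|)%N.
  rewrite -(card_uniqP (embeds_uniq ep)); apply: subset_leq_card.
  apply/fintype.subsetP => y yp; apply/in_ball_set; rewrite -pv.
  have iy : (index y p < size w)%N by rewrite -(embeds_size ep) index_mem.
  rewrite -[in X in dist_le _ _ _ X](nth_index ord0 yp).
  apply: (dist_leW (leqnSn r)); apply: (embeds_dist _ ep iy).
    exact/alive_prealive/active_alive/aw.
  exact: ltn_trans aw.
by rewrite (embeds_size ep) => /(leq_trans Mk); rewrite ltnNge bM.
Qed.

(** A complete word of nonzero weight codes the ball at [v]. If that ball is [F], all complete words
    that count are in the list and their probabilities sum to one; otherwise none of the listed
    words has weight. *)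
Theorem exploration_ball t v r F M : is_tree t -> (0 < r)%N -> size_bound F M ->
  \sum_(u <- ball_words r M (fun u => `[< rooted_iso (word_tree u) F >]))
     exploration_weight t v u = `[< rooted_iso (graph_ball t v r) F >]%:R.
Proof.
move=> tt r0 FM.
have wball u : complete r u -> exploration_weight t v u != 0 ->
    rooted_iso (word_tree u) (graph_ball t v r).
  move=> cu; have u0 := complete_gt0 r0 cu => /(exploration_weight_neq0 u0)[p ep <-].
  by apply: embeds_ball_iso => //; exact/eqP.
case: asboolP => [bF|bF] /=.
  have bM := card_ball_set bF FM.
  apply: ball_words_sum => [//|u|u|u cu].
  - exact: exploration_weight_step.
  - exact: exploration_weight_large.
  - apply: contraNeq => /(wball _ cu) h; apply/asboolP.
    exact: rooted_iso_trans h bF.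
apply: ball_words_sum0 => u cu /asboolP uF; apply/eqP; apply: contraT => /(wball _ cu) h.
by case: bF; apply: rooted_iso_trans uF; exact: rooted_iso_sym.
Qed.

Theorem ball_frequency_exploration t r F M : is_tree t -> (0 < r)%N -> size_bound F M ->
  ball_frequency R r F t =
  \sum_(u <- ball_words r M (fun u => `[< rooted_iso (word_tree u) F >]))
    embeddings t u / (orders u)%:R / n.+1%:R.
Proof.
move=> tt r0 FM; rewrite /ball_frequency -big_distrl /=; congr (_ / _).
rewrite -sum1_card natr_sum big_mkcond /=.
transitivity (\sum_v (`[< rooted_iso (graph_ball t v r) F >]%:R : R)).
  by apply: eq_bigr => v _; rewrite inE; case: asboolP.
rewrite (eq_bigr _ (fun x _ => esym (exploration_ball x tt r0 FM))).
rewrite exchange_big big_seq [RHS]big_seq; apply: eq_bigr => u.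
move=> /complete_ball_words/andP[/(complete_gt0 r0) u0 _].
exact: sum_exploration_weight.
Qed.

End TreeWeight.

(** * First and second moments of the number of embeddings *)

Section Moments.
Variable (R : realType) (n : nat).
Notation V := 'I_n.+1.
Implicit Types (t u : lgraph n.+1) (p q : seq V) (w : seq nat) (v : V).
Notation nthp p i := (nth ord0 p i).
Local Open Scope ring_scope.

Variable mu : lgraph n.+1 -> R.

Definition degree_prob p (ds : seq nat) : R :=
  \sum_t mu t * ([seq degree t x | x <- p] == ds)%:R.

(** What is used of the law of the random tree, as a weight function on a finite set: uniformity
    enters as equal weights for trees of equal degrees. *)
Record tree_law : Prop := TreeLaw {
  tree_law_ge0 : forall t, 0 <= mu t;
  tree_law_sum : \sum_t mu t = 1;
  tree_law_tree : forall t, mu t != 0 -> is_tree t;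
  tree_law_uniform : forall t u, is_tree t -> is_tree u -> degree t =1 degree u ->
    mu t = mu u;
  tree_law_exchangeable : forall p q ds, uniq p -> uniq q -> size p = size q ->
    degree_prob p ds = degree_prob q ds }.

Hypothesis mu_law : tree_law.

Lemma degree_class t u : (t \in trees_with_degrees (degree u)) =
  `[< is_tree t /\ degree t =1 degree u >].
Proof. by rewrite finset.in_set. Qed.

Lemma trees_over0 d : trees_over d finset.set0 = trees_with_degrees d :> {set lgraph n.+1}.
Proof. by apply/setP => t; rewrite finset.in_set finset.sub0set andbT. Qed.

Lemma tree_law_average (C : pred (lgraph n.+1)) (F : {set V * V}) (a b : R) :
  (forall t u, degree t =1 degree u -> C t = C u) ->
  (forall t, is_tree t -> C t ->
     #|trees_over (degree t) F|%:R * a = #|trees_over (degree t) finset.set0|%:R * b) ->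
  (\sum_t mu t * (C t && (F \subset edges t))%:R) * a = (\sum_t mu t * (C t)%:R) * b.
Proof.
move=> CE H.
pose T t := trees_with_degrees (degree t).
have inT t : is_tree t -> t \in T t by move=> tt; rewrite degree_class; apply/asboolP.
have TE t u : t \in T u -> is_tree t /\ degree t =1 degree u.
  by rewrite degree_class => /asboolP.
have Tsym t u : is_tree u -> t \in T u -> u \in T t.
  by move=> uu /TE[tt e]; rewrite degree_class; apply/asboolP; split=> // i; rewrite e.
have T0 t : is_tree t -> #|T t|%:R != 0 :> R.
  by move=> tt; rewrite pnatr_eq0 -lt0n; apply/card_gt0P; exists t; exact: inT.
have cT t u : is_tree u -> t \in T u -> T t = T u.
  move=> uu tu; apply/setP => z; rewrite !degree_class; have [_ e] := TE _ _ tu.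
  by apply/asboolP/asboolP => -[zz ez]; split=> // i; rewrite ez e.
(* The weight of [t] is spread evenly over its degree class; after the two sums are exchanged, each
   class contributes its number of trees over [F]. *)
have mass t : is_tree t -> mu t = \sum_(u in T t) mu u / #|T t|%:R.
  move=> tt; rewrite (eq_bigr (fun=> mu t / #|T t|%:R)) => [|u /TE[uu e]]; last first.
    by congr (_ / _); exact: tree_law_uniform.
  by rewrite sumr_const -[RHS]mulr_natr -mulrA mulVf ?mulr1// T0.
have treeE (f : lgraph n.+1 -> R) : \sum_t mu t * f t = \sum_(t : lgraph n.+1 | `[< is_tree t >]) mu t * f t.
  rewrite [LHS](bigID (fun t : lgraph n.+1 => `[< is_tree t >])) /= [X in _ + X]big1 ?addr0// => t /asboolPn nt.
  by have [->|/(tree_law_tree mu_law)//] := eqVneq (mu t) 0; rewrite mul0r.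
rewrite !treeE.
transitivity ((\sum_(u : lgraph n.+1 | `[< is_tree u >]) \sum_(t in T u)
    mu u / #|T u|%:R * (C u && (F \subset edges t))%:R) * a).
  congr (_ * a); rewrite (exchange_big_dep (fun t : lgraph n.+1 => `[< is_tree t >])) /=; last first.
    by move=> u t _ /TE[tt _]; apply/asboolP.
  apply: eq_bigr => t /asboolP tt; rewrite {1}(mass t tt) mulr_suml.
  apply: eq_big => u; first by apply/idP/andP => [ut|[/asboolP uu /(Tsym _ _ uu)//]];
    have [uu e] := TE _ _ ut; split; [exact/asboolP|exact: Tsym].
  move=> ut; have [uu e] := TE _ _ ut.
  by rewrite (cT _ _ tt ut) (CE _ _ e).
rewrite !mulr_suml; apply: eq_bigr => u /asboolP uu; rewrite -mulr_sumr.
have [Cu|Cu] := boolP (C u); last by rewrite /= big1 ?mulr0 ?mul0r// => t _.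
rewrite mulr1 -2!mulrA; congr (_ * _).
have -> : \sum_(t in T u) (true && (F \subset edges t))%:R = #|trees_over (degree u) F|%:R :> R.
  rewrite -sum1_card natr_sum [RHS]big_mkcond [LHS]big_mkcond; apply: eq_bigr => t _.
  by rewrite /trees_over finset.in_set -/(T u); case: (t \in T u) => //=; case: (_ \subset _).
by rewrite (H u uu Cu) trees_over0 mulKf// T0.
Qed.

Lemma intr_pattern_forest d F0 c0 w p (al : prealive w) :
  forest F0 c0 -> (forall v, (fdegree F0 v <= d v)%N) ->
  (\sum_v d v + 2 = 2 * n.+1)%N ->
  (0 < size w)%N -> size p = size w -> uniq p -> isolated c0 p ->
  [seq d x | x <- p] = word_degrees w ->
  let F := F0 :|: pattern w p in
  #|trees_over d F|%:R * ((nth 0 w 0)%N%:R *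
       \prod_(1 <= j < size w) (#|components c0|%:R - 1 - j%:R)) =
  #|trees_over d F0|%:R * ((orders w)%:R * ((disc w (size w))%:R - (size w)%:R)) :> R.
Proof.
move=> Fc0 dF0 sd k0 pk up iso dp F.
have [c [_ [_ _]]] := pattern_forest Fc0 dF0 sd al k0 pk up iso dp.
move=> /(congr1 (intr : int -> R)); rewrite !(rmorphM, rmorphB, rmorph_prod, rmorph_nat) /=.
under eq_bigr do rewrite !(rmorphB, rmorph1, rmorph_nat).
by rewrite !mulrA.
Qed.

(** This is (N-2)(N-3)...(N-k), the product of the factors [m] of [trees_over_add_isolated] when k-1
    vertices are attached in turn in a forest with N components. *)
Definition falling (N k : nat) : R := \prod_(1 <= j < k) (N%:R - 1 - j%:R).

Lemma embeds_pattern t w p : size p = size w -> uniq p ->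
  embeds t w p = ([seq degree t x | x <- p] == word_degrees w) && (pattern w p \subset edges t).
Proof. by move=> pk up; rewrite /embeds pk up eqxx. Qed.

Lemma fdegree0 v : fdegree (finset.set0 : {set V * V}) v = 0%N.
Proof.
rewrite /fdegree (_ : nbrs finset.set0 v = finset.set0) ?cards0//.
by apply/setP => u; rewrite in_nbrs !finset.in_set0.
Qed.

Lemma mean_embeds w p : prealive w -> (0 < size w)%N -> size p = size w -> uniq p ->
  (\sum_t mu t * (embeds t w p)%:R) * ((nth 0 w 0)%N%:R * falling n.+1 (size w)) =
  degree_prob p (word_degrees w) *
    ((orders w)%:R * ((disc w (size w))%:R - (size w)%:R)).
Proof.
move=> al k0 pk up; under eq_bigr do rewrite embeds_pattern//.
apply: tree_law_average => [t u e|t tt /eqP dp].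
  by congr (_ == _); apply: eq_map.
have iso : isolated (@id V) p by move=> x u _.
have d0 v : (fdegree (finset.set0 : {set V * V}) v <= degree t v)%N by rewrite fdegree0.
have := intr_pattern_forest al (forest0 V) d0 (sum_degree (ltn0Sn n) tt) k0 pk up iso dp.
rewrite finset.set0U; have -> // : #|components (@id V)| = n.+1.
by rewrite -[RHS]card_ord -cardsT; congr #|pred_of_set _|; apply/setP => v; rewrite mem_components inE.
Qed.

(** The second pattern is added to the forest formed by the first. That forest has [n.+2 - size w]
    components, and the vertices of [q] are still isolated in it. *)
Lemma mean_embeds2 w p q : prealive w -> (0 < size w)%N -> size p = size w ->
  size q = size w -> uniq (p ++ q) ->
  (\sum_t mu t * (embeds t w p && embeds t w q)%:R) *
    ((nth 0 w 0)%N%:R ^+ 2 * falling n.+1 (size w) * falling (n.+2 - size w) (size w)) =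
  degree_prob (p ++ q) (word_degrees w ++ word_degrees w) *
    ((orders w)%:R * ((disc w (size w))%:R - (size w)%:R)) ^+ 2.
Proof.
move=> al k0 pk qk; rewrite cat_uniq => /and3P[up /hasPn qp uq].
have e t : embeds t w p && embeds t w q =
    ([seq degree t x | x <- p ++ q] == word_degrees w ++ word_degrees w) &&
    (pattern w p :|: pattern w q \subset edges t).
  rewrite !embeds_pattern// map_cat eqseq_cat ?size_map ?size_word_degrees// finset.subUset.
  by rewrite andbACA.
under eq_bigr do rewrite e.
apply: tree_law_average => [t u eD|t tt].
  by congr (_ == _); apply: eq_map.
rewrite map_cat eqseq_cat ?size_map ?size_word_degrees// => /andP[/eqP dp /eqP dq].
have iso : isolated (@id V) p by move=> x u _.
have d0 v : (fdegree (finset.set0 : {set V * V}) v <= degree t v)%N by rewrite fdegree0.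
have sd := sum_degree (ltn0Sn n) tt.
have := intr_pattern_forest al (forest0 V) d0 sd k0 pk up iso dp.
have [c [[Fc cp cp' cn cm] [dF _ _]]] := pattern_forest (forest0 V) d0 sd al k0 pk up iso dp.
rewrite finset.set0U in Fc cp cp' cn cm dF *.
have isoq : isolated c q.
  move=> x u xq; have xp : x \notin p by exact: qp.
  have [upp|upp] := boolP (u \in p); last by rewrite !cn.
  by move=> e'; move: xp; rewrite cp'// -e' cp.
have := intr_pattern_forest al Fc dF sd k0 qk uq isoq dq.
have cV : #|components (@id V)| = n.+1.
  by rewrite -[RHS]card_ord -cardsT; congr #|pred_of_set _|; apply/setP => v;
    rewrite mem_components inE.
have -> : #|components c| = (n.+2 - size w)%N by rewrite cV in cm; lia.
rewrite cV -!/(falling _ _) => h2 h1.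
transitivity ((#|trees_over (degree t) (pattern w p :|: pattern w q)|%:R *
  ((nth 0 w 0)%N%:R * falling (n.+2 - size w) (size w))) *
  ((nth 0 w 0)%N%:R * falling n.+1 (size w))); first lra.
rewrite h2 mulrAC h1; lra.
Qed.

End Moments.

Section EmbeddingBounds.
Variable (R : realType) (n : nat).
Notation V := 'I_n.+1.
Implicit Types (t u : lgraph n.+1) (p q : seq V) (w : seq nat) (v : V).
Notation nthp p i := (nth ord0 p i).
Local Open Scope ring_scope.

Lemma ler_sum_tuples k (F G : seq V -> R) :
  (forall p, size p = k -> F p <= G p) -> sum_tuples k F <= sum_tuples k G.
Proof. by move=> h; apply: ler_sum => p _; apply: h; rewrite size_tuple. Qed.

Lemma sum_tuplesM k (F : seq V -> R) a : sum_tuples k (fun p => a * F p) = a * sum_tuples k F.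
Proof. by rewrite /sum_tuples mulr_sumr. Qed.

Lemma exchange_sum_tuples (I : Type) (r : seq I) (P : pred I) k (F : seq V -> I -> R) :
  sum_tuples k (fun p => \sum_(i <- r | P i) F p i) =
  \sum_(i <- r | P i) sum_tuples k (fun p => F p i).
Proof. by rewrite /sum_tuples exchange_big. Qed.

Lemma sum_uniq_tuples k : sum_tuples k (fun p : seq V => (uniq p)%:R : R) = (n.+1 ^_ k)%:R.
Proof.
elim: k => [|k IH]; first by rewrite sum_tuples0 ffactn0.
rewrite sum_tuplesS ffactnSr natrM -IH mulrC -sum_tuplesM.
apply: eq_sum_tuples => p pk; under eq_bigr do rewrite rcons_uniq.
have [up|up] := boolP (uniq p); last by rewrite mulr0 big1// => y _; rewrite andbF.
rewrite mulr1 -pk -(card_uniqP up); under eq_bigr do rewrite andbT.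
have <- : #|[predC p]| = (n.+1 - #|p|)%N.
  have := cardC (mem p); rewrite card_ord.
  by move: #|p| #|[predC p]| => a b <-; rewrite addKn.
by rewrite -sum1_card natr_sum [RHS]big_mkcond; apply: eq_bigr => y _; rewrite !inE; case: ifP.
Qed.

Variable t : lgraph n.+1.
Hypothesis tt : is_tree t.

Definition embeddings_at w (j : nat) (z : V) : R :=
  sum_tuples (size w) (fun p : seq V => (embeds t w p && (nthp p j == z))%:R).

(** With the root fixed, each further vertex has at most [branch] choices. *)
Lemma embeddings_at_root w z : prealive w -> (0 < size w)%N ->
  embeddings_at w 0 z <= (orders w)%:R.
Proof.
elim/last_ind: w => // w s IH /prealive_rcons al _.
have [w0|k0] := posnP (size w).
  have -> : w = [::] by apply/nilP; rewrite /nilp w0.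
  rewrite /embeddings_at sum_tuplesS sum_tuples0 /orders big_geq//=.
  rewrite (bigD1 z) //= eqxx andbT big1 ?addr0 => [|y /negbTE ->]; last by rewrite andbF.
  by rewrite lern1 leq_b1.
have -> : embeddings_at (rcons w s) 0 z = rooted_embeddings R t z (rcons w s) by [].
rewrite rooted_embeddings_rcons//.
apply: (@le_trans _ _ (sum_tuples (size w) (fun p : seq V =>
    (branch w)%:R * (embeds t w p && (nthp p 0 == z))%:R))); last first.
  rewrite sum_tuplesM orders_rcons// natrM mulrC ler_wpM2r//.
  by apply: IH => //; exact: alive_prealive.
apply: ler_sum_tuples => p pk; rewrite mulrC.
have [/andP[ep _]|] := boolP (embeds _ _ _ && _); last by rewrite !mulr0.
rewrite !mulr1 -(card_embeds_extend tt al k0 ep) -sum1_card natr_sum [leRHS]big_mkcond.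
apply: ler_sum => y _; rewrite inE.
rewrite /= andbA; case: ((y \notin p) && _) => //=.
by case: (degree t y == s.+1).
Qed.

(** A crude common bound for the degrees in [w]; the successor keeps it at least 1, so that its
    powers increase. *)
Definition degree_bound w : nat := (sumn (word_degrees w)).+1.

(** If position [j] is fixed at [z], its parent is one of the neighbours of [z], whose number is
    prescribed by [w]. The position of the parent is smaller, so after at most [j] such factors the
    root is reached. *)
Lemma embeddings_at_le w j z : prealive w -> (j < size w)%N ->
  embeddings_at w j z <= (orders w)%:R * (degree_bound w)%:R ^+ j.
Proof.
move=> al; have [m] := ubnP j; elim: m j z => // m IH j z jm jk.
have k0 : (0 < size w)%N by exact: leq_ltn_trans jk.
have D1 : 1 <= (degree_bound w)%:R :> R by rewrite ler1n.
have [->|j0] := posnP j; first by rewrite expr0 mulr1 embeddings_at_root.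
have pj := parent_ltn j0 (al _ jk).
have pk : (par w j < size w)%N by exact: ltn_trans jk.
have [zj|zj] := eqVneq (degree t z) (nth 0 w j).+1%N; last first.
  rewrite /embeddings_at /sum_tuples big1; first by rewrite mulr_ge0// exprn_ge0.
  move=> p _; case: andP => // -[ep /eqP pz]; case/eqP: zj.
  by rewrite -pz (degree_embeds ep jk) j0 addn1.
apply: (@le_trans _ _ (\sum_(y | t z y) embeddings_at w (par w j) y)).
  rewrite /embeddings_at -exchange_sum_tuples; apply: ler_sum_tuples => p psz.
  have [/andP[ep /eqP pz]|_] := boolP (embeds t w p && _); last by apply: sumr_ge0.
  have tz : t z (nthp p (par w j)).
    by rewrite -pz (embeds_adj tt al ep)// /bfs_adj pj eqxx orbT.
  by rewrite (bigD1 (nthp p (par w j))) //= ep eqxx lerDl sumr_ge0.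
apply: (@le_trans _ _ (\sum_(y | t z y) (orders w)%:R * (degree_bound w)%:R ^+ (par w j))).
  by apply: ler_sum => y _; apply: IH => //; exact: leq_trans pj _.
rewrite sumr_const -[_ *+ _]mulr_natr -mulrA ler_wpM2l//.
have -> : #|[pred y | t z y]| = degree t z by [].
rewrite zj; apply: (@le_trans _ _ ((degree_bound w)%:R ^+ (par w j) * (degree_bound w)%:R)).
  rewrite ler_wpM2l ?exprn_ge0// ler_nat /degree_bound.
  have := nth_word_degrees jk; rewrite j0 addn1 => <-; apply: leqW.
  have jwd : (j < size (word_degrees w))%N by rewrite size_word_degrees.
  elim: (word_degrees w) j {zj jm jk j0 pj pk} jwd => //= a s IHs [|i] /= h.
    exact: leq_addr.
  by apply: (leq_trans (IHs i h)); exact: leq_addl.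
by rewrite -exprSr ler_weXn2l.
Qed.

Lemma embeddings_le w : prealive w -> (0 < size w)%N ->
  embeddings R t w <= n.+1%:R * (orders w)%:R.
Proof.
move=> al k0; have o0 : (orders w)%:R != 0 :> R.
  rewrite pnatr_eq0 -lt0n; case/lastP: w al k0 => // w s /prealive_rcons al _.
  have [w0|k0] := posnP (size w).
    by have -> : w = [::] by [apply/nilP; rewrite /nilp w0]; rewrite /orders big_geq.
  by rewrite orders_rcons// muln_gt0 orders_gt0// branch_gt0.
rewrite -[leLHS](divfK o0) -sum_exploration_weight// mulr_suml.
apply: (@le_trans _ _ (\sum_(v : V) (orders w)%:R)); last first.
  by rewrite sumr_const card_ord -[_ *+ n.+1]mulr_natl.
apply: ler_sum => v _; have -> : exploration_weight R t v w = embeddings_at w 0 v / (orders w)%:R.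
  by case: (w) k0.
by rewrite divfK// embeddings_at_root.
Qed.

Definition overlap_bound w : R :=
  (orders w)%:R * ((size w)%:R ^+ 2 * ((orders w)%:R * (degree_bound w)%:R ^+ size w)).

(** Two overlapping embeddings share a vertex at some pair of positions. Once the first is chosen,
    the second has a number of choices bounded independently of [n], so the total is linear in
    [n]. *)
Lemma overlap_le w : prealive w -> (0 < size w)%N ->
  sum_tuples (size w) (fun p : seq V => sum_tuples (size w) (fun q : seq V =>
    (embeds t w p && embeds t w q && ~~ uniq (p ++ q))%:R)) <=
  n.+1%:R * overlap_bound w.
Proof.
move=> al k0; set B := (orders w)%:R * (degree_bound w)%:R ^+ size w : R.
have D1 : 1 <= (degree_bound w)%:R :> R by rewrite ler1n.
apply: (@le_trans _ _ (sum_tuples (size w)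
    (fun p : seq V => ((size w)%:R ^+ 2 * B) * (embeds t w p)%:R))); last first.
  rewrite sum_tuplesM /overlap_bound mulrC mulrA ler_wpM2r//.
    by rewrite mulr_ge0 ?exprn_ge0// mulr_ge0 ?exprn_ge0.
  exact: embeddings_le.
apply: ler_sum_tuples => p pk; have [ep|_] := boolP (embeds t w p); last first.
  by rewrite mulr0 /sum_tuples big1.
rewrite mulr1; apply: (@le_trans _ _ (\sum_(i < size w) \sum_(j < size w)
    embeddings_at w j (nthp p i))); last first.
  apply: (@le_trans _ _ (\sum_(i < size w) \sum_(j < size w) B)); last first.
    by rewrite !sumr_const !card_ord -mulrnA -[B *+ _]mulr_natl natrM expr2.
  apply: ler_sum => i _; apply: ler_sum => j _.
  apply: (le_trans (embeddings_at_le _ al (ltn_ord j))).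
  by rewrite ler_wpM2l// ler_weXn2l// ltnW.
rewrite /embeddings_at; under eq_bigr do rewrite -exchange_sum_tuples.
rewrite -exchange_sum_tuples; apply: ler_sum_tuples => q qk.
have [/andP[eq nu]|_] := boolP (embeds t w q && ~~ uniq (p ++ q)); last first.
  by rewrite /=; apply: sumr_ge0 => i _; exact: sumr_ge0.
move: nu; rewrite cat_uniq (embeds_uniq ep) (embeds_uniq eq) andbT /= negbK => /hasP[z zq zp].
have zj : (index z q < size w)%N by rewrite -qk index_mem.
have zi : (index z p < size w)%N by rewrite -pk index_mem.
rewrite (bigD1 (Ordinal zi)) //= (bigD1 (Ordinal zj)) //= !nth_index// eqxx eq /=.
by rewrite -addrA lerDl addr_ge0// sumr_ge0// => i _; exact: sumr_ge0.
Qed.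

End EmbeddingBounds.

Section TreeMoments.
Variable (R : realType) (n : nat).
Notation V := 'I_n.+1.
Implicit Types (t u : lgraph n.+1) (p q : seq V) (w : seq nat) (v : V).
Notation nthp p i := (nth ord0 p i).
Local Open Scope ring_scope.

Lemma tree_degree_gt0 t v : is_tree t -> (0 < n)%N -> (0 < degree t v)%N.
Proof.
move=> [con _] n0.
have [y yv] : exists y, y != v.
  have [->|v0] := eqVneq v ord0; last by exists ord0; rewrite eq_sym.
  by exists ord_max; rewrite -val_eqE /= -lt0n.
have [r [[|z s] [/= pp pl _]]] := con v y; first by move: yv; rewrite -pl eqxx.
by apply: (@degree_gt0 _ _ z); rewrite adj_sym; case/andP: pp.
Qed.

Variable mu : lgraph n.+1 -> R.
Hypothesis mu_law : tree_law mu.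

Lemma degree_prob_perm p q ds : uniq p -> uniq q -> size p = size q ->
  degree_prob mu p ds = degree_prob mu q ds.
Proof. exact: tree_law_exchangeable. Qed.

(** By exchangeability every list of distinct vertices contributes as much as [p0]. *)
Lemma mean_embeddings w p0 : prealive w -> (0 < size w)%N -> size p0 = size w -> uniq p0 ->
  (\sum_t mu t * embeddings R t w) * ((nth 0 w 0)%N%:R * falling R n.+1 (size w)) =
  (n.+1 ^_ size w)%:R * degree_prob mu p0 (word_degrees w) *
    ((orders w)%:R * ((disc w (size w))%:R - (size w)%:R)).
Proof.
move=> al k0 pk0 up0.
have -> : \sum_t mu t * embeddings R t w =
    sum_tuples (size w) (fun p : seq V => \sum_t mu t * (embeds t w p)%:R).
  rewrite exchange_sum_tuples; apply: eq_bigr => t _.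
  by rewrite /embeddings -sum_tuplesM.
rewrite -sum_uniq_tuples /sum_tuples !mulr_suml; apply: eq_bigr => p _.
have [up|up] := boolP (uniq p); last first.
  rewrite !mul0r big1 ?mul0r// => t _; rewrite [embeds _ _ _]negbTE ?mulr0//.
  by apply: contra up => /embeds_uniq.
rewrite mul1r mean_embeds// ?size_tuple//; congr (_ * _).
by apply: degree_prob_perm => //; rewrite size_tuple.
Qed.

Lemma sum_tuples_cat (k l : nat) (F : seq V -> R) :
  sum_tuples (k + l) F = sum_tuples k (fun p => sum_tuples l (fun q => F (p ++ q))).
Proof.
elim: l F => [|l IH] F.
  by rewrite addn0; apply: eq_sum_tuples => p _; rewrite sum_tuples0 cats0.
rewrite addnS sum_tuplesS IH; apply: eq_sum_tuples => p _; rewrite sum_tuplesS.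
by apply: eq_sum_tuples => q _; apply: eq_bigr => y _; rewrite rcons_cat.
Qed.

(** The square counts pairs of embeddings: the disjoint ones are given exactly by [mean_embeds2],
    the others are bounded by [overlap_le]. *)
Lemma mean_embeddings2 w p0 : prealive w -> (0 < size w)%N ->
  size p0 = (size w + size w)%N -> uniq p0 ->
  let D := (nth 0 w 0)%N%:R ^+ 2 * falling R n.+1 (size w) *
           falling R (n.+2 - size w) (size w) in
  0 <= D ->
  (\sum_t mu t * embeddings R t w ^+ 2) * D <=
  (n.+1 ^_ (size w + size w))%:R * degree_prob mu p0 (word_degrees w ++ word_degrees w) *
    ((orders w)%:R * ((disc w (size w))%:R - (size w)%:R)) ^+ 2
  + n.+1%:R * overlap_bound R w * D.
Proof.
move=> al k0 pk0 up0 D D0.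
pose U (p q : seq V) := uniq (p ++ q).
have XE t : embeddings R t w ^+ 2 =
    sum_tuples (size w) (fun p => sum_tuples (size w) (fun q =>
      (embeds t w p && embeds t w q && U p q)%:R)) +
    sum_tuples (size w) (fun p => sum_tuples (size w) (fun q =>
      (embeds t w p && embeds t w q && ~~ U p q)%:R)).
  rewrite /embeddings expr2 /sum_tuples mulr_suml -big_split; apply: eq_bigr => p _ /=.
  rewrite mulr_sumr -big_split; apply: eq_bigr => q _ /=.
  by rewrite -natrM mulnb; case: (_ && _); case: (U _ _); rewrite ?addr0 ?add0r.
under eq_bigr do rewrite XE mulrDr.
rewrite big_split mulrDl; apply: lerD.
  rewrite le_eqVlt; apply/orP; left; apply/eqP.
  have -> : \sum_t mu t * sum_tuples (size w) (fun p => sum_tuples (size w) (fun q =>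
        (embeds t w p && embeds t w q && U p q)%:R)) =
      sum_tuples (size w) (fun p : seq V => sum_tuples (size w) (fun q : seq V =>
        \sum_t mu t * (embeds t w p && embeds t w q && U p q)%:R)).
    under [in RHS]eq_sum_tuples do rewrite exchange_sum_tuples.
    rewrite exchange_sum_tuples; apply: eq_bigr => t _; rewrite -sum_tuplesM.
    by apply: eq_sum_tuples => p _; rewrite -sum_tuplesM.
  rewrite -sum_uniq_tuples sum_tuples_cat /sum_tuples !mulr_suml; apply: eq_bigr => p _.
  rewrite !mulr_suml; apply: eq_bigr => q _.
  have [up|up] := boolP (uniq (p ++ q)); last first.
    by rewrite !mul0r big1 ?mul0r// => t _; rewrite /U (negbTE up) andbF mulr0.
  rewrite mul1r; under eq_bigr do rewrite /U up andbT.
  rewrite mean_embeds2// ?size_tuple//; congr (_ * _).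
  by apply: degree_prob_perm => //; rewrite size_cat !size_tuple.
rewrite ler_wpM2r//; have mu0 := tree_law_ge0 mu_law.
apply: (@le_trans _ _ (\sum_t mu t * (n.+1%:R * overlap_bound R w))).
  apply: ler_sum => t _; have [->|mt] := eqVneq (mu t) 0; first by rewrite !mul0r.
  by rewrite ler_wpM2l//; apply: overlap_le => //; exact: (tree_law_tree mu_law).
by rewrite -mulr_suml (tree_law_sum mu_law) mul1r.
Qed.

(** Words with root letter 0 need separate treatment, because the moment formulas then have a zero
    factor on the left. *)
Lemma embeddings_root0 t w : is_tree t -> (0 < n)%N -> (0 < size w)%N ->
  nth 0%N w 0 = 0%N -> embeddings R t w = 0.
Proof.
move=> tt n0 k0 w0; rewrite /embeddings /sum_tuples big1// => p _.
have [ep|//] := boolP (embeds t w p).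
by have := tree_degree_gt0 (nthp p 0) tt n0; rewrite (degree_embeds ep k0) w0.
Qed.

End TreeMoments.

(** * Mean square convergence of the ball frequencies *)

Section MomentLimits.
Variable R : realType.
Local Open Scope ring_scope.
Local Open Scope classical_set_scope.

Lemma cvg_bigsum (I : Type) (r : seq I) (P : pred I) (f : I -> nat -> R) (a : I -> R) :
  (forall i, P i -> f i n @[n --> \oo] --> a i) ->
  \sum_(i <- r | P i) f i n @[n --> \oo] --> \sum_(i <- r | P i) a i.
Proof. by move=> h; apply: cvg_big => //; exact: add_continuous. Qed.

Lemma cvg_bigprod (I : Type) (r : seq I) (P : pred I) (f : I -> nat -> R) (a : I -> R) :
  (forall i, P i -> f i n @[n --> \oo] --> a i) ->
  \prod_(i <- r | P i) f i n @[n --> \oo] --> \prod_(i <- r | P i) a i.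
Proof. by move=> h; apply: cvg_big => //; exact: mul_continuous. Qed.

Lemma cvg_ratio1 (c : R) : (n.+1%:R - c) / n.+1%:R @[n --> \oo] --> (1 : R).
Proof.
have -> : (fun n => (n.+1%:R - c) / n.+1%:R) = (fun n => 1 - c * harmonic n) :> (nat -> R).
  by apply/funext => n; rewrite mulrBl divff ?pnatr_eq0.
rewrite -[X in _ --> X]subr0 -[X in _ - X](mulr0 c).
apply: cvgB; first exact: cvg_cst.
by apply: cvgMr; exact: cvg_harmonic.
Qed.

Lemma ffactE (N k : nat) : (N ^_ k)%:R = \prod_(j < k) (N%:R - j%:R) :> R.
Proof.
elim: k => [|k IH]; first by rewrite ffactn0 big_ord0.
rewrite ffactnSr natrM IH big_ord_recr /=; have [kN|Nk] := leqP k N.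
  by rewrite natrB.
have -> : \prod_(j < k) (N%:R - j%:R) = 0 :> R.
  by rewrite (bigD1 (Ordinal Nk)) //= subrr mul0r.
by rewrite !mul0r.
Qed.

(** Numerator and denominator are both products of k factors, each equal to n plus a constant. *)
Lemma cvg_ffact_falling k : (0 < k)%N ->
  (n.+1 ^_ k)%:R / (n.+1%:R * falling R n.+1 k) @[n --> \oo] --> (1 : R).
Proof.
case: k => // k _.
have e n : (n.+1 ^_ k.+1)%:R / (n.+1%:R * falling R n.+1 k.+1) =
    (\prod_(j < k.+1) ((n.+1%:R - j%:R) / n.+1%:R)) *
    (\prod_(j < k) ((n.+1%:R - (1 + j.+1%:R)) / n.+1%:R))^-1 :> R.
  have N0 : n.+1%:R != 0 :> R by rewrite pnatr_eq0.
  rewrite ffactE /falling big_add1 big_mkord /= !big_split /= !prodr_const !card_ord.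
  have -> : \prod_(j < k) (n.+1%:R - 1 - j.+1%:R) =
      \prod_(j < k) (n.+1%:R - (1 + j.+1%:R)) :> R.
    by apply: eq_bigr => j _; lra.
  rewrite !invfM -!exprVn invrK exprS.
  set A := \prod_(j < k.+1) _; set B := \prod_(j < k) _.
  set x := n.+1%:R^-1 ^+ k; set y := n.+1%:R ^+ k.
  have xy : x * y = 1 by rewrite /x /y -exprMn mulVf// expr1n.
  transitivity (A * n.+1%:R^-1 / B * (x * y)); last first.
    by move: A (B^-1) (n.+1%:R^-1) x y {xy} => a b c x y; lra.
  by rewrite xy; move: A (B^-1) (n.+1%:R^-1) => a b c; lra.
suff : (fun n => (n.+1 ^_ k.+1)%:R / (n.+1%:R * falling R n.+1 k.+1)) @ \oo
    --> (1 * 1^-1 : R) by rewrite invr1 mulr1.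
rewrite (funext e).
apply: cvgM.
  have := @cvg_bigprod _ (index_enum 'I_k.+1) xpredT
    (fun j n => (n.+1%:R - j%:R) / n.+1%:R) (fun=> 1) (fun j _ => cvg_ratio1 _).
  by rewrite big1.
apply: cvgV => //.
have := @cvg_bigprod _ (index_enum 'I_k) xpredT
    (fun j n => (n.+1%:R - (1 + j.+1%:R)) / n.+1%:R) (fun=> 1) (fun j _ => cvg_ratio1 _).
by rewrite big1.
Qed.

Lemma cvg_ffact_falling2 k : (0 < k)%N ->
  (n.+1 ^_ (k + k))%:R / (n.+1%:R ^+ 2 * falling R n.+1 k * falling R (n.+2 - k) k)
    @[n --> \oo] --> (1 : R).
Proof.
case: k => // k _.
have e : \forall n \near \oo,
   (\prod_(j < k.+1 + k.+1) ((n.+1%:R - j%:R) / n.+1%:R)) *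
    ((\prod_(j < k) ((n.+1%:R - (1 + j.+1%:R)) / n.+1%:R))^-1 *
     (\prod_(j < k) ((n.+1%:R - (k.+1%:R + j.+1%:R)) / n.+1%:R))^-1) =
   (n.+1 ^_ (k.+1 + k.+1))%:R /
     (n.+1%:R ^+ 2 * falling R n.+1 k.+1 * falling R (n.+2 - k.+1) k.+1).
  near=> n.
  have kn : (k.+1 <= n.+2)%N by near: n; exists k.+1 => // m /=; lia.
  have N0 : n.+1%:R != 0 :> R by rewrite pnatr_eq0.
  rewrite ffactE /falling !big_add1 !big_mkord /= !big_split /= !prodr_const !card_ord.
  have -> : \prod_(j < k) ((n.+2 - k.+1)%:R - 1 - j.+1%:R) =
      \prod_(j < k) (n.+1%:R - (k.+1%:R + j.+1%:R)) :> R.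
    by apply: eq_bigr => j _; rewrite natrB// -[n.+2%:R]natr1; lra.
  have -> : \prod_(j < k) (n.+1%:R - 1 - j.+1%:R) =
      \prod_(j < k) (n.+1%:R - (1 + j.+1%:R)) :> R.
    by apply: eq_bigr => j _; lra.
  rewrite !invfM -!exprVn invrK.
  set A := \prod_(j < k.+1 + k.+1) _; set B := \prod_(j < k) _; set C := \prod_(j < k) _.
  have -> : (k.+1 + k.+1 = 2 + k + k)%N by lia.
  rewrite !exprD; set x := n.+1%:R^-1 ^+ k; set y := n.+1%:R ^+ k.
  have xy : x * y = 1 by rewrite /x /y -exprMn mulVf// expr1n.
  transitivity (A * n.+1%:R^-1 ^+ 2 / B / C * (x * y) * (x * y)).
    by move: A (B^-1) (C^-1) (n.+1%:R^-1) x y {xy} => a b c e x y; lra.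
  by rewrite xy; move: A (B^-1) (C^-1) (n.+1%:R^-1) => a b c f; lra.
apply: cvg_trans; first exact: (near_eq_cvg e).
suff : (fun n => (\prod_(j < k.+1 + k.+1) ((n.+1%:R - j%:R) / n.+1%:R)) *
    ((\prod_(j < k) ((n.+1%:R - (1 + j.+1%:R)) / n.+1%:R))^-1 *
     (\prod_(j < k) ((n.+1%:R - (k.+1%:R + j.+1%:R)) / n.+1%:R))^-1)) @ \oo
    --> (1 * (1^-1 * 1^-1) : R) by rewrite invr1 !mulr1.
apply: cvgM.
  have := @cvg_bigprod _ (index_enum 'I_(k.+1 + k.+1)) xpredT
    (fun j n => (n.+1%:R - j%:R) / n.+1%:R) (fun=> 1) (fun j _ => cvg_ratio1 _).
  by rewrite big1.
apply: cvgM; apply: cvgV => //.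
  have := @cvg_bigprod _ (index_enum 'I_k) xpredT
    (fun j n => (n.+1%:R - (1 + j.+1%:R)) / n.+1%:R) (fun=> 1) (fun j _ => cvg_ratio1 _).
  by rewrite big1.
have := @cvg_bigprod _ (index_enum 'I_k) xpredT
    (fun j n => (n.+1%:R - (k.+1%:R + j.+1%:R)) / n.+1%:R) (fun=> 1) (fun j _ => cvg_ratio1 _).
by rewrite big1.
Unshelve. all: by end_near. Qed.

End MomentLimits.

Section LocalLimit.
Variable R : realType.
Local Open Scope ring_scope.
Local Open Scope classical_set_scope.

Lemma falling_gt0 N k : (k < N)%N -> 0 < falling R N k.
Proof.
move=> kN; rewrite /falling big_nat_cond prodr_gt0// => j; rewrite andbT => /andP[j0 jk].
by rewrite -addrA -opprD subr_gt0 addrC natr1 ltr_nat; lia.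
Qed.

Definition first_vertices n k : seq 'I_n.+1 := [seq inord i | i <- iota 0 k].

Lemma size_first_vertices n k : size (first_vertices n k) = k.
Proof. by rewrite size_map size_iota. Qed.

Lemma uniq_first_vertices n k : (k <= n.+1)%N -> uniq (first_vertices n k).
Proof.
move=> kn; rewrite map_inj_in_uniq ?iota_uniq// => i j.
rewrite !mem_iota /= !add0n => ik jk /(congr1 val) /=.
by rewrite !inordK//; [exact: leq_trans jk kn | exact: leq_trans ik kn].
Qed.

Variable p : nat -> R.

(** The probability of these degrees when they are independent with law [p], times b/s, where b is
    the number of vertices discovered and not explored at the end, and s, the root degree, is this
    number after one step. For s = 0 the value is 0. *)
Definition word_limit w : R :=
  ((disc w (size w))%:R - (size w)%:R) / (nth 0 w 0)%N%:R * \prod_(x <- word_degrees w) p x.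

Variable mu : forall n, lgraph n.+1 -> R.
Hypothesis mu_law : forall n, (0 < n)%N -> tree_law (@mu n).
Hypothesis mu_cvg : forall ds : seq nat,
  degree_prob (@mu n) (first_vertices n (size ds)) ds @[n --> \oo] --> \prod_(x <- ds) p x.

(** The square is expanded: the mean of the frequency tends to the limit L, and the mean of its
    square has an upper bound that tends to L^2. *)
Lemma word_frequency_L2 w : prealive w -> (0 < size w)%N ->
  \sum_(t : lgraph n.+1) mu t * (embeddings R t w / (orders w)%:R / n.+1%:R - word_limit w) ^+ 2
    @[n --> \oo] --> (0 : R).
Proof.
move=> al k0; set L := word_limit w; set k := size w; set A : R := (orders w)%:R.
have mu0 n : (0 < n)%N -> forall t, 0 <= @mu n t by move=> n0; exact: tree_law_ge0 (mu_law n0).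
have mu1 n : (0 < n)%N -> \sum_t @mu n t = 1 by move=> n0; exact: tree_law_sum (mu_law n0).
have [s0|s0] := posnP (nth 0%N w 0).
  apply: cvg_near_cst; near=> n; have n0 : (0 < n)%N by near: n; exists 1%N.
  rewrite big1// => t _; have [->|mt] := eqVneq (mu t) 0; first by rewrite mul0r.
  rewrite (embeddings_root0 R (tree_law_tree (mu_law n0) mt) n0 k0 s0).
  by rewrite /L /word_limit s0 invr0 !mulr0 !mul0r subr0 expr0n mulr0.
set s : R := (nth 0%N w 0)%:R; set b : R := (disc w k)%:R - k%:R.
have sn0 : s != 0 by rewrite pnatr_eq0 -lt0n.
have A0 : A != 0.
  rewrite pnatr_eq0 -lt0n; case/lastP: (w) k0 al => // w' s' _ /prealive_rcons al.
  have [w0|k0] := posnP (size w').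
    by have -> : w' = [::] by [apply/nilP; rewrite /nilp w0]; rewrite /orders big_geq.
  by rewrite orders_rcons// muln_gt0 orders_gt0// branch_gt0.
pose lam1 n : R := (n.+1 ^_ k)%:R / (n.+1%:R * falling R n.+1 k).
pose lam2 n : R := (n.+1 ^_ (k + k))%:R / (n.+1%:R ^+ 2 * falling R n.+1 k * falling R (n.+2 - k) k).
pose pi1 n : R := degree_prob (@mu n) (first_vertices n k) (word_degrees w).
pose pi2 n : R := degree_prob (@mu n) (first_vertices n (k + k)) (word_degrees w ++ word_degrees w).
set be := b / s.
(* An upper bound for the left side once the moments are inserted; the term with [harmonic] carries
   the overlapping pairs. *)
pose U n : R := lam2 n * pi2 n * be ^+ 2 + overlap_bound R w / A ^+ 2 * harmonic n
  - 2 * L * be * (lam1 n * pi1 n) + L ^+ 2.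
have Ucvg : U n @[n --> \oo] --> (0 : R).
  set P := \prod_(x <- word_degrees w) p x.
  have p1 : pi1 n @[n --> \oo] --> P.
    by have := @mu_cvg (word_degrees w); rewrite size_word_degrees.
  have p2 : pi2 n @[n --> \oo] --> P * P.
    by have := @mu_cvg (word_degrees w ++ word_degrees w); rewrite size_cat size_word_degrees big_cat.
  suff : U n @[n --> \oo] --> 1 * (P * P) * be ^+ 2 + overlap_bound R w / A ^+ 2 * 0
     - 2 * L * be * (1 * P) + L ^+ 2.
    set v := _ + L ^+ 2; suff v0 : v = 0 by rewrite v0.
    rewrite /v (_ : L = be * P)//.
    by move: (be) (P) (overlap_bound R w / A ^+ 2) => x y z; lra.
  apply: cvgD; last exact: cvg_cst.
  apply: cvgB.
    apply: cvgD; last by apply: cvgMr; exact: cvg_harmonic.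
    by apply: cvgMl; apply: cvgM => //; exact: cvg_ffact_falling2.
  by apply: cvgMr; apply: cvgM => //; exact: cvg_ffact_falling.
apply: (squeeze_cvgr _ (cvg_cst 0) Ucvg); near=> n.
have nk : (k + k <= n)%N by near: n; exists (k + k)%N.
have n0 : (0 < n)%N by apply: leq_trans nk; rewrite addn_gt0 k0.
have nt t : 0 <= @mu n t by exact: mu0.
apply/andP; split; first by apply: sumr_ge0 => t _; rewrite mulr_ge0// sqr_ge0.
set f1 := falling R n.+1 k; set f2 := falling R (n.+2 - k) k.
have f10 : 0 < f1 by apply: falling_gt0; lia.
have f20 : 0 < f2 by apply: falling_gt0; lia.
have N0 : n.+1%:R != 0 :> R by rewrite pnatr_eq0.
have Ngt : 0 < n.+1%:R :> R by rewrite ltr0n.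
have := mean_embeddings (mu_law n0) al k0 (size_first_vertices n k) (uniq_first_vertices _).
move=> /(_ ltac:(lia)); rewrite -/k -/s -/b -/f1 -/A -/(pi1 n).
set m1 := \sum_t _ => Hm1.
have D0 : 0 < s ^+ 2 * f1 * f2 by rewrite mulr_gt0// mulr_gt0// exprn_gt0// ltr0n.
have := mean_embeddings2 (mu_law n0) al k0 (size_first_vertices n (k + k)) (uniq_first_vertices _).
move=> /(_ ltac:(lia)); rewrite -/k -/s -/b -/f1 -/f2 -/A -/(pi2 n) => /(_ (ltW D0)).
set m2 := \sum_t _ => Hm2.
have E1 : m1 / A / n.+1%:R = be * (lam1 n * pi1 n).
  have -> : m1 = (n.+1 ^_ k)%:R * pi1 n * (A * b) / (s * f1).
    by rewrite -Hm1 mulfK// mulf_neq0// gt_eqF.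
  rewrite /lam1 -/f1 /be !invfM.
  transitivity ((n.+1 ^_ k)%:R * pi1 n * b * s^-1 * f1^-1 * n.+1%:R^-1 * (A / A)).
    by move: (s^-1) (f1^-1) (n.+1%:R^-1) (A^-1) => x y z A'; lra.
  rewrite divff//; by move: (s^-1) (f1^-1) (n.+1%:R^-1) => x y z; lra.
have E2 : m2 / A ^+ 2 / n.+1%:R ^+ 2 <=
    lam2 n * pi2 n * be ^+ 2 + overlap_bound R w / A ^+ 2 * harmonic n.
  rewrite -(ler_pM2r D0).
  have Z0 : 0 <= (A ^+ 2)^-1 * (n.+1%:R ^+ 2)^-1 by rewrite mulr_ge0// invr_ge0 sqr_ge0.
  have := ler_wpM2r Z0 Hm2.
  set X := overlap_bound R w; set Y := (n.+1 ^_ (k + k))%:R * pi2 n.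
  have -> : m2 * (s ^+ 2 * f1 * f2) * ((A ^+ 2)^-1 * (n.+1%:R ^+ 2)^-1) =
     m2 / A ^+ 2 / n.+1%:R ^+ 2 * (s ^+ 2 * f1 * f2).
    by move: (A ^+ 2)^-1 (n.+1%:R ^+ 2)^-1 => a c; lra.
  move=> /le_trans; apply; rewrite le_eqVlt; apply/orP; left; apply/eqP.
  rewrite mulrDl [RHS]mulrDl; congr (_ + _).
    rewrite /lam2 -/f1 -/f2 /be /Y (invfM _ f2) (invfM _ f1) expr_div_n exprMn.
    transitivity ((n.+1 ^_ (k + k))%:R * pi2 n * b ^+ 2 * (n.+1%:R ^+ 2)^-1 * (A ^+ 2 / A ^+ 2)).
      by move: (A ^+ 2) (A ^+ 2)^-1 (n.+1%:R ^+ 2)^-1 => a c e; lra.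
    rewrite divff ?expf_neq0//.
    transitivity ((n.+1 ^_ (k + k))%:R * pi2 n * b ^+ 2 * (n.+1%:R ^+ 2)^-1 *
      (s ^+ 2 / s ^+ 2) * (f1 / f1) * (f2 / f2)).
      by rewrite !divff ?expf_neq0// ?gt_eqF// !mulr1.
    by move: (s ^+ 2)^-1 (f1^-1) (f2^-1) (n.+1%:R ^+ 2)^-1 => a c e g; lra.
  rewrite /= -(exprVn n.+1%:R).
  transitivity (X / A ^+ 2 * n.+1%:R^-1 * (s ^+ 2 * f1 * f2) * (n.+1%:R / n.+1%:R)).
    by move: (A ^+ 2)^-1 (n.+1%:R^-1) => a c; lra.
  by rewrite divff// mulr1.
have -> : \sum_(t : lgraph n.+1) mu t * (embeddings R t w / A / n.+1%:R - L) ^+ 2 =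
    m2 / A ^+ 2 / n.+1%:R ^+ 2 - 2 * L * (m1 / A / n.+1%:R) + L ^+ 2.
  have e : L ^+ 2 = \sum_(t : lgraph n.+1) mu t * L ^+ 2 by rewrite -mulr_suml mu1// mul1r.
  rewrite /m1 /m2 [X in _ = _ + X]e !mulr_suml !mulr_sumr.
  rewrite -sumrB -big_split; apply: eq_bigr => t _ /=.
  rewrite sqrrB -!exprVn.
  by move: (A^-1) (n.+1%:R^-1) => a c; lra.
rewrite E1 /U lerD2r; apply: lerB; first exact: E2.
by rewrite [leRHS]mulrA.
Unshelve. all: by end_near. Qed.

End LocalLimit.

Section BallFrequencyLimit.
Variable R : realType.
Local Open Scope ring_scope.
Local Open Scope classical_set_scope.
Variable p : nat -> R.
Variable mu : forall n, lgraph n.+1 -> R.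
Hypothesis mu_law : forall n, (0 < n)%N -> tree_law (@mu n).
Hypothesis mu_cvg : forall ds : seq nat,
  degree_prob (@mu n) (first_vertices n (size ds)) ds @[n --> \oo] --> \prod_(x <- ds) p x.

(** Finite sums by induction, through (x+y)^2 at most 2x^2 + 2y^2. *)
Lemma words_frequency_L2 (L : seq (seq nat)) :
  {in L, forall w, prealive w /\ (0 < size w)%N} ->
  \sum_(t : lgraph n.+1) mu t * (\sum_(w <- L)
      (embeddings R t w / (orders w)%:R / n.+1%:R - word_limit p w)) ^+ 2
    @[n --> \oo] --> (0 : R).
Proof.
elim: L => [_|w L IH H].
  apply: cvg_near_cst; apply: nearW => n.
  by rewrite big1// => t _; rewrite big_nil expr0n mulr0.
have {}IH := IH (fun u uL => H u (@mem_behead _ (w :: L) u uL)).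
have [al k0] := H w (mem_head _ _).
have Hw := word_frequency_L2 mu_law mu_cvg al k0.
set f := (fun n => _) in IH; set g := (fun n => _) in Hw.
have S : 2 * g n + 2 * f n @[n --> \oo] --> (0 : R).
  suff : 2 * g n + 2 * f n @[n --> \oo] --> (2 * 0 + 2 * 0 : R) by rewrite !mulr0 addr0.
  by apply: cvgD; apply: cvgMr.
apply: (squeeze_cvgr _ (cvg_cst 0) S); near=> n.
have n0 : (0 < n)%N by near: n; exists 1%N.
have mu0 := tree_law_ge0 (mu_law n0).
apply/andP; split; first by apply: sumr_ge0 => t _; rewrite mulr_ge0// sqr_ge0.
rewrite /f /g !mulr_sumr -big_split; apply: ler_sum => t _ /=.
rewrite big_cons ![2 * (mu t * _)]mulrCA -mulrDr ler_wpM2l//.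
set x := _ - _; set y := \sum_(_ <- _) _.
rewrite -subr_ge0; have -> : 2 * x ^+ 2 + 2 * y ^+ 2 - (x + y) ^+ 2 = (x - y) ^+ 2 by lra.
exact: sqr_ge0.
Unshelve. all: by end_near. Qed.

Definition ball_limit r F M : R :=
  \sum_(u <- ball_words r M (fun u => `[< rooted_iso (word_tree u) F >])) word_limit p u.

(** Chebyshev's inequality for the finite sum of word frequencies that makes up the ball
    frequency. *)
Theorem ball_frequency_cvg r F M (e : R) : (0 < r)%N -> size_bound F M -> 0 < e ->
  \sum_(t : lgraph n.+1) mu t * (e < `|ball_frequency R r F t - ball_limit r F M|)%R%:R
    @[n --> \oo] --> (0 : R).
Proof.
move=> r0 FM e0; rewrite /ball_limit.
set L := ball_words r M _.
have HL : {in L, forall w, prealive w /\ (0 < size w)%N}.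
  move=> w /complete_ball_words/andP[cw _].
  by split; [exact: complete_prealive cw|exact: complete_gt0 cw].
have := words_frequency_L2 HL; set f := (fun n => _) => fcvg.
have S : (e ^+ 2)^-1 * f n @[n --> \oo] --> (0 : R).
  by rewrite -[X in _ --> X](mulr0 (e ^+ 2)^-1); apply: cvgMr.
apply: (squeeze_cvgr _ (cvg_cst 0) S); near=> n.
have n0 : (0 < n)%N by near: n; exists 1%N.
have mu0 := tree_law_ge0 (mu_law n0).
apply/andP; split; first by apply: sumr_ge0 => t _; rewrite mulr_ge0.
rewrite /f mulr_sumr; apply: ler_sum => t _; rewrite mulrCA.
have [->|mt] := eqVneq (mu t) 0; first by rewrite !mul0r.
rewrite ler_wpM2l// (ball_frequency_exploration R (tree_law_tree (mu_law n0) mt) r0 FM).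
rewrite -/L -sumrB; set x := \sum_(_ <- _) _.
have [h|h] := ltP; last by rewrite mulr_ge0 ?sqr_ge0// invr_ge0 sqr_ge0.
rewrite mulrC ler_pdivlMr ?exprn_gt0// mul1r -[leRHS](real_normK (num_real _)).
by rewrite ler_sqr ?nnegrE// ?ltW.
Unshelve. all: by end_near. Qed.

End BallFrequencyLimit.

(** * A random sequence with prescribed probabilities of its prefixes *)

Lemma bigcup_measurable_countable d (T : measurableType d) (I : countType)
    (P : set I) (F : I -> set T) :
  (forall i, P i -> measurable (F i)) -> measurable (\bigcup_(i in P) F i)%classic.
Proof.
move=> mF; have -> : (\bigcup_(i in P) F i =
    \bigcup_(n in [set: nat]) (if (choice.unpickle n : option I) is Some i then if pselect (P i) then F i else set0 else set0))%classic.
  apply/seteqP; split=> [x [i Pi Fi]|x [n _]].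
    by exists (choice.pickle i) => //; rewrite choice.pickleK; case: pselect.
  by case: choice.unpickle => // i; case: pselect => // Pi Fi; exists i.
apply: bigcupT_measurable => n; case: choice.unpickle => [i|]; last exact: measurable0.
by case: pselect => Pi; [exact: mF|exact: measurable0].
Qed.

Section Realization.
Variable R : realType.
Local Open Scope ring_scope.
Local Open Scope classical_set_scope.
Variable q : seq nat -> R.
Hypothesis q_ge0 : forall w, 0 <= q w.
Hypothesis q_nil : q [::] = 1.
Hypothesis q_cvg : forall w, series (fun s => q (rcons w s)) n @[n --> \oo] --> q w.

Let partial w m : R := \sum_(0 <= j < m) q (rcons w j).

Let partial_le w m : partial w m <= q w.
Proof.
have h := @q_cvg w; rewrite -(cvg_lim (@Rhausdorff _) h).
apply: (nondecreasing_cvgn_le _ (cvgP _ h)) => a b ab.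
by rewrite /series /= (big_cat_nat (leq0n a) ab) /= lerDl sumr_ge0.
Qed.

Let partial_gt w y : y < q w -> exists m, y < partial w m.
Proof.
move=> yq; have := @q_cvg w => /cvgr_gt /(_ _ yq) [m _ h].
by exists m; apply: (h m) => /=.
Qed.

(** The left end of the interval attached to [w]: each letter adds the lengths of the intervals of
    its smaller siblings. *)
Definition lower w : R :=
  \sum_(i < size w) partial (take i w) (nth 0%N w i).

Let lower_rcons w s : lower (rcons w s) = lower w + partial w s.
Proof.
rewrite /lower size_rcons big_ord_recr /= nth_rcons ltnn eqxx -cats1 take_size_cat//.
congr (_ + _); apply: eq_bigr => i _; rewrite nth_cat ltn_ord.
by rewrite takel_cat// ltnW.
Qed.

Let partialS w s : partial w s.+1 = partial w s + q (rcons w s).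
Proof. by rewrite /partial big_nat_recr. Qed.

Let partial_mono w a b : (a <= b)%N -> partial w a <= partial w b.
Proof. by move=> ab; rewrite /partial (big_cat_nat (leq0n a) ab) /= lerDl sumr_ge0. Qed.

Definition cell w : set R := [set x | lower w <= x < lower w + q w].

Let cell_rcons w s : cell (rcons w s) `<=` cell w.
Proof.
move=> x; rewrite /cell /= lower_rcons => /andP[h1 h2].
have p0 : 0 <= partial w s by apply: sumr_ge0.
have p1 := partial_le w s.+1; rewrite partialS in p1.
by apply/andP; split; lra.
Qed.

Let cell_ex w x : cell w x -> exists s, cell (rcons w s) x.
Proof.
rewrite /cell /= => /andP[h1 h2].
have [|m hm] := @partial_gt w (x - lower w); first by rewrite ltrBlDl.
have ex : exists m, x - lower w < partial w m by exists m.
case: (ex_minnP ex) => -[|s] hs smin; first by move: hs; rewrite /partial big_geq//; lra.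
exists s; rewrite lower_rcons -addrA -partialS.
have : ~~ (x - lower w < partial w s) by apply/negP => /smin; rewrite ltnn.
by rewrite -leNgt => hs'; apply/andP; split; lra.
Qed.

Let cell_uniq w x s s' : cell (rcons w s) x -> cell (rcons w s') x -> s = s'.
Proof.
wlog ss : s s' / (s <= s')%N.
  by move=> H h1 h2; case/orP: (leq_total s s') => h; [|apply/esym]; exact: H.
rewrite /cell /= !lower_rcons -!addrA -!partialS => /andP[_ h1] /andP[h2 _].
apply/eqP; rewrite eqn_leq ss /= leqNgt; apply/negP => /(partial_mono w) h.
lra.
Qed.

Let next w x : nat := xget 0%N [set s | cell (rcons w s) x].

Fixpoint digits (x : R) k : seq nat :=
  if k is k'.+1 then rcons (digits x k') (next (digits x k') x) else [::].

Let cell0 : cell [::] = (`[0, 1[ : set R).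
Proof.
by rewrite /cell /lower big_ord0 q_nil add0r set_itvE.
Qed.

Let digits_cell x k : cell [::] x -> cell (digits x k) x.
Proof.
move=> x01; elim: k => //= k IH; rewrite /next.
by case: xgetP => // /(_ _) h; have [s /h] := cell_ex IH.
Qed.

Let digits_eq x w : cell [::] x -> (digits x (size w) = w) <-> cell w x.
Proof.
move=> x01; split=> [<-|]; first exact: digits_cell.
elim/last_ind: w => // w s IH xw; rewrite size_rcons /=.
have xw' := cell_rcons xw; rewrite (IH xw') /next; congr rcons.
by case: xgetP => [s' _ h|h]; [exact: cell_uniq h xw|case: (h s)].
Qed.

(** Points outside [0,1[ are sent to 0, so that the digits exist everywhere; these points have mass
    zero. *)
Let clamp (x : R) : R := if 0 <= x < 1 then x else 0.

Let clamp_cell x : cell [::] (clamp x).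
Proof.
rewrite cell0 /= in_itv /= /clamp; case: ifPn => [//|_] /=.
by rewrite lexx ltr01.
Qed.

Let X k (x : measurableTypeR R) : nat := next (digits (clamp x) k) (clamp x).

Let mkseqX x k : mkseq (fun i => X i x) k = digits (clamp x) k.
Proof. by elim: k => //= k IH; rewrite mkseqS IH. Qed.

Let cell_itv w : cell w = (`[lower w, lower w + q w[ : set R).
Proof. by rewrite set_itvE. Qed.

Let cell_sub w : cell w `<=` cell [::].
Proof. by elim/last_ind: w => // w s IH; exact: subset_trans (@cell_rcons w s) IH. Qed.

Let word_set w : [set x | mkseq (fun i => X i x) (size w) = w] =
  cell w `|` (if pselect (cell w 0) then ~` `[0, 1[ else set0).
Proof.
apply/seteqP; split=> x /=; rewrite mkseqX digits_eq//.
  rewrite /clamp; case: ifPn => x01; first by left.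
  by move=> h; right; case: pselect => //= _; rewrite /= in_itv; exact/negP.
case=> [h|].
  have := cell_sub h; rewrite cell0 /= in_itv /= /clamp => /andP[x0 x1].
  by rewrite x0 x1.
case: pselect => //= h; rewrite in_itv /= /clamp => /negP/negbTE x01.
by rewrite x01.
Qed.

Let P : probability (measurableTypeR R) R := uniform_prob (@ltr01 R).

Let P_cell w : P (cell w) = (q w)%:E.
Proof.
have -> : P (cell w) = (\int[lebesgue_measure]_(x in cell w) (uniform_pdf 0 1 x)%:E)%E by [].
rewrite integral_uniform_pdf setIidl; last first.
  by move=> x /cell_sub; rewrite cell0 /= !in_itv /= => /andP[-> /ltW ->].
rewrite (eq_integral (fun=> 1%:E)); last first.
  move=> x; rewrite inE => /cell_sub; rewrite cell0 /= in_itv /= => /andP[x0 x1].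
  by rewrite /uniform_pdf x0 (ltW x1) subr0 invr1.
rewrite integral_cst/=; last by rewrite cell_itv; exact: measurable_itv.
rewrite mul1e cell_itv lebesgue_measure_itv/= lte_fin ltrDl.
case: ifPn => [_|]; first by rewrite -EFinD addrAC subrr add0r.
by rewrite -leNgt => h; congr (_%:E); apply/eqP; rewrite eq_le h q_ge0.
Qed.

Let measurable_word w : measurable [set x : measurableTypeR R | mkseq (fun i => X i x) (size w) = w].
Proof.
rewrite word_set; apply: measurableU; first by rewrite cell_itv; exact: measurable_itv.
by case: (pselect (cell w 0)) => h; [apply: measurableC; exact: measurable_itv|exact: measurable0].
Qed.

Let P_word w : P [set x | mkseq (fun i => X i x) (size w) = w] = (q w)%:E.
Proof.
rewrite word_set; case: pselect => h; last by rewrite setU0 P_cell.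
have mi : measurable (`[0, 1[ : set R) by exact: measurable_itv.
have mc : measurable (cell w) by rewrite cell_itv; exact: measurable_itv.
have mo : measurable (~` `[0, 1[ : set R) by exact: measurableC.
have dis : cell w `&` ~` `[0, 1[ = set0.
  by apply/seteqP; split=> // x [/cell_sub]; rewrite cell0.
move: mi mo dis; rewrite -cell0 => mi mo dis.
have e : P (cell w `|` ~` cell [::]) = (P (cell w) + P (~` cell [::]))%E by exact: measureU.
have e1 : P (~` cell [::]) = (1 - P (cell [::]))%E by exact: probability_setC.
by rewrite e P_cell e1 P_cell q_nil subee// adde0.
Qed.

Let measurable_X k : measurable_fun [set: measurableTypeR R] (X k).
Proof.
move=> _ A _; rewrite setTI.
have -> : X k @^-1` A = \bigcup_(w in [set w | size w = k.+1 /\ A (last 0%N w)])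
    [set x | mkseq (fun i => X i x) (size w) = w].
  apply/seteqP; split=> x /=.
    move=> AX; exists (mkseq (fun i => X i x) k.+1); last by rewrite /mkset size_mkseq.
    by split; [rewrite size_mkseq|rewrite mkseqS last_rcons].
  by move=> [w [sw Aw]]; rewrite sw => /(congr1 (last 0%N)); rewrite mkseqS last_rcons => ->.
by apply: bigcup_measurable_countable => w _; exact: measurable_word.
Qed.

(** The unit interval is cut into intervals of lengths [q [:: s]], each of these again according to
    the next letter, and so on; the digits of a uniform point have the required law. A half-open
    interval that contains a point has positive length, so prefixes of weight zero occur nowhere,
    and not just almost nowhere. *)
Lemma realization : exists (d : measure_display) (Om : measurableType d)
    (Q : probability Om R) (Y : nat -> {RV Q >-> nat}),
  (forall om k, 0 < q (mkseq (fun i => Y i om) k)) /\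
  (forall w, measurable [set om | mkseq (fun i => Y i om) (size w) = w] /\
     Q [set om | mkseq (fun i => Y i om) (size w) = w] = (q w)%:E).
Proof.
pose Y k : {RV P >-> nat} := HB.pack (X k) (isMeasurableFun.Build _ _ _ _ (X k) (measurable_X k)).
exists _, _, P, Y; split=> [x k|w]; last by split; [exact: measurable_word|exact: P_word].
have := digits_cell k (clamp_cell x); rewrite -mkseqX /cell /=.
by move=> /andP[h1 h2]; have := le_lt_trans h1 h2; rewrite ltrDl.
Qed.

End Realization.

(** * Infinite trees coded by sequences, and the limiting random tree *)

Lemma dist_le_map (U V : eqType) (G : sgraph U) (H : sgraph V) (f : U -> V) r x y :
  (forall a b, G a b -> H (f a) (f b)) -> dist_le G r x y -> dist_le H r (f x) (f y).
Proof.
move=> fGH [p [px pl ps]]; exists (map f p); split; last by rewrite size_map.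
  by rewrite path_map; apply: sub_path px => a b; exact: fGH.
by rewrite last_map pl.
Qed.

Lemma rooted_iso_ball (F H : rooted_graph) r : rooted_iso F H ->
  rooted_iso (graph_ball (rooted_sgraph F) (rooted_root F) r)
             (graph_ball (rooted_sgraph H) (rooted_root H) r).
Proof.
move=> [f [[g fK gK] f0 fadj]].
have gadj x y : rooted_sgraph F (g x) (g y) = rooted_sgraph H x y by rewrite -fadj !gK.
have fd x : dist_le (rooted_sgraph F) r (rooted_root F) x ->
    dist_le (rooted_sgraph H) r (rooted_root H) (f x).
  by move=> h; rewrite -f0; apply: dist_le_map h => a b; rewrite fadj.
have gd x : dist_le (rooted_sgraph H) r (rooted_root H) x ->
    dist_le (rooted_sgraph F) r (rooted_root F) (g x).
  move=> h; rewrite -(fK (rooted_root F)) f0; apply: dist_le_map h => a b.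
  by rewrite gadj.
pose ff (x : ball_vertex (rooted_sgraph F) (rooted_root F) r) :
    ball_vertex (rooted_sgraph H) (rooted_root H) r :=
  exist _ (f (val x)) (asboolT (fd _ (asboolW (valP x)))).
pose gg (x : ball_vertex (rooted_sgraph H) (rooted_root H) r) :
    ball_vertex (rooted_sgraph F) (rooted_root F) r :=
  exist _ (g (val x)) (asboolT (gd _ (asboolW (valP x)))).
exists ff; split.
- by exists gg => x; apply: val_inj; rewrite /= ?fK ?gK.
- exact: val_inj.
- by move=> x y; exact: fadj.
Qed.

Section BfsTree.
Variable s : nat -> nat.
Hypothesis s_alive : forall k, k < discovered s k.

Lemma bfs_parent x : 0 < x -> bfs_graph s x (parent s x) /\ parent s x < x.
Proof.
move=> x0; have px := parent_ltn x0 (s_alive x); split=> //.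
by rewrite /= /bfs_adj px eqxx orbT.
Qed.

Lemma bfs_dist0 x : exists r, dist_le (bfs_graph s) r x 0.
Proof.
have [m] := ubnP x; elim: m x => // m IH x xm.
have [->|x0] := posnP x; first by exists 0; exact: dist_le_refl.
have [xp px] := bfs_parent x0; have [|r [p [pp pl ps]]] := IH (parent s x).
  exact: leq_trans px _.
exists r.+1, (parent s x :: p); split; [|exact: pl|exact: ps].
by apply/andP; split; [exact: xp|exact: pp].
Qed.

Lemma dist_le_sym (V : eqType) (G : sgraph V) r x y : dist_le G r x y -> dist_le G r y x.
Proof.
elim: r y => [|r IH] y; first by move=> /dist_le0 ->; exact: dist_le_refl.
move=> /dist_leS[/IH h|[z /IH [p [pp pl ps]] zy]]; first exact: dist_leW h.
by exists (z :: p); split=> //=; rewrite adj_sym zy.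
Qed.

Lemma dist_le_trans (V : eqType) (G : sgraph V) r r' x y z :
  dist_le G r x y -> dist_le G r' y z -> dist_le G (r + r') x z.
Proof.
move=> [p [pp pl ps]] [p' [pp' pl' ps']]; exists (p ++ p'); split.
- by rewrite cat_path pp pl.
- by rewrite last_cat pl.
- by rewrite size_cat leq_add.
Qed.

(** In a cycle of length at least three, the largest number would have two distinct smaller
    neighbours, both equal to its parent. *)
Lemma bfs_is_tree : is_tree (bfs_graph s).
Proof.
split=> [x y|c].
  have [r xr] := bfs_dist0 x; have [r' yr] := bfs_dist0 y.
  by exists (r + r'); apply: dist_le_trans xr (dist_le_sym yr).
case: c => [|x0 c0]; first by [].
set c := x0 :: c0 => /andP[cc uc].
have [m mc mmax] : exists2 m, m \in c & forall x, x \in c -> x <= m.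
  exists (\max_(x <- c) x); last by move=> x xc; exact: leq_bigmax_seq.
  by rewrite /c; elim: (c0) x0 {c cc uc} => [|y t IH] x;
    rewrite big_cons ?big_nil ?maxn0 ?mem_head//;
    case: (leqP x (\max_(j <- y :: t) j)) => _;
    rewrite in_cons ?eqxx// IH orbT.
have [i t Et] := rot_to mc.
rewrite -(size_rot i) Et.
have : cycle (bfs_graph s) (m :: t) by rewrite -Et rot_cycle.
have : uniq (m :: t) by rewrite -Et rot_uniq.
have tmax x : x \in t -> x <= m.
  by move=> xt; apply: mmax; rewrite -(mem_rot i) Et in_cons xt orbT.
case: t {Et} tmax => // a; case/lastP=> // t b tmax.
have am : a <= m by apply: tmax; rewrite mem_head.
have bm : b <= m by apply: tmax; rewrite in_cons mem_rcons mem_head orbT.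
rewrite /= rcons_path last_rcons => /and3P[_ + _] /and3P[+ _ +].
rewrite mem_rcons in_cons negb_or => /andP[+ _].
have pm z : z <= m -> bfs_adj s z m -> parent s m = z.
  by move=> zm; rewrite /bfs_adj [m < z]ltnNge zm orbF => /andP[_ /eqP].
move=> ab; rewrite bfs_adj_sym => /(pm _ am) pa /(pm _ bm) pb.
by move: ab; rewrite -pa -pb eqxx.
Qed.

Lemma bfs_locally_finite : locally_finite_graph (bfs_graph s).
Proof.
move=> x; apply: (@sub_finite_set _ _ `I_(discovered s x.+1)) (finite_II _) => y /=.
rewrite /bfs_adj => /orP[/andP[xy /eqP <-]|/andP[yx _]].
  by apply: ltn_discovered_parent; [exact: leq_ltn_trans xy|exact: s_alive].
exact: ltn_trans yx (ltn_trans (ltnSn x) (s_alive x.+1)).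
Qed.

Definition bfs_itree : itree := ITree 0 bfs_is_tree bfs_locally_finite.

Lemma frontier_mkseq k r : k = frontier s r -> frontier (nth 0 (mkseq s k)) r = k.
Proof.
move=> kr; have [|e|[+ _]] := @eq_frontier s (nth 0 (mkseq s k)) k r.
- by move=> i ik; rewrite nth_mkseq.
- by rewrite -e.
- by rewrite -kr ltnn.
Qed.

Lemma bfs_ball_iso r :
  rooted_iso (word_tree (mkseq s (frontier s r))) (graph_ball (bfs_graph s) 0 r).
Proof.
set k := frontier s r; set w := mkseq s k.
have sw : size w = k by rewrite size_mkseq.
have e i : i < k -> s i = nth 0 w i by move=> ik; rewrite nth_mkseq.
have dE j : j <= k -> discovered s j = disc w j by move=> jk; exact: eq_discovered e jk.
apply: (@word_tree_iso_ball _ (bfs_graph s) 0 r w (@nat_of_ord _)) => //.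
- exact: ord_inj.
- move=> i j; rewrite /= /word_adj; apply: (eq_bfs_adj e) => //.
  + by rewrite dE// -sw.
  + by rewrite dE// -sw.
- move=> i y ik iy; have yN : y < disc w (size w).
    rewrite [X in y < disc w X]sw -dE//.
    have {}ik : i < k by rewrite -[X in _ < X]sw.
    case/orP: iy => /andP[h /eqP pe].
      have y0 : 0 < y by exact: leq_ltn_trans h.
      apply: leq_trans (leq_discovered s ik); rewrite -pe.
      by apply: ltn_discovered_parent.
    by apply: (ltn_trans h); apply: (ltn_trans ik).
  by exists (Ordinal yN).
- by rewrite sw frontier_mkseq.
Qed.

End BfsTree.

Section BfsExploration.
Variable s : nat -> nat.
Hypothesis s_alive : forall k, k < discovered s k.

Let frontier_eq u r : mkseq s (size u) = u ->
  frontier s r = frontier (nth 0 u) r \/ size u < frontier s r /\ size u < frontier (nth 0 u) r.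
Proof. by move=> us; apply: eq_frontier => i iu; rewrite -us nth_mkseq. Qed.

Lemma complete_word_iso u r : complete r u -> mkseq s (size u) = u ->
  rooted_iso (word_tree u) (graph_ball (bfs_graph s) 0 r).
Proof.
move=> /eqP cu us; have [e|[_]] := frontier_eq r us; last by rewrite -cu ltnn.
by have := bfs_ball_iso s_alive r; rewrite e -cu us.
Qed.

(** The counterpart of [exploration_ball] for a tree whose order is already fixed: the weights are
    the indicators that the sequence begins with the word. *)
Lemma bfs_exploration (R : nzRingType) r F M : 0 < r -> size_bound F M ->
  (\sum_(u <- ball_words r M (fun u => `[< rooted_iso (word_tree u) F >]))
    (mkseq s (size u) == u)%:R)%R =
  `[< rooted_iso (graph_ball (bfs_graph s) 0 r) F >]%:R%R :> R.
Proof.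
move=> r0 FM; case: asboolP => bF /=; last first.
  apply: ball_words_sum0 => u cu /asboolP uF; case: eqP => // us; case: bF.
  by apply: rooted_iso_trans uF; apply: rooted_iso_sym; exact: complete_word_iso.
have fM : frontier s r.+1 <= M.
  have /size_bound_iso/(_ FM)/word_tree_size_bound :=
    rooted_iso_trans (bfs_ball_iso s_alive r) bF.
  rewrite size_mkseq -(@eq_discovered s _ (frontier s r))// => i ik.
  by rewrite nth_mkseq.
have fr u : active r u -> mkseq s (size u) = u -> size u < frontier s r.
  by move=> au us; have [->|[]//] := frontier_eq r us.
apply: ball_words_sum => [|u au|u au Mu|u cu].
- by rewrite eqxx.
- have e i : (mkseq s (size (rcons u i)) == rcons u i) =
      (mkseq s (size u) == u) && (s (size u) == i).
    by rewrite size_rcons mkseqS eqseq_rcons.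
  under eq_bigr do rewrite e.
  case: (eqVneq (mkseq s (size u)) u) => [us|_]; last by rewrite big1.
  have sM : s (size u) < M.
    have := leq_trans (leq_discovered s (fr _ au us)) fM.
    by rewrite discoveredS; apply: leq_trans; rewrite -add1n leq_add2r.
  rewrite (bigD1 (Ordinal sM)) //= eqxx big1 ?addr0// => i iM.
  by case: eqP => // si; move: iM; rewrite -val_eqE /= si eqxx.
- case: eqP => // us; have := leq_trans (fr _ au us) (leq_trans (leq_frontierS s r) fM).
  by move/ltnW; rewrite leqNgt Mu.
- by case: eqP => // us /asboolP[]; apply: rooted_iso_trans bF; exact: complete_word_iso.
Qed.

End BfsExploration.

Section ConditionedWalk.
Variable R : realType.
Local Open Scope ring_scope.
Local Open Scope classical_set_scope.
Variable p : nat -> R.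
Hypothesis p_ge0 : forall k, 0 <= p k.
Hypothesis p0 : p 0%N = 0.
Hypothesis p_sum : series p n @[n --> \oo] --> (1 : R).
Hypothesis p_mean : series (fun k => k%:R * p k) n @[n --> \oo] --> (2 : R).

(* Doob transform of the walk [discovered k - k] conditioned to stay positive *)
Definition word_weight w : R :=
  if w is [::] then 1 else `[< prealive w >]%:R * word_limit p w.

Lemma prealive_leq w : prealive w -> (size w <= disc w (size w))%N.
Proof.
case/lastP: w => // w s h; rewrite size_rcons.
have := h (size w); rewrite size_rcons ltnSn => /(_ isT) /leq_trans; apply.
exact: leq_discovered.
Qed.

Lemma word_weight_ge0 w : 0 <= word_weight w.
Proof.
rewrite /word_weight; case: w => // a w; case: asboolP => al; last by rewrite mul0r.
rewrite mul1r /word_limit mulr_ge0 ?prodr_ge0// divr_ge0// subr_ge0 ler_nat.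
exact: prealive_leq.
Qed.

Let p_sumS : series (fun k => p k.+1) n @[n --> \oo] --> (1 : R).
Proof.
have -> : series (fun k => p k.+1) = (fun n => series p n.+1).
  by apply/funext => n; rewrite /series /= big_nat_recl//= p0 add0r.
by have := p_sum; rewrite -(cvg_shiftS (series p)).
Qed.

Let p_meanS : series (fun k => k.+1%:R * p k.+1) n @[n --> \oo] --> (2 : R).
Proof.
have -> : series (fun k => k.+1%:R * p k.+1) = (fun n => series (fun k => k%:R * p k) n.+1).
  by apply/funext => n; rewrite /series /= big_nat_recl//= mul0r add0r.
by have := p_mean; rewrite -(cvg_shiftS (series (fun k => k%:R * p k))).
Qed.

(** A letter [s] changes b, the number of discovered unexplored vertices, into (b-2) + (s+1) and has
    probability [p s.+1]. As [p] has no mass at 0 and mean two, the sum over [s] is (b-2) + 2 = b.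
    For the first letter, b/s is 1. *)
Lemma word_weight_consistent w :
  series (fun s => word_weight (rcons w s)) n @[n --> \oo] --> word_weight w.
Proof.
case: (posnP (size w)) => [w0|k0].
  have -> : w = [::] by apply/nilP; rewrite /nilp w0.
  rewrite [X in _ --> X]/word_weight.
  suff -> : (fun s => word_weight (rcons [::] s)) = p by exact: p_sum.
  apply/funext => s; rewrite /word_weight /= asboolT; last first.
    by move=> [|//] _; rewrite /discovered big_ord0.
  rewrite mul1r /word_limit /= discoveredS /discovered big_ord0 /= big_seq1.
  rewrite -natrB// subn1 /= add0n; case: s => [|s]; first by rewrite p0 mulr0.
  by rewrite divff ?mul1r// pnatr_eq0.
have wE s : word_weight (rcons w s) = `[< prealive (rcons w s) >]%:R * word_limit p (rcons w s).
  by case: (w) k0.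
have -> : word_weight w = `[< prealive w >]%:R * word_limit p w by case: (w) k0.
(* A word that is [prealive] but not [alive] has no unexplored vertex left, so its weight is zero
   like that of its continuations. *)
have [al|dead] := pselect (alive w); last first.
  have -> : (fun s => word_weight (rcons w s)) = (fun=> 0).
    apply/funext => s; rewrite wE; case: asboolP => [/prealive_rcons //|_].
    by rewrite mul0r.
  rewrite (_ : _ * _ = 0); last first.
    case: asboolP => pw; last by rewrite mul0r.
    rewrite mul1r /word_limit (_ : disc w (size w) = size w) ?subrr ?mul0r//.
    apply/eqP; rewrite eqn_leq prealive_leq// andbT leqNgt; apply/negP => h.
    by apply: dead => j; rewrite leq_eqVlt => /orP[/eqP ->//|]; exact: pw.
  apply: cvg_near_cst; apply: nearW => n.
  by rewrite /series /= big1.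
rewrite asboolT ?mul1r; last exact: alive_prealive.
set c := (\prod_(x <- word_degrees w) p x) / (nth 0%N w 0)%:R.
set b : R := (disc w (size w))%:R - (size w)%:R.
have -> : word_limit p w = c * (b - 2) * 1 + c * 2.
  rewrite /word_limit -/b /c; set P := \prod_(x <- _) _.
  by move: P ((nth 0%N w 0)%:R^-1) => P x; lra.
have -> : series (fun s => word_weight (rcons w s)) =
    (fun n => c * (b - 2) * series (fun k => p k.+1) n + c * series (fun k => k.+1%:R * p k.+1) n).
  apply/funext => n; rewrite /series /= !mulr_sumr -big_split; apply: eq_bigr => s _ /=.
  rewrite wE asboolT ?mul1r; last exact/prealive_rcons.
  rewrite /word_limit size_rcons disc_rconsS word_degrees_rcons// nth_rcons k0.
  rewrite -cats1 big_cat big_seq1 /= natrD -[(size w).+1%:R]natr1 -[s.+1%:R]natr1.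
  have -> : (disc w (size w))%:R = b + (size w)%:R :> R by rewrite /b subrK.
  rewrite /c; set P := \prod_(x <- _) _.
  by move: P ((nth 0%N w 0)%:R^-1) b (p s.+1) => P x y z; lra.
by apply: cvgD; apply: cvgMr.
Qed.

(** The law is the image of the realized sequence under the coding of trees. A ball is [F] exactly
    when the sequence begins with one of the listed words, and the probabilities of these words add
    up to [ball_limit]. *)
Theorem infinite_random_tree : exists rho : probability infinite_trees R,
  forall r F M, (0 < r)%N -> size_bound F M -> ball_probability rho r F = ball_limit p r F M.
Proof.
have [d [Om [Q [Y [Ypos Yword]]]]] :=
  realization word_weight_ge0 (erefl _) word_weight_consistent.
(* Every prefix has positive weight and is therefore [prealive]; at length [k.+1] this says that the
   exploration is not over at step [k]. *)
have Yalive om k : (k < discovered (fun i => Y i om) k)%N.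
  have := Ypos om k.+1; rewrite /word_weight; case E: (mkseq _ _) => [//|a u].
  rewrite -E; case: asboolP => al; last by rewrite mul0r ltxx.
  move=> _; have := al k; rewrite size_mkseq => /(_ (ltnSn k)).
  rewrite -(@eq_discovered (fun i => Y i om) _ k.+1)// => i ik.
  by rewrite nth_mkseq.
pose tree om : itree := bfs_itree (Yalive om).
pose X om : infinite_trees := (\pi_itree_class (tree om))%qT.
pose A r F : set Om := [set om | rooted_iso (graph_ball (bfs_graph (fun i => Y i om)) 0%N r) F].
pose W u : set Om := [set om | mkseq (fun i => Y i om) (size u) = u].
have XA r F : X @^-1` (cylinder r F) = A r F.
  apply/seteqP; split=> om; rewrite /cylinder /A /=.
    have /eqmodP/asboolP/rooted_iso_ball h : (repr (X om) = tree om %[mod itree_class])%qT.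
      by rewrite reprK.
    by apply: rooted_iso_trans; apply: rooted_iso_sym; exact: h.
  have /eqmodP/asboolP/rooted_iso_ball h : (repr (X om) = tree om %[mod itree_class])%qT.
    by rewrite reprK.
  by apply: rooted_iso_trans; exact: h.
pose L r F M := ball_words r M (fun u => `[< rooted_iso (word_tree u) F >]).
have AW r F M : (0 < r)%N -> size_bound F M -> A r F = \bigcup_(u in [set u | u \in L r F M]) W u.
  move=> r0 FM; apply/seteqP; split=> om.
    move=> Aom; have := bfs_exploration (Yalive om) R r0 FM; rewrite asboolT//.
    have [[u uL Wu]|none] := pselect (exists2 u, u \in L r F M & W u om).
      by move=> _; exists u.
    rewrite big_seq big1 => [/esym/eqP|u uL]; first by rewrite oner_eq0.
    by case: eqP => // Wu; case: none; exists u.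
  move=> [u /complete_ball_words/andP[cu /asboolP uF] Wu].
  apply: rooted_iso_trans uF; apply: rooted_iso_sym.
  exact (complete_word_iso (Yalive om) cu Wu).
have mW u : measurable (W u) by have [] := Yword u.
have mA r F : finite_rooted_graph F -> measurable (A r F).
  (* The generators include radius 0, where all balls are single vertices and the event is
     everything or empty. *)
  move=> /finite_size_bound[M FM]; case: (posnP r) => [->|r0]; last first.
    by rewrite (AW _ _ _ r0 FM); apply: bigcup_measurable_countable => u _; exact: mW.
  have [iF|niF] := pselect (rooted_iso (word_tree [::]) F).
    have -> : A 0%N F = setT; last exact: measurableT.
    apply/seteqP; split=> // om _; apply: rooted_iso_trans iF.
    by apply: rooted_iso_sym; exact: (bfs_ball_iso (Yalive om) 0).
  have -> : A 0%N F = set0; last exact: measurable0.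
  apply/seteqP; split=> // om Aom; apply: niF; apply: rooted_iso_trans Aom.
  exact: (bfs_ball_iso (Yalive om) 0).
have mX : measurable_fun setT X.
  apply: (@measurability _ _ _ _ setT X cylinders) => //.
  move=> _ [_ [r [F [fF _ _ ->]]] <-]; rewrite setTI XA; exact: mA.
pose XRV : {RV Q >-> infinite_trees} := HB.pack X (isMeasurableFun.Build _ _ _ _ X mX).
exists (distribution Q XRV) => r F M r0 FM.
have mArF : measurable (A r F).
  by rewrite (AW _ _ _ r0 FM); apply: bigcup_measurable_countable => u _; exact: mW.
suff e : Q (A r F) = (ball_limit p r F M)%:E.
  by rewrite -XA in e; exact: (congr1 fine e).
have -> : Q (A r F) = (\int[Q]_om (\1_(A r F) om)%:E)%E by rewrite integral_indic// setIT.
transitivity (\int[Q]_om (\sum_(u <- L r F M) (\1_(W u) om)%:E))%E.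
  apply: eq_integral => om _; rewrite sumEFin; congr (_%:E).
  rewrite indicE (_ : (om \in A r F) = `[< A r F om >]); last by apply/idP/asboolP; rewrite inE.
  rewrite -(bfs_exploration (Yalive om) R r0 FM); apply: eq_bigr => u _.
  by rewrite indicE; congr (_%:R); congr nat_of_bool; apply/eqP/idP; rewrite inE.
rewrite ge0_integral_sum//; last first.
  by move=> u; apply/measurable_EFinP; exact: measurable_indic.
rewrite /ball_limit -sumEFin big_seq [RHS]big_seq; apply: eq_bigr => u.
move=> /complete_ball_words/andP[cu _].
rewrite integral_indic// setIT.
transitivity (word_weight u)%:E; [exact: (Yword u).2|congr (_%:E)].
have := complete_gt0 r0 cu; rewrite /word_weight; case: (u) cu => // a v cu _.
by rewrite asboolT ?mul1r//; exact: complete_prealive cu.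
Qed.

End ConditionedWalk.

(** * Integer random variables and the law of the random tree *)

Lemma measurable_RV_pre {R : realType} d d' (Om : measurableType d) (E : measurableType d')
    (P : probability Om R) (X : {RV P >-> E}) (A : set E) :
  measurable A -> measurable [set w | A (X w)]%classic.
Proof. by move=> mA; rewrite -[X in measurable X]setTI; exact: measurable_funP. Qed.

Section NatVariables.
Local Open Scope classical_set_scope.
Local Open Scope ring_scope.
Context {R : realType} {d : measure_display} {Om : measurableType d}.
Variable P : probability Om R.

Lemma series_of_nneseries (u : nat -> R) (l : R) : (forall k, 0 <= u k) ->
  (\sum_(k <oo) (u k)%:E = l%:E)%E -> series u n @[n --> \oo] --> l.
Proof.
move=> u0 ul.
have h : (fun n => \sum_(0 <= k < n) (u k)%:E)%E @ \oo --> l%:E.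
  by rewrite -ul; apply: is_cvg_nneseries => k _ _; rewrite lee_fin.
have [_] := (fine_cvgP _ _).1 h.
apply: cvg_trans; apply: near_eq_cvg; apply: nearW => n.
by rewrite /= sumEFin.
Qed.

Variable X : {RV P >-> nat}.

Definition pmf_nat k : R := fine (P [set w | X w = k]).

Lemma measurable_nat_fiber k : measurable [set w | X w = k].
Proof. exact: (measurable_RV_pre X (A := [set k])). Qed.

Lemma pmf_nat_ge0 k : 0 <= pmf_nat k.
Proof. by rewrite /pmf_nat fine_ge0. Qed.

Lemma pmf_natE k : P [set w | X w = k] = (pmf_nat k)%:E.
Proof. by rewrite fineK// fin_num_measure//; exact: measurable_nat_fiber. Qed.

Lemma nat_bigcup_fibers : \bigcup_k [set w | X w = k] = setT.
Proof. by apply/seteqP; split=> // w _; exists (X w). Qed.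

Lemma trivIset_fibers : trivIset setT (fun k => [set w | X w = k]).
Proof. by move=> i j _ _ [w [/= <- <-]]. Qed.

Lemma pmf_nat_sum : series pmf_nat n @[n --> \oo] --> (1 : R).
Proof.
apply: series_of_nneseries; first exact: pmf_nat_ge0.
rewrite -(probability_setT P) -nat_bigcup_fibers measure_semi_bigcup//.
- by apply: eq_eseriesr => k _; exact/esym/pmf_natE.
- by move=> k; exact: measurable_nat_fiber.
- exact: trivIset_fibers.
- by rewrite nat_bigcup_fibers; exact: measurableT.
Qed.

Lemma measurable_fun_natR : measurable_fun setT (fun w => (X w)%:R : R).
Proof.
move=> _ A _; rewrite setTI.
have -> : (fun w => (X w)%:R : R) @^-1` A = X @^-1` [set k | A k%:R] by [].
exact: (measurable_RV_pre X (A := [set k | A k%:R])).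
Qed.

Lemma expectation_nat :
  ('E_P[fun w => (X w)%:R] = \sum_(k <oo) (k%:R * pmf_nat k)%:E)%E.
Proof.
rewrite unlock -nat_bigcup_fibers ge0_integral_bigcup.
- apply: eq_eseriesr => k _.
  rewrite (eq_integral (fun=> k%:R%:E)); last by move=> w; rewrite inE /= => ->.
  rewrite integral_cst; last exact: measurable_nat_fiber.
  by rewrite EFinM; congr (_ * _)%E; exact: pmf_natE.
- exact: measurable_nat_fiber.
- rewrite nat_bigcup_fibers; apply/measurable_EFinP; exact: measurable_fun_natR.
- by move=> w _; rewrite lee_fin.
- exact: trivIset_fibers.
Qed.

Lemma pmf_nat_mean (m : R) : ('E_P[fun w => (X w)%:R] = m%:E)%E ->
  series (fun k => k%:R * pmf_nat k) n @[n --> \oo] --> m.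
Proof.
move=> Em; apply: series_of_nneseries; last by rewrite -expectation_nat.
by move=> k; rewrite mulr_ge0// pmf_nat_ge0.
Qed.

End NatVariables.

(** The image of the last element is corrected by a transposition that moves none of the earlier
    images. *)
Lemma perm_extend (T : finType) (p q : seq T) : uniq p -> uniq q -> size p = size q ->
  exists s : {perm T}, map s p = q.
Proof.
elim/last_ind: p q => [|p x IH] q; case/lastP: q => [|q y];
  rewrite ?size_rcons// => up uq; first by exists 1%g.
move: up uq; rewrite !rcons_uniq => /andP[xp up] /andP[yq uq] [spq].
have [s sp] := IH q up uq spq; exists (s * tperm (s x) y)%g.
rewrite map_rcons permM tpermL; congr rcons; rewrite -[RHS]sp.
apply/eq_in_map => z zp; rewrite permM tpermD//.
  by rewrite (inj_eq perm_inj); apply: contra xp => /eqP ->.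
by apply: contra yq => /eqP ->; rewrite -sp map_f.
Qed.

Section FinitePartition.
Local Open Scope classical_set_scope.
Local Open Scope ereal_scope.
Context {R : realType} {d : measure_display} {Om : measurableType d}.
Variable P : probability Om R.

Lemma probability_partition (J : finType) (f : Om -> J) (S : set Om) :
  measurable S -> (forall j, measurable [set w | f w = j]) ->
  P S = \sum_j P (S `&` [set w | f w = j]).
Proof.
move=> mS mf.
transitivity (\int[P]_w (\sum_j (\1_(S `&` [set w | f w = j]) w)%:E)).
  transitivity (\int[P]_w (\1_S w)%:E); first by rewrite integral_indic// setIT.
  apply: eq_integral => w _; rewrite sumEFin; congr (_%:E).
  rewrite (bigD1 (f w)) //= big1 ?addr0 => [|j jw].
    by rewrite !indicE; congr (_%:R)%R; congr nat_of_bool; apply/idP/idP; rewrite !inE; [split|case].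
  rewrite indicE (_ : (_ \in _) = false)//; apply/negbTE; rewrite notin_setE => -[_ /= fj].
  by move: jw; rewrite fj eqxx.
rewrite ge0_integral_sum//; last first.
  by move=> j; apply/measurable_EFinP; apply: measurable_indic; exact: measurableI.
apply: eq_bigr => j _; rewrite integral_indic// ?setIT//; exact: measurableI.
Qed.

End FinitePartition.

Section TreeLaw.
Local Open Scope classical_set_scope.
Context {R : realType} {d : measure_display} {Om : measurableType d}.
Variables (P : probability Om R) (n : nat).
Notation V := 'I_n.+1.
Variable D : V -> {RV P >-> nat}.
Variable T : {RV P >-> lgraph n.+1}.
Hypothesis D_seq : random_degree_sequence D.
Hypothesis D_exch : exchangeable D.
Hypothesis T_unif : uniform_tree_given D T.

Definition law (t : lgraph n.+1) : R := fine (P [set w | T w = t]).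

Lemma measurable_T (A : set (lgraph n.+1)) : measurable [set w | A (T w)].
Proof. exact: measurable_RV_pre. Qed.

Lemma measurable_D i (A : set nat) : measurable [set w | A (D i w)].
Proof. exact: measurable_RV_pre. Qed.

(** Degrees are below [n.+2], so the degree vector takes values in a finite type; this gives
    measurability and finite partitions. *)
Let degs (w : Om) : {ffun V -> 'I_n.+2} := [ffun i => inord (D i w)].

Let D_lt i w : D i w < n.+2.
Proof.
have [t [_ td]] := D_seq w; rewrite -td ltnS.
by apply: (leq_trans (max_card _)); rewrite card_ord.
Qed.

Let degsE i w : degs w i = D i w :> nat.
Proof. by rewrite ffunE inordK. Qed.

Let degs_eq x w : degs w = x <-> forall i, D i w = x i.
Proof.
split=> [<- i|h]; first by rewrite degsE.
by apply/ffunP => i; apply: val_inj; rewrite /= degsE h.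
Qed.

Let measurable_degs_set (A : set {ffun V -> 'I_n.+2}) : measurable [set w | A (degs w)].
Proof.
have -> : [set w | A (degs w)] = \bigcup_(x in A) \bigcap_(i in [set: V]) [set w | D i w = x i].
  apply/seteqP; split=> w /=.
    by move=> Aw; exists (degs w) => // i _ /=; rewrite degsE.
  by move=> [x Ax h]; rewrite (_ : degs w = x)//; apply/degs_eq => i; exact: h.
apply: fin_bigcup_measurable => [|x _]; first exact: finite_finset.
apply: fin_bigcap_measurable => [|i _]; first exact: finite_finset.
exact: (measurable_D i [set k : nat | k = x i :> nat]).
Qed.

Lemma measurable_degrees (A : set (V -> nat)) : measurable [set w | A (fun i => D i w)].
Proof.
have -> : [set w | A (fun i => D i w)] = [set w | A (fun i => degs w i : nat)].
  by apply/seteqP; split=> w /=; (have -> : (fun i => D i w) = (fun i => degs w i : nat) by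
    apply/funext => i; rewrite degsE).
exact: (measurable_degs_set [set x : {ffun V -> 'I_n.+2} | A (fun i => x i : nat)]).
Qed.

Local Open Scope ring_scope.

Lemma probability_fin_num (A : set Om) : measurable A -> P A = (fine (P A))%:E.
Proof. by move=> mA; rewrite fineK// fin_num_measure. Qed.

(** The conditional law gives mass zero to [T w = t] together with any degree vector other than that
    of [t], so on [T w = t] the degrees are almost surely those of [t]. *)
Lemma law_degrees t (C : set (V -> nat)) :
  P ([set w | T w = t] `&` [set w | C (fun i => D i w)]) =
  (law t * `[< is_tree t /\ C (degree t) >]%:R)%:E.
Proof.
have mT : measurable [set w | T w = t] by exact: (measurable_T [set u | u = t]).
have key (C' : set (V -> nat)) :
  P ([set w | T w = t] `&` [set w | C' (fun i => D i w)]) =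
  (P ([set w | T w = t] `&` [set w | (fun i => D i w) = degree t]) *
   (`[< is_tree t /\ C' (degree t) >]%:R)%:E)%E.
  have mC : measurable [set w | C' (fun i => D i w)] by exact: measurable_degrees.
  rewrite (@probability_partition _ _ _ P _ degs); last 2 first.
  - exact: measurableI.
  - by move=> x; exact: (measurable_degs_set [set y | y = x]).
  have z (x : {ffun V -> 'I_n.+2}) : ~ (is_tree t /\ degree t =1 (fun i => x i : nat)) ->
      P ([set w | T w = t] `&` [set w | C' (fun i => D i w)] `&` [set w | degs w = x]) = 0%E.
    move=> nx; apply/eqP; rewrite -measure_le0.
    have <- : P [set w | T w = t /\ forall i, D i w = x i] = 0%E.
      rewrite T_unif (_ : (t \in _) = false) ?mul0r ?mule0//; apply/negbTE.
      by rewrite finset.in_set; apply/asboolPn => -[tt tx]; apply: nx.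
    rewrite le_measure ?inE//.
    + by apply: measurableI; [exact: measurableI|exact: (measurable_degs_set [set y | y = x])].
    + have -> : [set w | T w = t /\ forall i, D i w = x i] =
          [set w | T w = t] `&` [set w | (forall i, D i w = x i)] by [].
      apply: measurableI => //.
      exact: (measurable_degrees [set y : V -> nat | forall i, y i = x i :> nat]).
    + by move=> w /= [[Tw _] /degs_eq].
  have dt i : (degree t i < n.+2)%N.
    by rewrite ltnS; apply: (leq_trans (max_card _)); rewrite card_ord.
  pose x0 : {ffun V -> 'I_n.+2} := [ffun i => inord (degree t i)].
  have x0E i : x0 i = degree t i :> nat by rewrite ffunE inordK.
  rewrite (bigD1 x0) //= big1 ?adde0 => [|x xx0]; last first.
    apply: z => -[_ e]; move/eqP: xx0; apply; apply/ffunP => i; apply: val_inj.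
    by rewrite /= x0E e.
  case: asboolP => [[tt Ct]|nC]; last first.
    rewrite mule0; have [tt|nt] := pselect (is_tree t); last by apply: z => -[].
    rewrite (_ : _ `&` _ = set0) ?measure0//; apply/seteqP; split=> // w /= [[_ Cw] /degs_eq dw].
    apply: nC; split=> //; rewrite (_ : degree t = (fun i => D i w))//.
    by apply/funext => i; rewrite dw x0E.
  rewrite mule1; congr (P _); apply/seteqP; split=> w /=.
    move=> [[Tw _] /degs_eq dw]; split=> //.
    by apply/funext => i; rewrite dw x0E.
  move=> [Tw dw]; split; first by rewrite dw.
  by apply/degs_eq => i; rewrite x0E -dw.
have lawE : P [set w | T w = t] = (P ([set w | T w = t] `&` [set w | (fun i => D i w) = degree t]) *
   (`[< is_tree t /\ True >]%:R)%:E)%E.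
  by rewrite -(key setT) /= setIT.
rewrite key EFinM -probability_fin_num// lawE -muleA -EFinM -natrM mulnb.
congr (_ * (_%:R)%:E)%E; congr nat_of_bool.
by apply/asboolP/andP => [[tt Ct]|[_ /asboolP//]]; split; exact/asboolP.
Qed.

Lemma law_ge0 t : 0 <= law t.
Proof. exact: fine_ge0. Qed.

Lemma law_sum (A : pred (lgraph n.+1)) :
  P [set w | A (T w)] = (\sum_t law t * (A t)%:R)%:E.
Proof.
rewrite (@probability_partition _ _ _ P _ T); last 2 first.
- exact: (measurable_T [set t | A t]).
- by move=> t; exact: (measurable_T [set u | u = t]).
rewrite -sumEFin; apply: eq_bigr => t _; case: (boolP (A t)) => At.
  rewrite mulr1 -probability_fin_num; last exact: (measurable_T [set u | u = t]).
  by congr (P _); apply/seteqP; split=> w /=; [case|move=> ->].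
rewrite mulr0 (_ : _ `&` _ = set0) ?measure0//; apply/seteqP; split=> // w /= [+ Tw].
by rewrite Tw (negbTE At).
Qed.

Lemma law_degree_prob p ds :
  P [set w | [seq D i w | i <- p] = ds] = (degree_prob law p ds)%:E.
Proof.
have m : measurable [set w | [seq D i w | i <- p] = ds].
  exact: (measurable_degrees [set y | [seq y i | i <- p] = ds]).
rewrite (@probability_partition _ _ _ P _ T)//; last first.
  by move=> t; exact: (measurable_T [set u | u = t]).
rewrite /degree_prob -sumEFin; apply: eq_bigr => t _; rewrite setIC.
rewrite (law_degrees t [set y | [seq y i | i <- p] = ds]).
have := law_degrees t setT; rewrite setIT.
rewrite (probability_fin_num (measurable_T [set u | u = t])) => -[lt].
congr (_%:E); move: lt; rewrite -/(law t); have [tt|nt] := pselect (is_tree t).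
  by move=> _; congr (_ * _%:R); congr nat_of_bool; apply/asboolP/eqP => [[]|].
rewrite asboolF ?mulr0 => [->|[]//]; by rewrite !mul0r.
Qed.

Theorem law_tree_law : tree_law law.
Proof.
split.
- exact: law_ge0.
- have := law_sum predT; rewrite (_ : [set w | _] = setT); last by apply/seteqP.
  by rewrite probability_setT => -[->]; apply: eq_bigr => t _; rewrite mulr1.
- move=> t; apply: contraNP => nt.
  have := law_degrees t setT; rewrite setIT asboolF ?mulr0 => [e|[]//].
  by rewrite /law e.
- move=> t u tt uu tu.
  have e : (degree t : V -> nat) = degree u by apply/funext.
  have h (t' : lgraph n.+1) : is_tree t' -> law t' = fine (P [set w | forall i, D i w = degree t' i]) /
      #|trees_with_degrees (degree t')|%:R.
    move=> tt'; have := law_degrees t' [set x | x = degree t'].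
    rewrite asboolT// mulr1 => h; rewrite -[law t']/(fine (law t')%:E) -h.
    have -> : [set w | T w = t'] `&` [set w | [set x | x = degree t'] (fun i => D i w)] =
       [set w | T w = t' /\ forall i, D i w = degree t' i].
      by apply/seteqP; split=> w /= [-> h']; split=> //; [move=> i; rewrite -h'|exact/funext].
    have mD : measurable [set w | forall i, D i w = degree t' i].
      exact: (measurable_degrees [set y | forall i, y i = degree t' i]).
    rewrite T_unif fineM//; last exact: fin_num_measure.
    by rewrite finset.in_set asboolT//= mul1r.
  by rewrite (h t tt) (h u uu) e.
- move=> p q ds up uq spq.
  have [s sp] := perm_extend up uq spq.
  have := D_exch s [set y | [seq y i | i <- p] = ds] => /=.
  have -> : [set w | [seq D (s i) w | i <- p] = ds] = [set w | [seq D i w | i <- q] = ds].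
    by rewrite -sp; apply/seteqP; split=> w /=; rewrite -map_comp.
  by rewrite !law_degree_prob => -[].
Qed.

End TreeLaw.

(** * From convergence of the degrees to convergence of the trees *)

Section TestFunction.
Local Open Scope classical_set_scope.
Local Open Scope ring_scope.
Variables (R : realType) (k : nat) (v : 'I_k -> nat).

(** The positive part of 1 - x, written with an absolute value, which makes continuity immediate. *)
Definition tent (x : R) : R := (1 - x + `|1 - x|) / 2.

Lemma tent0 : tent 0 = 1.
Proof. by rewrite /tent subr0 normr1 -(natrD _ 1 1) divff// pnatr_eq0. Qed.

Lemma tent_ge1 x : 1 <= x -> tent x = 0.
Proof. by move=> x1; rewrite /tent ler0_norm ?subr_le0// subrr mul0r. Qed.

Lemma tent_bounds x : 0 <= x -> 0 <= tent x <= 1.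
Proof.
move=> x0; rewrite /tent; have [h|h] := ger0P (1 - x); apply/andP; split; lra.
Qed.

(** A bounded continuous function that on integer vectors is the indicator of [v], because distinct
    integers differ by at least one. *)
Definition point_test (x : 'rV[R]_k) : R := \prod_(i < k) tent `|x ord0 i - (v i)%:R|.

Lemma continuous_point_test : continuous point_test.
Proof.
suff H (x : 'rV[R]_k) : point_test @ x --> point_test x by move=> x; exact: H.
suff H i : tent `|y ord0 i - (v i)%:R| @[y --> x] --> tent `|x ord0 i - (v i)%:R|.
  have h := @cvg_big R 'I_k *%R 1 xpredT (@mul_continuous R) 'rV[R]_k (nbhs x)
    (index_enum 'I_k) _ _ _ (fun i _ => H i).
  exact: h.
have c0 : `|y ord0 i - (v i)%:R| @[y --> x] --> `|x ord0 i - (v i)%:R|.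
  by apply: cvg_norm; apply: cvgB; [exact: coord_continuous|exact: cvg_cst].
have c1 : 1 - `|y ord0 i - (v i)%:R| @[y --> x] --> 1 - `|x ord0 i - (v i)%:R|.
  by apply: cvgB => //; exact: cvg_cst.
apply: cvgM; last exact: cvg_cst.
by apply: cvgD => //; exact: cvg_norm.
Qed.

Lemma bounded_point_test : bounded_fun point_test.
Proof.
exists 1; split; first exact: num_real.
move=> M M1 x _; have h i : 0 <= tent `|x ord0 i - (v i)%:R| <= 1 by exact: tent_bounds.
rewrite /= ger0_norm ?prodr_ge0//; last by move=> i _; case/andP: (h i).
by apply: (le_trans _ (ltW M1)); apply: prodr_ile1 => i _; exact: h.
Qed.

Lemma point_test_nat (x : 'I_k -> nat) :
  point_test (\row_i (x i)%:R) = `[< forall i, x i = v i >]%:R.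
Proof.
rewrite /point_test; case: asboolP => [e|ne].
  by rewrite big1// => i _; rewrite mxE e subrr normr0 tent0.
have [i /eqP xv] : exists i, x i <> v i by apply: contra_notP ne => h i; apply: contra_notP h => ?; exists i.
rewrite (bigD1 i) //= mxE tent_ge1 ?mul0r//.
rewrite -[(x i)%:R]/((x i)%:Z%:~R) -[(v i)%:R]/((v i)%:Z%:~R) -intrB -intr_norm.
by rewrite ler1z; lia.
Qed.

End TestFunction.

Section FirstDirection.
Local Open Scope classical_set_scope.
Local Open Scope ring_scope.
Variables (R : realType) (d : nat -> measure_display)
  (Om : forall n : nat, measurableType (d n))
  (P : forall n : nat, probability (Om n) R)
  (D : forall n : nat, 'I_n -> {RV (P n) >-> nat})
  (T : forall n : nat, {RV (P n) >-> lgraph n}).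
Hypothesis H : forall n : nat, (2 <= n)%N ->
    [/\ random_degree_sequence (@D n), exchangeable (@D n) &
        uniform_tree_given (@D n) (@T n)].

Let mu n : lgraph n.+1 -> R := law (@T n.+1).

Lemma mu_tree_law n : (0 < n)%N -> tree_law (@mu n).
Proof. by move=> n0; have [|a b c] := H (n := n.+1); [|exact: (law_tree_law a b c)]. Qed.

Lemma expectation_point_test d' (Om' : measurableType d') (Q : probability Om' R) k
    (X : 'I_k -> {RV Q >-> nat}) (v : 'I_k -> nat) :
  ('E_Q[point_test v \o (fun w => \row_i (X i w)%:R)] = Q [set w | forall i, X i w = v i])%E.
Proof.
rewrite -expectation_indic; last first.
  have -> : [set w | forall i, X i w = v i] = \bigcap_(i in [set: 'I_k]) [set w | X i w = v i].
    by apply/seteqP; split=> w /= h i; [move=> _|]; exact: h.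
  apply: fin_bigcap_measurable => [|i _]; first exact: finite_finset.
  exact: measurable_nat_fiber.
congr expectation; apply/funext => w /=; rewrite point_test_nat indicE.
by congr (_%:R); congr nat_of_bool; apply/asboolP/idP; rewrite inE.
Qed.

(** Defined for every [N] by means of [insub], so that sequences indexed by [size ds + n] and by
    [n.+1] become shifts of one and the same sequence. *)
Definition first_degrees_prob (ds : seq nat) N : R :=
  fine (P N [set w | forall i : 'I_(size ds),
    (if insub (val i) is Some j then @D N j w = nth 0%N ds i else True)]).

Lemma first_degrees_prob_shift ds n :
  first_degrees_prob ds (size ds + n) =
  fine (P (size ds + n)%N [set w | forall i : 'I_(size ds), D (lshift n i) w = nth 0%N ds i]).
Proof.
have e (i : 'I_(size ds)) : insub (val i) = Some (lshift n i) :> option 'I_(size ds + n).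
  by rewrite -(valK (lshift n i)).
by congr (fine (P _ _)); apply/seteqP; split=> w /= h i; have := h i; rewrite e.
Qed.

Lemma first_degrees_prob_law ds n : (0 < n)%N -> (size ds <= n.+1)%N ->
  first_degrees_prob ds n.+1 = degree_prob (@mu n) (first_vertices n (size ds)) ds.
Proof.
move=> n0 dn; have [//|a b c] := H (n := n.+1).
have := law_degree_prob a c (first_vertices n (size ds)) ds.
move=> /(congr1 fine) /= <-; congr (fine (P _ _)).
have e (i : 'I_(size ds)) : insub (val i) = Some (inord i) :> option 'I_n.+1.
  by rewrite -(valK (inord i)) /= inordK// (leq_trans (ltn_ord i)).
have nE (i : 'I_(size ds)) : nth ord0 (first_vertices n (size ds)) i = inord i.
  by rewrite (nth_map 0%N) ?size_iota// nth_iota.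
apply/seteqP; split=> w /=.
  move=> h; apply: (@eq_from_nth _ 0%N); rewrite size_map size_first_vertices// => i ik.
  have := h (Ordinal ik); rewrite e /= => <-.
  by rewrite (nth_map ord0) ?size_first_vertices// (nE (Ordinal ik)).
move=> h i; rewrite e -[RHS](congr1 (fun s => nth 0%N s i) h).
by rewrite (nth_map ord0) ?size_first_vertices// nE.
Qed.

(** Both sequences are shifts of [first_degrees_prob ds], the second up to finitely many terms. *)
Lemma cvg_of_first_degrees ds (l : R) :
  fine (P (size ds + n)%N [set w | forall i : 'I_(size ds), D (lshift n i) w = nth 0%N ds i])
    @[n --> \oo] --> l <->
  degree_prob (@mu n) (first_vertices n (size ds)) ds @[n --> \oo] --> l.
Proof.
have -> : (fun n => fine (P (size ds + n)%N
    [set w | forall i : 'I_(size ds), D (lshift n i) w = nth 0%N ds i])) =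
    [sequence first_degrees_prob ds (n + size ds)%N]_n.
  by apply/funext => n /=; rewrite -first_degrees_prob_shift addnC.
rewrite cvg_shiftn -cvg_shiftS.
have e : \forall n \near \oo, first_degrees_prob ds n.+1 =
    degree_prob (@mu n) (first_vertices n (size ds)) ds.
  exists (size ds).+1 => // n /= nd; apply: first_degrees_prob_law; lia.
split; apply: cvg_trans; apply: near_eq_cvg => //.
by apply: filterS e => n /= ->.
Qed.

End FirstDirection.

Section FirstDirection.
Local Open Scope classical_set_scope.
Local Open Scope ring_scope.
Variables (R : realType) (d : nat -> measure_display)
  (Om : forall n : nat, measurableType (d n))
  (P : forall n : nat, probability (Om n) R)
  (D : forall n : nat, 'I_n -> {RV (P n) >-> nat})
  (T : forall n : nat, {RV (P n) >-> lgraph n}).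
Hypothesis H : forall n : nat, (2 <= n)%N ->
    [/\ random_degree_sequence (@D n), exchangeable (@D n) &
        uniform_tree_given (@D n) (@T n)].

Lemma independent_first_degrees d' (Om' : measurableType d') (Q : probability Om' R)
    (X : nat -> {RV Q >-> nat}) (p : nat -> R) (ds : seq nat) :
  mutually_independent X -> (forall i k, Q [set w | X i w = k] = (p k)%:E) ->
  Q [set w | forall i : 'I_(size ds), X i w = nth 0%N ds i] = (\prod_(x <- ds) p x)%:E.
Proof.
move=> indep Xp.
pose J := [fset i | i in iota 0 (size ds)]%fset.
have memJ i : (i \in J) = (i < size ds)%N by rewrite !inE mem_iota.
have := indep J (fun i => [set nth 0%N ds i]) (fun i => I).
have -> : \bigcap_(i in [set` J]) (X i @^-1` [set nth 0%N ds i]) =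
    [set w | forall i : 'I_(size ds), X i w = nth 0%N ds i].
  apply/seteqP; split=> w /= h i; first by apply: h; rewrite /= memJ.
  by rewrite /= memJ => ik; exact: (h (Ordinal ik)).
move=> ->; rewrite (eq_bigr (fun i => (p (nth 0%N ds i))%:E)); last by move=> i _; exact: Xp.
rewrite prodEFin; congr (_%:E).
rewrite (perm_big (iota 0 (size ds))) /=; last first.
  apply: uniq_perm; rewrite ?fset_uniq ?iota_uniq// => i.
  by rewrite mem_iota /= add0n -memJ.
by rewrite [RHS](big_nth 0%N) /index_iota subn0.
Qed.

Theorem iid_mean_two_cvg_tree :
  cvg_to_iid_of_mean_two D -> cvg_to_infinite_random_tree T.
Proof.
move=> [d0 [Om0 [P0 [D0 [d' [Om' [Q [D' [[D0pos D0mean] indep same cvgD]]]]]]]]].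
pose p := pmf_nat D0.
have p0 : p 0%N = 0.
  rewrite /p /pmf_nat (_ : [set w | D0 w = 0%N] = set0) ?measure0//.
  by apply/seteqP; split=> // w /= e; have := D0pos w; rewrite e.
have psum := pmf_nat_sum D0.
have pmean := pmf_nat_mean D0mean.
have D'p i k : Q [set w | D' i w = k] = (p k)%:E.
  rewrite -pmf_natE; exact: (same i [set k] I).
have [rho rhoE] := infinite_random_tree (pmf_nat_ge0 D0) p0 psum pmean.
have mu_cvg (ds : seq nat) :
    degree_prob (law (@T n.+1)) (first_vertices n (size ds)) ds @[n --> \oo]
      --> \prod_(x <- ds) p x.
  apply/(cvg_of_first_degrees H).
  have := cvgD (size ds) (point_test (fun i : 'I_(size ds) => nth 0%N ds i))
    (@continuous_point_test _ _ _) (@bounded_point_test _ _ _).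
  rewrite (expectation_point_test (fun i : 'I_(size ds) => D' i)).
  rewrite (independent_first_degrees _ indep D'p).
  under eq_fun do rewrite (expectation_point_test (fun i : 'I_(size ds) => D (lshift _ i))).
  by move=> /fine_cvgP[].
exists rho => e r F e0 r0 /finite_size_bound[M FM].
rewrite (rhoE r F M r0 FM).
have := ball_frequency_cvg (mu_tree_law H) mu_cvg r0 FM e0.
set L := ball_limit _ _ _ _ => h.
rewrite -cvg_shiftS; apply/fine_cvgP; split.
  apply: nearW => n; apply: fin_num_measure.
  exact: (measurable_RV_pre (@T n.+1) (A := [set t | e < `|ball_frequency R r F t - L|])).
apply: cvg_trans h; apply: near_eq_cvg.
exists 1%N => // n /= n0.
have [//|a b c] := H (n := n.+1).
by rewrite (law_sum (@T n.+1) (fun t => e < `|ball_frequency R r F t - L|)).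
Qed.

End FirstDirection.

(** * Balls as graphs and measurability of cylinders *)

Section BallGraph.
Context {V : eqType}.
Variables (G : sgraph V) (v : V) (r : nat).
Notation B := (graph_ball G v r).

(** The vertices of a walk of length at most [r] from [v] all lie in the ball, so the walk exists
    inside it. *)
Lemma ball_dist q (x : rooted_vertex B) : q <= r -> dist_le G q v (val x) ->
  dist_le (rooted_sgraph B) q (rooted_root B) x.
Proof.
elim: q x => [|q IH] x qr.
  by move=> /dist_le0 e; rewrite (_ : x = rooted_root B); [exact: dist_le_refl|exact: val_inj].
move=> /dist_leS[/(IH x (ltnW qr)) h|[z vz zx]]; first exact: dist_leW h.
have zr : dist_le G r v z by apply: dist_leW vz; exact: ltnW.
pose z' : rooted_vertex B := exist _ z (asboolT zr).
have h : dist_le (rooted_sgraph B) q (rooted_root B) z' by apply: IH => //; exact: ltnW.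
exact: dist_le_rcons h zx.
Qed.

Lemma dist_ball q (x : rooted_vertex B) :
  dist_le (rooted_sgraph B) q (rooted_root B) x -> dist_le G q v (val x).
Proof. exact: (@dist_le_map _ _ _ G val). Qed.

Lemma ball_connected : connected_graph (rooted_sgraph B).
Proof.
have h x : dist_le (rooted_sgraph B) r (rooted_root B) x.
  by apply: ball_dist => //; exact: (asboolW (valP x)).
by move=> x y; exists (r + r); apply: dist_le_trans (h y); exact: dist_le_sym.
Qed.

Lemma ball_acyclic : acyclic G -> acyclic (rooted_sgraph B).
Proof.
move=> ac c /andP[cc uc]; rewrite -(size_map val); apply: (ac (map val c)).
apply/andP; split; last by rewrite map_inj_uniq//; exact: val_inj.
case: c cc {uc} => //= a s; rewrite -map_rcons path_map.
exact: sub_path.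
Qed.

End BallGraph.

Lemma acyclic_iso (F H : rooted_graph) : rooted_iso F H ->
  acyclic (rooted_sgraph F) -> acyclic (rooted_sgraph H).
Proof.
move=> /rooted_iso_sym[g [bg g0 gadj]] ac c /andP[cc uc]; rewrite -(size_map g).
apply: (ac (map g c)); apply/andP; split; last by rewrite map_inj_uniq//; exact: bij_inj.
case: c cc {uc} => //= a s; rewrite -map_rcons path_map.
by apply: sub_path => x y; rewrite /= gadj.
Qed.

Lemma connected_iso (F H : rooted_graph) : rooted_iso F H ->
  connected_graph (rooted_sgraph F) -> connected_graph (rooted_sgraph H).
Proof.
move=> [f [[g fK gK] f0 fadj]] con x y; have [q h] := con (g x) (g y).
exists q; rewrite -(gK x) -(gK y); apply: dist_le_map h => a b.
by rewrite fadj.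
Qed.

Lemma dist_iso (F H : rooted_graph) f :
  f (rooted_root F) = rooted_root H ->
  (forall x y, adj (rooted_sgraph H) (f x) (f y) = adj (rooted_sgraph F) x y) ->
  forall q x, dist_le (rooted_sgraph F) q (rooted_root F) x ->
    dist_le (rooted_sgraph H) q (rooted_root H) (f x).
Proof. by move=> f0 fadj q x h; rewrite -f0; apply: dist_le_map h => a b; rewrite fadj. Qed.

Lemma has_height_iso (F H : rooted_graph) r : rooted_iso F H -> has_height F r -> has_height H r.
Proof.
move=> [f [[g fK gK] f0 fadj]] [hF [x hx]].
have g0 : g (rooted_root H) = rooted_root F by rewrite -f0 fK.
have gadj a b : adj (rooted_sgraph F) (g a) (g b) = adj (rooted_sgraph H) a b.
  by rewrite -fadj !gK.
split=> [y|]; first by rewrite -(gK y); exact: dist_iso.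
by exists (f x) => q h; apply: hx; rewrite -(fK x); exact: dist_iso h.
Qed.

Section Cylinders.
Local Open Scope classical_set_scope.

Lemma finite_iso (F H : rooted_graph) : rooted_iso F H ->
  finite_rooted_graph F -> finite_rooted_graph H.
Proof.
move=> [f [[g fK gK] _ _]] fF; rewrite /finite_rooted_graph.
have -> : [set: rooted_vertex H] = f @` [set: rooted_vertex F].
  by apply/seteqP; split=> // y _; exists (g y).
exact: finite_image.
Qed.

Lemma finite_ball (V : choiceType) (G : sgraph V) v r : locally_finite_graph G ->
  finite_set [set y | dist_le G r v y].
Proof.
move=> lf; elim: r => [|r IH].
  by apply: (@sub_finite_set _ _ [set v]) => // y /dist_le0.
apply: (@sub_finite_set _ _ ([set y | dist_le G r v y] `|`
    \bigcup_(z in [set y | dist_le G r v y]) [set y | adj G z y])).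
  by move=> y /dist_leS[|[z vz zy]]; [left|right; exists z].
rewrite finite_setU; split=> //; apply: bigcup_finite => // z _; exact: lf.
Qed.

Lemma finite_graph_ball (V : choiceType) (G : sgraph V) v r : locally_finite_graph G ->
  finite_rooted_graph (graph_ball G v r).
Proof.
move=> lf; rewrite /finite_rooted_graph.
have -> : [set: rooted_vertex (graph_ball G v r)] = val @^-1` [set y | dist_le G r v y].
  by apply/seteqP; split=> // x _; exact: (asboolW (valP x)).
apply: finite_preimage; last exact: finite_ball.
by move=> x y _ _; exact: val_inj.
Qed.

(** If no vertex had distance exactly [r], connectedness would put every vertex at a smaller
    distance, and local finiteness would make the tree finite. *)
Lemma itree_ball_height (t : itree) r :
  has_height (graph_ball (itree_graph t) (itree_root t) r) r.
Proof.
set G := itree_graph t; set v := itree_root t.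
split=> [x|]; first by apply: ball_dist => //; exact: (asboolW (valP x)).
have [[x vx hx]|none] := pselect (exists2 x, dist_le G r v x & forall q, dist_le G q v x -> r <= q).
  exists (exist _ x (asboolT vx)) => q /dist_ball; exact: hx.
have [con _] := itree_is_tree t.
case: r none => [|r] none.
  by exists (rooted_root (graph_ball G v 0)).
have step q y : dist_le G q v y -> dist_le G r v y.
  elim: q y => [|q IH] y; first by move=> h; exact: dist_leW h.
  move=> /dist_leS[/IH //|[z /IH vz zy]].
  have vy := dist_le_rcons vz zy.
  apply: contrapT => ny; case: none; exists y => // q' vq'.
  by rewrite ltnNge; apply/negP => q'r; apply: ny; exact: dist_leW vq'.
have : finite_set [set: nat].
  apply: (sub_finite_set _ (finite_ball v r (itree_locally_finite t))) => y _ /=.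
  by have [q h] := con v y; exact: step h.
by move=> h; case: infinite_nat.
Qed.

(** A nonempty cylinder forces [F] to be a finite tree of height [r], so it is one of the
    generators; no assumption on [F] is left. *)
Lemma measurable_cylinder r F : measurable (cylinder r F : set infinite_trees).
Proof.
have [[t tF]|none] := pselect (exists t, cylinder r F t); last first.
  have -> : cylinder r F = set0 by apply/seteqP; split=> // t tF; case: none; exists t.
  exact: measurable0.
apply: sub_sigma_algebra; exists r, F; split=> //.
- by apply: finite_iso tF _; apply: finite_graph_ball; exact: itree_locally_finite.
- split; first by apply: connected_iso tF _; exact: ball_connected.
  by apply: acyclic_iso tF _; apply: ball_acyclic; case: (itree_is_tree (repr t)).
- by apply: has_height_iso tF _; exact: itree_ball_height.
Qed.

End Cylinders.

(** * Events whose probability tends to one *)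

Section HighProbability.
Local Open Scope classical_set_scope.
Local Open Scope ring_scope.
Variables (R : realType) (mu : forall n, lgraph n.+1 -> R).
Hypothesis mu_law : forall n, (0 < n)%N -> tree_law (@mu n).
Implicit Types A B : forall n, lgraph n.+1 -> Prop.

Definition bad_prob A n : R := \sum_t mu t * (`[< ~ A n t >] : bool)%:R.

Definition whp A : Prop := bad_prob A n @[n --> \oo] --> (0 : R).

Lemma bad_prob_ge0 A n : (0 < n)%N -> 0 <= bad_prob A n.
Proof.
move=> n0; apply: sumr_ge0 => t _; apply: mulr_ge0 => //.
exact: tree_law_ge0 (mu_law n0) t.
Qed.

Lemma near_pos : \forall n \near \oo, (0 < n)%N.
Proof. by exists 1%N. Qed.

Lemma whp_mono A B : (\forall n \near \oo, forall t : lgraph n.+1, is_tree t -> A n t -> B n t) ->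
  whp A -> whp B.
Proof.
move=> AB Ac; apply: (squeeze_cvgr _ (cvg_cst 0) Ac).
near=> n; have n0 : (0 < n)%N by near: n; exact: near_pos.
have h : forall t : lgraph n.+1, is_tree t -> A n t -> B n t by near: n.
rewrite bad_prob_ge0//=; apply: ler_sum => t _.
have [->|/(tree_law_tree (mu_law n0)) tt] := eqVneq (mu t) 0; first by rewrite !mul0r.
apply: ler_wpM2l; first exact: tree_law_ge0 (mu_law n0) t.
rewrite ler_nat; case: asboolP => //= nB; rewrite asboolT// => /(h _ tt).
exact: nB.
Unshelve. all: by end_near. Qed.

Lemma whpT A : (\forall n \near \oo, forall t : lgraph n.+1, is_tree t -> A n t) -> whp A.
Proof.
move=> h; apply: (@whp_mono (fun _ _ => True)).
  by apply: filterS h => n h t tt _; exact: h.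
rewrite /whp (_ : bad_prob _ = fun=> 0); first exact: cvg_cst.
by apply/funext => n; apply: big1 => t _; rewrite asboolF ?mulr0//; exact.
Qed.

Lemma whp_and A B : whp A -> whp B -> whp (fun n t => A n t /\ B n t).
Proof.
move=> Ac Bc; have AB : (fun n => bad_prob A n + bad_prob B n) @ \oo --> (0 : R).
  by rewrite -[0]addr0; exact: cvgD.
apply: (squeeze_cvgr _ (cvg_cst 0) AB).
near=> n; have n0 : (0 < n)%N by near: n; exact: near_pos.
rewrite bad_prob_ge0//= /bad_prob -big_split /=; apply: ler_sum => t _.
rewrite -mulrDr; apply: ler_wpM2l; first exact: tree_law_ge0 (mu_law n0) t.
rewrite -natrD ler_nat; case: asboolP => //= nAB.
case: asboolP => //= /contrapT a; case: asboolP => //= /contrapT b.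
by case: nAB.
Unshelve. all: by end_near. Qed.

Lemma whp_all (I : eqType) (s : seq I) (A : I -> forall n, lgraph n.+1 -> Prop) :
  (forall i, i \in s -> whp (A i)) -> whp (fun n t => forall i, i \in s -> A i n t).
Proof.
elim: s => [|i s IH] h; first by apply: whpT; exact: nearW.
have hi : whp (A i) by apply: h; rewrite mem_head.
have hs : whp (fun n t => forall i, i \in s -> A i n t).
  by apply: IH => j js; apply: h; rewrite in_cons js orbT.
apply: whp_mono (whp_and hi hs); apply: nearW => n t _ [a b] j.
by rewrite in_cons => /predU1P[->|/b].
Qed.

(** A failure probability below one leaves some tree without failure. This turns statements in
    probability into inequalities between their limits. *)
Lemma whp_exists A : whp A -> \forall n \near \oo, exists2 t : lgraph n.+1, is_tree t & A n t.
Proof.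
move=> Ac; have h : \forall n \near \oo, bad_prob A n < 1.
  by apply: (cvgr_lt (0 : R)).
near=> n; have n0 : (0 < n)%N by near: n; exact: near_pos.
apply: contrapT => none; have : bad_prob A n < 1 by near: n.
apply/negP; rewrite -leNgt -(tree_law_sum (mu_law n0)); apply: ler_sum => t _.
have [->|/(tree_law_tree (mu_law n0)) tt] := eqVneq (mu t) 0; first by rewrite mul0r.
by rewrite asboolT ?mulr1// => a; apply: none; exists t.
Unshelve. all: by end_near. Qed.

(** Bounded convergence: off the bad event the error is at most [e / 2], on it the bound [M] is
    multiplied by a vanishing probability. *)
Lemma whp_expectation (f : forall n, lgraph n.+1 -> R) (l M : R) :
  (forall n (t : lgraph n.+1), is_tree t -> `|f n t - l| <= M) ->
  (forall e, 0 < e -> whp (fun n t => `|f n t - l| <= e)) ->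
  (\sum_t mu t * f n t) @[n --> \oo] --> l.
Proof.
move=> fM fc; apply/cvgrPdist_le => e e0.
have e2 : 0 < e / 2 by rewrite divr_gt0.
have M0 : 0 < `|M| + 1 by rewrite ltr_wpDl.
have := fc _ e2; set B := fun n t => _.
move=> /cvgr0Pnorm_le /(_ (e / 2 / (`|M| + 1))).
rewrite divr_gt0// => /(_ isT) h.
near=> n; have n0 : (0 < n)%N by near: n; exact: near_pos.
have hn : `|bad_prob B n| <= e / 2 / (`|M| + 1) by near: n.
rewrite ger0_norm ?bad_prob_ge0// in hn.
rewrite distrC.
have -> : \sum_t mu t * f n t - l = \sum_t mu t * (f n t - l).
  by under [RHS]eq_bigr do rewrite mulrBr; rewrite sumrB -[X in _ = _ - X]mulr_suml (tree_law_sum (mu_law n0)) mul1r.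
apply: (le_trans (ler_norm_sum _ _ _)).
have -> : e = e / 2 + (e / 2 / (`|M| + 1)) * (`|M| + 1).
  by rewrite divfK ?gt_eqF//; lra.
apply: (@le_trans _ _ (e / 2 + bad_prob B n * (`|M| + 1))); last first.
  by rewrite lerD2l; apply: ler_wpM2r => //; exact: ltW.
have -> : e / 2 = \sum_(t : lgraph n.+1) mu t * (e / 2).
  by rewrite -[RHS]mulr_suml (tree_law_sum (mu_law n0)) mul1r.
rewrite /bad_prob mulr_suml -big_split; apply: ler_sum => t _ /=.
have m0 := tree_law_ge0 (mu_law n0) t.
rewrite normrM (ger0_norm m0) -mulrA -mulrDr.
have [->|/(tree_law_tree (mu_law n0)) tt] := eqVneq (mu t) 0; first by rewrite !mul0r.
apply: ler_wpM2l => //; case: asboolP => /= [_|/contrapT]; last by rewrite mul0r addr0.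
rewrite mul1r; apply: (le_trans (fM _ _ tt)).
have := ler_norm M; lra.
Unshelve. all: by end_near. Qed.

End HighProbability.

(** * Degree frequencies: total mass and mean of their limits *)

Section TreeDegrees.
Variable n : nat.
Notation V := 'I_n.+1.
Implicit Types (t : lgraph n.+1) (v : V).

Lemma star_ballP t v k : is_tree t ->
  rooted_iso (graph_ball t v 1) (word_tree [:: k]) <-> degree t v = k.
Proof.
move=> tt.
have star : rooted_iso (word_tree [:: degree t v]) (graph_ball t v 1).
  apply: (@embeds_ball_iso _ t [:: degree t v] [:: v]) => //; last by rewrite frontierS /discovered big_ord0.
  apply/and4P; split=> //.
  apply/fintype.subsetP => -[x y]; rewrite in_pattern !inE.
  by move=> /and3P[/eqP -> /eqP ->]; rewrite /= bfs_adj_irr.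
split=> [h|<-]; last exact: rooted_iso_sym.
have [f [bf _ _]] := rooted_iso_trans star h.
have := @bij_eq_card 'I_(disc [:: degree t v] 1) 'I_(disc [:: k] 1) f bf.
by rewrite !card_ord /discovered !big_ord1 => -[].
Qed.

Definition degree_class_set t k : {set V} := [set v | degree t v == k]%SET.

Definition large_balls t r K : {set V} := [set v | K < #|ball_set t v r|]%SET.

(** The edges inside [S] form a forest in which every vertex outside [S] is a component of its own,
    so there are at most as many edges as vertices of [S]; ordered pairs give the factor 2. *)
Lemma card_inner_edges t (S : {set V}) : is_tree t ->
  #|[set p in edges t | (p.1 \in S) && (p.2 \in S)]%SET| <= 2 * #|S|.
Proof.
move=> tt; set F := finset.finset _.
have inF x y : ((x, y) \in F) = [&& t x y, x \in S & y \in S] by rewrite inE in_edges.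
have Ft : F \subset edges t.
  by apply/fintype.subsetP => -[x y]; rewrite inF in_edges => /andP[].
have sF : symmetric (edge_rel F).
  by move=> x y; rewrite /edge_rel !inF adj_sym [(x \in S) && _]andbC.
have iF : irreflexive (edge_rel F) by move=> x; rewrite /edge_rel inF adj_irr.
have aF : acyclic_edges F.
  move=> s /andP[cs us]; have [_ /acyclic_edges_acyclic ac] := tt.
  apply: ac; apply/andP; split=> //; case: s cs {us} => // a s.
  by apply: sub_path => x y; exact: (fintype.subsetP Ft).
have [c Fc] := acyclic_forest sF iF aF.
have := card_forest Fc; rewrite card_ord.
have ci : {in ~: S &, injective c}.
  move=> x y; rewrite finset.in_setC => xS _ /(forest_connect Fc)/connectP[[|z p] /=].
    by move=> _ ->.
  by rewrite /edge_rel inF (negbTE xS) andbF.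
have : #|~: S| <= #|components c|.
  rewrite -(card_in_imset ci); apply: subset_leq_card.
  by apply/fintype.subsetP => _ /imsetP[x _ ->]; exact: mem_components.
have := cardsC S; rewrite card_ord.
move: #|~: S|%N #|components c| #|F| #|S| => a b e f; lia.
Qed.

(** A vertex of degree at least [K] and each of its neighbours have more than [K] vertices within
    distance 2, so all edges at such vertices are inner edges of [large_balls t 2 K]. This is where
    the tree structure provides uniform integrability of the degrees. *)
Lemma sum_large_degree t K : is_tree t ->
  \sum_(v | K <= degree t v) degree t v <= 2 * #|large_balls t 2 K|.
Proof.
move=> tt; set S := large_balls t 2 K.
apply: leq_trans (card_inner_edges S tt); set F := finset.finset _.
rewrite -(sum_fdegree F) [leqRHS](bigID (fun v => K <= degree t v)) /=.
apply: leq_trans (leq_addr _ _); apply: leq_sum => v Kv.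
rewrite -fdegree_edges; apply: subset_leq_card; apply/fintype.subsetP => y.
rewrite !in_nbrs => vy; rewrite /F finset.in_set vy /=; rewrite in_edges in vy.
rewrite !inE; apply/andP; split; apply: (leq_ltn_trans Kv); apply: degree_lt_ball.
  by apply: (@dist_leW _ _ 0) => //; exact: dist_le_refl.
apply: (@dist_le_rcons _ _ 0 _ y); first exact: dist_le_refl.
by rewrite adj_sym.
Qed.

Lemma card_large_degree t K : #|[set v | K <= degree t v]%SET| <= #|large_balls t 1 K|.
Proof.
apply: subset_leq_card; apply/fintype.subsetP => v; rewrite !inE => Kv.
apply: (leq_ltn_trans Kv); apply: degree_lt_ball; exact: dist_le_refl.
Qed.

Lemma sum_degree_class (f : nat -> nat) t K :
  \sum_(v | degree t v < K) f (degree t v) = \sum_(k < K) f k * #|degree_class_set t k|.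
Proof.
transitivity (\sum_(k < K) \sum_(v | degree t v == k) f (degree t v)).
  rewrite (exchange_big_dep (fun v => degree t v < K)) /=; last by move=> k v _ /eqP ->.
  apply: eq_bigr => v vK; rewrite (big_pred1 (Ordinal vK)) //.
apply: eq_bigr => k _; rewrite (eq_bigr (fun=> f k)); last by move=> v /eqP ->.
by rewrite sum_nat_const mulnC; congr (_ * _); apply: eq_card => v; rewrite inE.
Qed.

End TreeDegrees.

Section DegreeLimits.
Local Open Scope classical_set_scope.
Local Open Scope ring_scope.
Variables (R : realType) (mu : forall n, lgraph n.+1 -> R).
Hypothesis mu_law : forall n, (0 < n)%N -> tree_law (@mu n).

Definition whp_cvg (X : forall n, lgraph n.+1 -> R) (x : R) : Prop :=
  forall e : R, 0 < e -> whp mu (fun n t => `|X n t - x| <= e).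

Lemma whp_cvg_le X x C : whp_cvg X x -> whp mu (fun n t => X n t <= C) -> x <= C.
Proof.
move=> Xx XC; apply/ler_addgt0Pr => e e0.
have [N _ /(_ N (leqnn N)) [t _ [h1 h2]]] := whp_exists mu_law (whp_and mu_law (Xx _ e0) XC).
move: h1; rewrite distrC ler_norml; lra.
Qed.

Lemma whp_cvg_ge X x C : whp_cvg X x -> whp mu (fun n t => C <= X n t) -> C <= x.
Proof.
move=> Xx XC; apply/ler_addgt0Pr => e e0.
have [N _ /(_ N (leqnn N)) [t _ [h1 h2]]] := whp_exists mu_law (whp_and mu_law (Xx _ e0) XC).
move: h1; rewrite ler_norml; lra.
Qed.

Variable a : nat -> R.

Definition degree_freq n (t : lgraph n.+1) k : R := #|degree_class_set t k|%:R / n.+1%:R.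

Hypothesis degree_cvg : forall k : nat, whp_cvg (fun n t => degree_freq t k) (a k).
Hypothesis tight : forall (r : nat) (e : R), (0 < r)%N -> 0 < e ->
  exists K, whp mu (fun n t => #|large_balls t r K|%:R <= e * n.+1%:R).

Lemma degree_freq_ge0 n (t : lgraph n.+1) k : 0 <= degree_freq t k.
Proof. by rewrite divr_ge0. Qed.

Lemma degree_freq_le1 n (t : lgraph n.+1) k : degree_freq t k <= 1.
Proof. by rewrite ler_pdivrMr// mul1r ler_nat -[leqRHS](card_ord n.+1) max_card. Qed.

Lemma degree_limit_ge0 k : 0 <= a k.
Proof.
by apply: (whp_cvg_ge (degree_cvg k)); apply: (whpT mu_law); apply: nearW => n t _;
  exact: degree_freq_ge0.
Qed.

Lemma degree_limit_le1 k : a k <= 1.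
Proof.
by apply: (whp_cvg_le (degree_cvg k)); apply: (whpT mu_law); apply: nearW => n t _;
  exact: degree_freq_le1.
Qed.

Lemma degree_limit0 : a 0%N = 0.
Proof.
apply/le_anti/andP; split; last exact: degree_limit_ge0.
apply: (whp_cvg_le (degree_cvg 0)); apply: (whpT mu_law).
exists 1%N => // n /= n0 t tt; rewrite /degree_freq (_ : degree_class_set t 0 = finset.set0).
  by rewrite cards0 mul0r.
apply/setP => v; rewrite !inE; apply: gtn_eqF; exact: tree_degree_gt0.
Qed.

Lemma truncated_sum_cvg (f : nat -> nat) K :
  whp_cvg (fun n t => (\sum_(v | (degree t v < K)%N) f (degree t v))%N%:R / n.+1%:R)
          (\sum_(k < K) (f k)%:R * a k).
Proof.
move=> e e0; pose S := \sum_(k < K) (f k)%:R + 1 : R.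
have S0 : 0 < S by rewrite ltr_wpDl// sumr_ge0.
have h : whp mu (fun n t => forall k, k \in iota 0 K -> `|degree_freq t k - a k| <= e / S).
  by apply: (whp_all mu_law) => k _; apply: degree_cvg; exact: divr_gt0.
apply: (whp_mono mu_law) h; apply: nearW => n t _ h.
rewrite sum_degree_class natr_sum mulr_suml -sumrB.
apply: (le_trans (ler_norm_sum _ _ _)).
apply: (@le_trans _ _ (\sum_(k < K) (f k)%:R * (e / S))).
  apply: ler_sum => k _; rewrite natrM -mulrA -mulrBr normrM ger0_norm//.
  by apply: ler_wpM2l => //; apply: h; rewrite mem_iota /= add0n ltn_ord.
rewrite -mulr_suml mulrCA -[leRHS]mulr1; apply: ler_wpM2l; first exact: ltW.
by rewrite ler_pdivrMr// mul1r /S lerDl.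
Qed.

Lemma sum_small_large n (t : lgraph n.+1) (f : nat -> nat) K :
  (\sum_(v | (degree t v < K)%N) f (degree t v) + \sum_(v | (K <= degree t v)%N) f (degree t v) =
   \sum_v f (degree t v))%N.
Proof.
rewrite [RHS](bigID (fun v => (degree t v < K)%N)) /=; congr (_ + _)%N.
by apply: eq_bigl => v; rewrite -leqNgt.
Qed.

(** Vertices of degree at least [K] have a 1-ball with more than [K] elements, so by tightness they
    carry little mass. *)
Lemma degree_limit_sum : series a @ \oo --> (1 : R).
Proof.
have E K : series a K = \sum_(k < K) 1%:R * a k.
  by rewrite /series /= big_mkord; apply: eq_bigr => k _; rewrite mul1r.
have le1 K : series a K <= 1.
  rewrite E; apply: (whp_cvg_le (truncated_sum_cvg (fun=> 1%N) K)).
  apply: (whpT mu_law); apply: nearW => n t _; rewrite ler_pdivrMr// mul1r ler_nat.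
  by rewrite sum1_card -[leqRHS](card_ord n.+1) max_card.
have nd : nondecreasing_seq (series a).
  by apply: nondecreasing_series => k _ _; exact: degree_limit_ge0.
apply/cvgrPdist_le => e e0; have [K hK] := tight (ltn0Sn 0) e0.
have ge1 : 1 - e <= series a K.
  rewrite E; apply: (whp_cvg_ge (truncated_sum_cvg (fun=> 1%N) K)).
  apply: (whp_mono mu_law) hK; apply: nearW => n t _ h.
  rewrite ler_pdivlMr// mulrBl mul1r lerBlDr.
  apply: (le_trans _ (lerD (lexx _) h)); rewrite -natrD ler_nat.
  have := sum_small_large t (fun=> 1%N) K.
  rewrite [X in _ = X]sum1_card card_ord => {1}<-; rewrite leq_add2l.
  apply: leq_trans (card_large_degree t K); rewrite sum1_card.
  by apply: subset_leq_card; apply/fintype.subsetP => v; rewrite !inE.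
exists K => // m /= Km; have := nd _ _ Km; have := le1 m.
by rewrite ler_norml; lra.
Qed.

(** The total degree 2(n+1) - 2 bounds every truncated sum from above, and [sum_large_degree] with
    tightness at radius 2 bounds what the truncation loses. *)
Lemma degree_limit_mean : series (fun k => k%:R * a k) @ \oo --> (2 : R).
Proof.
have E K : series (fun k => k%:R * a k) K = \sum_(k < K) k%:R * a k.
  by rewrite /series /= big_mkord.
have le2 K : series (fun k => k%:R * a k) K <= 2.
  rewrite E; apply: (whp_cvg_le (truncated_sum_cvg id K)).
  apply: (whpT mu_law); apply: nearW => n t tt; rewrite ler_pdivrMr// -natrM ler_nat.
  have := sum_degree (ltn0Sn n) tt; rewrite -(sum_small_large t id K) /=.
  by move=> <-; rewrite -addnA leq_addr.
have nd : nondecreasing_seq (series (fun k => k%:R * a k)).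
  by apply: nondecreasing_series => k _ _; apply: mulr_ge0 => //; exact: degree_limit_ge0.
apply/cvgrPdist_le => e e0; have e3 : 0 < e / 3 by rewrite divr_gt0.
have [K hK] := tight (ltn0Sn 1) e3.
have ge2 : 2 - e <= series (fun k => k%:R * a k) K.
  rewrite E; apply: (whp_cvg_ge (truncated_sum_cvg id K)).
  apply: (whp_mono mu_law) hK.
  (* From here on the constant 2 of [sum_degree] uses at most one third of the error [e * n.+1%:R];
     the large degrees use the other two. *)
  exists (Num.trunc (2 / (e / 3))) => // n /= nK t tt h.
  have ne : 2 <= (e / 3) * n.+1%:R.
    rewrite mulrC -ler_pdivrMr//; apply: (le_trans (ltW (truncnS_gt _))).
    by rewrite ler_nat ltnS.
  rewrite ler_pdivlMr//.
  have := sum_degree (ltn0Sn n) tt; rewrite -(sum_small_large t id K) /=.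
  have := sum_large_degree K tt.
  move: (\sum_(v | (K <= _)%N) _)%N (\sum_(v | (_ < K)%N) _)%N #|_| h => x y z h xz.
  move=> /(congr1 (fun m => m%:R : R)); rewrite !natrD natrM => xy.
  have : x%:R <= 2 * z%:R :> R by rewrite -natrM ler_nat.
  have -> : (2 - e) * n.+1%:R = 2 * n.+1%:R - 3 * (e / 3 * n.+1%:R).
    by rewrite mulrBl mulrA (_ : 3 * (e / 3) = e)//; lra.
  move: (e / 3 * _) ne h xy => m ne h xy; lra.
exists K => // m /= Km; have := nd _ _ Km; have := le2 m.
by rewrite ler_norml; lra.
Qed.

End DegreeLimits.

(** * The joint law of the first degrees from the degree frequencies *)

Section DegreeMoments.
Local Open Scope classical_set_scope.
Local Open Scope ring_scope.
Variable R : realType.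

Lemma sum_tuples_degrees n (t : lgraph n.+1) ds :
  sum_tuples (size ds) (fun p : seq 'I_n.+1 => ([seq degree t x | x <- p] == ds)%:R : R) =
  \prod_(k <- ds) #|degree_class_set t k|%:R.
Proof.
elim/last_ind: ds => [|ds k IH]; first by rewrite sum_tuples0 big_nil.
rewrite size_rcons sum_tuplesS -cats1 big_cat /= big_seq1 -IH mulrC -sum_tuplesM.
apply: eq_sum_tuples => p _; rewrite cats1.
under eq_bigr do rewrite map_rcons eqseq_rcons.
have [_|_] := boolP (_ == ds); last by rewrite mulr0 big1.
by rewrite mulr1 -natr_sum -sum1_card /degree_class_set [in RHS]big_mkcond /=;
  congr (_%:R); apply: eq_bigr => v _; rewrite inE; case: (_ == _).
Qed.

Variable (mu : forall n, lgraph n.+1 -> R).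
Hypothesis mu_law : forall n, (0 < n)%N -> tree_law (@mu n).

Lemma degree_prob_bounds n p ds : (0 < n)%N -> 0 <= degree_prob (@mu n) p ds <= 1.
Proof.
move=> n0; have m0 := tree_law_ge0 (mu_law n0); apply/andP; split.
  by apply: sumr_ge0 => t _; apply: mulr_ge0.
rewrite -(tree_law_sum (mu_law n0)); apply: ler_sum => t _.
by rewrite -[leRHS]mulr1; apply: ler_wpM2l => //; case: (_ == _).
Qed.

(** The product of frequencies is the probability for vertices sampled with replacement. Samples
    without repetition all have the probability of the first vertices, by exchangeability, and the
    right side is the proportion of samples with a repetition. *)
Lemma mean_degree_freqs n ds : (0 < n)%N -> (size ds <= n.+1)%N ->
  `|\sum_(t : lgraph n.+1) mu t * \prod_(k <- ds) degree_freq R t k -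
    degree_prob (@mu n) (first_vertices n (size ds)) ds| <=
  1 - (n.+1 ^_ size ds)%:R / n.+1%:R ^+ size ds.
Proof.
move=> n0 dn; set s := size ds; set N : R := n.+1%:R; set f := degree_prob _ _ _.
have N0 : 0 < N ^+ s by rewrite exprn_gt0.
have E : (\sum_(t : lgraph n.+1) mu t * \prod_(k <- ds) degree_freq R t k) * N ^+ s =
    sum_tuples s (fun p : seq 'I_n.+1 => degree_prob (@mu n) p ds).
  rewrite exchange_sum_tuples mulr_suml; apply: eq_bigr => t _.
  rewrite sum_tuplesM sum_tuples_degrees -mulrA; congr (_ * _).
  rewrite /s; elim: (ds) => [|k l IH]; first by rewrite !big_nil mulr1.
  by rewrite !big_cons /= exprS mulrACA IH /degree_freq divfK// pnatr_eq0.
have U : sum_tuples s (fun p : seq 'I_n.+1 => (uniq p)%:R : R) = (n.+1 ^_ s)%:R.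
  exact: sum_uniq_tuples.
have T : sum_tuples s (fun p : seq 'I_n.+1 => 1 : R) = N ^+ s.
  by rewrite /sum_tuples sumr_const card_tuple card_ord -natrX.
rewrite -(ler_pM2r N0) -{1}(ger0_norm (ltW N0)) -normrM !mulrBl divfK ?gt_eqF// mul1r E.
rewrite -[X in sum_tuples _ _ - f * X]T -sum_tuplesM -[X in _ <= X - _]T -U /sum_tuples -!sumrB.
apply: (le_trans (ler_norm_sum _ _ _)); apply: ler_sum => p _.
have b q := degree_prob_bounds q ds n0.
have [up|up] := boolP (uniq p).
  rewrite mulr1 /f (@tree_law_exchangeable _ _ _ (mu_law n0) p (first_vertices n s))//.
  - by rewrite !subrr normr0.
  - exact: uniq_first_vertices.
  - by rewrite size_first_vertices size_tuple.
have := b p; have := b (first_vertices n s); rewrite -/f mulr1 subr0 ler_norml; lra.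
Qed.

Variable a : nat -> R.
Hypothesis degree_cvg : forall k : nat, whp_cvg mu (fun n t => degree_freq R t k) (a k).

Lemma prod_degree_freq_bounds n (t : lgraph n.+1) ds :
  0 <= \prod_(k <- ds) degree_freq R t k <= 1.
Proof.
elim: ds => [|k ds /andP[IH0 IH1]]; first by rewrite big_nil ler01 lexx.
rewrite big_cons mulr_ge0 ?degree_freq_ge0//= mulr_ile1 ?degree_freq_ge0 ?degree_freq_le1//.
Qed.

Lemma whp_cvg_prod ds :
  whp_cvg mu (fun n t => \prod_(k <- ds) degree_freq R t k) (\prod_(k <- ds) a k).
Proof.
elim: ds => [|k ds IH] e e0.
  by apply: (whpT mu_law); apply: nearW => n t _; rewrite !big_nil subrr normr0 ltW.
have a0 : 0 <= a k by exact: (degree_limit_ge0 mu_law degree_cvg).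
have a1 : a k <= 1 by exact: (degree_limit_le1 mu_law degree_cvg).
have e2 : 0 < e / 2 by rewrite divr_gt0.
have := whp_and mu_law (IH _ e2) (@degree_cvg k _ e2).
apply: (whp_mono mu_law); apply: nearW => n t _ [h1 h2]; rewrite !big_cons.
have := prod_degree_freq_bounds t ds; move: h1 h2.
set X := \prod_(j <- ds) _; set x := \prod_(j <- ds) _; set y := degree_freq _ _ _.
move=> h1 h2 /andP[X0 X1].
have -> : y * X - a k * x = X * (y - a k) + a k * (X - x) by lra.
apply: (le_trans (ler_normD _ _)); rewrite !normrM (ger0_norm X0) (ger0_norm a0).
have : X * `|y - a k| <= 1 * (e / 2) by apply: ler_pM.
have : a k * `|X - x| <= 1 * (e / 2) by apply: ler_pM.
lra.
Qed.

Lemma degree_prob_cvg ds :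
  degree_prob (@mu n) (first_vertices n (size ds)) ds @[n --> \oo] --> \prod_(k <- ds) a k.
Proof.
have h1 : (\sum_(t : lgraph n.+1) mu t * \prod_(k <- ds) degree_freq R t k) @[n --> \oo]
    --> \prod_(k <- ds) a k.
  apply: (whp_expectation mu_law (M := 1 + `|\prod_(k <- ds) a k|) _ (whp_cvg_prod ds)).
  move=> n t _; apply: (le_trans (ler_normB _ _)); rewrite lerD2r.
  by have /andP[p0 p1] := prod_degree_freq_bounds t ds; rewrite ger0_norm.
have h2 : (1 - (n.+1 ^_ size ds)%:R / n.+1%:R ^+ size ds : R) @[n --> \oo] --> (0 : R).
  rewrite -[0](subrr 1); apply: cvgB; first exact: cvg_cst.
  have := @cvg_bigprod R _ (index_enum 'I_(size ds)) xpredT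
    (fun j n => (n.+1%:R - j%:R) / n.+1%:R) (fun=> 1) (fun j _ => @cvg_ratio1 R j%:R).
  rewrite big1_eq; apply: cvg_trans; apply: near_eq_cvg; apply: nearW => n.
  by rewrite ffactE big_split /= prodr_const card_ord exprVn.
have h3 : (\sum_(t : lgraph n.+1) mu t * \prod_(k <- ds) degree_freq R t k -
    degree_prob (@mu n) (first_vertices n (size ds)) ds) @[n --> \oo] --> (0 : R).
  apply: (squeeze_cvgr _ _ h2); last by rewrite -oppr0; exact: cvgN h2.
  exists (size ds).+1 => // n /= dn; rewrite -ler_norml; apply: mean_degree_freqs.
    exact: (leq_trans (ltn0Sn _) dn).
  exact: leq_trans (leqnSn _) (leq_trans dn (leqnSn n)).
pose S n : R := \sum_(t : lgraph n.+1) mu t * \prod_(k <- ds) degree_freq R t k.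
have -> : (fun n => degree_prob (@mu n) (first_vertices n (size ds)) ds) =
    (fun n => S n - (S n - degree_prob (@mu n) (first_vertices n (size ds)) ds)).
  by apply/funext => n; rewrite opprB addrC subrK.
rewrite -[X in _ --> X]subr0; exact: cvgB h1 h3.
Qed.

End DegreeMoments.

(** * Tightness of the ball sizes *)

(** Rooted graphs on the sets ['I_m] form a countable type, which numbers the finite rooted graphs
    up to isomorphism; a number that codes nothing gives the graph with one vertex. *)
Definition coded_graph (i : nat) : rooted_graph :=
  if choice.unpickle i is Some c then
    let c : {m : nat & (lgraph m * 'I_m)%type} := c in
    RootedGraph (lgraph_sgraph (tagged c).1) (tagged c).2
  else RootedGraph (edgeless 1) ord0.

Lemma finite_coded_graph i : finite_rooted_graph (coded_graph i).
Proof. by rewrite /coded_graph; case: choice.unpickle => [c|]; exact: finite_finset. Qed.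

Lemma coded_graph_surj G : finite_rooted_graph G -> exists i, rooted_iso (coded_graph i) G.
Proof.
move=> /finite_setP[M /card_set_bijP[f [fM fi fs]]].
have g_ex (i : 'I_M) : exists x, f x = i by have [x _ fx] := fs i (ltn_ord i); exists x.
pose g i := projT1 (cid (g_ex i)).
have gE i : f (g i) = i by exact: projT2 (cid (g_ex i)).
have fM' x : f x < M by exact: (fM x).
pose h x : 'I_M := Ordinal (fM' x).
have gK : cancel g h by move=> i; apply: val_inj; exact: gE.
have hK : cancel h g by move=> x; apply: fi; rewrite ?inE// gE.
have simple : simple_adjacency [ffun p : 'I_M * 'I_M => rooted_sgraph G (g p.1) (g p.2)].
  by apply/asboolP; split=> [x y|x]; rewrite !ffunE /= ?adj_irr// adj_sym.
pose c : {m : nat & (lgraph m * 'I_m)%type} := existT _ M (LGraph simple, h (rooted_root G)).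
exists (choice.pickle c); rewrite /coded_graph choice.pickleK /=.
exists g; split; [by exists h | exact: hK | by move=> x y; rewrite /= ffunE].
Qed.

Lemma size_boundW F M N : M <= N -> size_bound F M -> size_bound F N.
Proof.
move=> MN [h hi]; exists (widen_ord MN \o h) => x y /(congr1 val) /= e.
by apply: hi; apply: val_inj.
Qed.

Lemma coded_graphs_size_bound N : exists K, forall i, i < N -> size_bound (coded_graph i) K.
Proof.
elim: N => [|N [K IH]]; first by exists 0.
have [M hM] := finite_size_bound (finite_coded_graph N).
exists (maxn K M) => i; rewrite ltnS leq_eqVlt => /predU1P[->|/IH iN].
  by apply: size_boundW hM; exact: leq_maxr.
by apply: size_boundW iN; exact: leq_maxl.
Qed.

(* the indices of the graphs that are not isomorphic to an earlier one *)
Definition new_code i : bool :=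
  `[< forall j, j < i -> ~ rooted_iso (coded_graph j) (coded_graph i) >].

Lemma new_code_uniq G i j : new_code i -> new_code j ->
  rooted_iso G (coded_graph i) -> rooted_iso G (coded_graph j) -> i = j.
Proof.
move=> /asboolP ni /asboolP nj Gi Gj; case: (ltngtP i j) => // [ij|ji].
  by case: (nj i ij); exact: rooted_iso_trans (rooted_iso_sym Gi) Gj.
by case: (ni j ji); exact: rooted_iso_trans (rooted_iso_sym Gj) Gi.
Qed.

Lemma new_code_surj G : finite_rooted_graph G -> exists2 i, new_code i & rooted_iso G (coded_graph i).
Proof.
move=> /coded_graph_surj[i0 i0G].
have ex : exists i, `[< rooted_iso (coded_graph i) G >] by exists i0; exact/asboolP.
case: (ex_minnP ex) => i /asboolP iG mini; exists i; last exact: rooted_iso_sym.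
apply/asboolP => j ji jiso.
have jG : `[< rooted_iso (coded_graph j) G >] by apply/asboolP; exact: rooted_iso_trans jiso iG.
by have := mini _ jG; rewrite leqNgt ji.
Qed.

Section Tightness.
Local Open Scope classical_set_scope.
Local Open Scope ring_scope.
Variables (R : realType) (mu : forall n, lgraph n.+1 -> R).
Hypothesis mu_law : forall n, (0 < n)%N -> tree_law (@mu n).
Variable rho : probability infinite_trees R.

(** Balls of locally finite trees are finite, hence have exactly one new code, so these cylinders
    partition the space; countable additivity leaves at most [e] beyond some [N]. *)
Lemma ball_mass r (e : R) : 0 < e ->
  exists N, 1 - e <= \sum_(i < N | new_code i) ball_probability rho r (coded_graph i).
Proof.
move=> e0.
pose C i : set infinite_trees := if new_code i then cylinder r (coded_graph i) else set0.
have mC i : measurable (C i).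
  by rewrite /C; case: ifP => _; [exact: measurable_cylinder | exact: measurable0].
have tC : trivIset setT C.
  move=> i j _ _ [t []]; rewrite /C; case: ifP => // ni ti; case: ifP => // nj tj.
  exact: new_code_uniq ni nj ti tj.
have UC : \bigcup_i C i = [set: infinite_trees].
  apply/seteqP; split=> // t _.
  have [|i ni ti] := @new_code_surj
      (graph_ball (itree_graph (repr t)) (itree_root (repr t)) r).
    by apply: finite_graph_ball; exact: itree_locally_finite.
  by exists i => //; rewrite /C ni.
have : (\sum_(0 <= i < n) rho (C i))%E @[n --> \oo] --> 1%:E.
  rewrite -(probability_setT rho) -UC.
  exact: measure_semi_sigma_additive mC tC (bigcup_measurable (fun i _ => mC i)).
move=> /fine_cvgP[_] /cvgrPdist_le /(_ _ e0) [N _ /(_ N (leqnn N))] /=.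
move=> h; exists N.
have -> : \sum_(i < N | new_code i) ball_probability rho r (coded_graph i) =
    fine (\sum_(0 <= i < N) rho (C i))%E.
  rewrite -sum_fine ?big_mkord; last by move=> i _; exact: fin_num_measure.
  rewrite big_mkcond /=; apply: eq_bigr => i _; rewrite /C; case: ifP => // _.
  by rewrite measure0.
move: h; rewrite ler_norml /comp /=; lra.
Qed.

Hypothesis ball_cvg : forall r F, (0 < r)%N -> finite_rooted_graph F ->
  whp_cvg mu (fun n t => ball_frequency R r F t) (ball_probability rho r F).

Lemma degree_cvg k : whp_cvg mu (fun n t => degree_freq R t k)
  (ball_probability rho 1 (word_tree [:: k])).
Proof.
move=> e e0; have fin : finite_rooted_graph (word_tree [:: k]) by exact: finite_finset.
have := ball_cvg (ltn0Sn 0) fin e0.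
apply: (whp_mono mu_law); apply: nearW => n t tt.
rewrite /ball_frequency /degree_freq; congr (`|_%:R / _ - _| <= _).
apply: eq_card => v; rewrite !inE; apply/asboolP/eqP; first by move/(star_ballP _ _ tt).
by move=> h; apply/(star_ballP _ _ tt).
Qed.

(** Finitely many types carry all but [e / 2] of the limit law, so with high probability all but a
    fraction [e] of the vertices have one of these types; [K] bounds the sizes of these types. *)
Lemma large_balls_tight r (e : R) : (0 < r)%N -> 0 < e ->
  exists K, whp mu (fun n t => #|large_balls t r K|%:R <= e * n.+1%:R).
Proof.
move=> r0 e0; have e2 : 0 < e / 2 by rewrite divr_gt0.
have [N hN] := ball_mass r e2; have [K hK] := coded_graphs_size_bound N.
(* At most [N] frequencies, each off by at most [e'], are off by at most [e / 2] in total; [N.+1]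
   avoids a division by zero. *)
exists K; pose e' := e / 2 / N.+1%:R.
have e'0 : 0 < e' by rewrite divr_gt0.
have : whp mu (fun n t => forall i, i \in iota 0 N ->
    `|ball_frequency R r (coded_graph i) t - ball_probability rho r (coded_graph i)| <= e').
  by apply: (whp_all mu_law) => i _; apply: ball_cvg => //; exact: finite_coded_graph.
apply: (whp_mono mu_law); apply: nearW => n t _ h.
pose X : R := \sum_(i < N | new_code i) ball_frequency R r (coded_graph i) t.
have XN : 1 - e <= X.
  have : \sum_(i < N | new_code i) ball_probability rho r (coded_graph i) <=
      \sum_(i < N | new_code i) (ball_frequency R r (coded_graph i) t + e').
    apply: ler_sum => i _; have := h i; rewrite mem_iota /= add0n ltn_ord => /(_ isT).
    by rewrite ler_norml; lra.
  rewrite big_split /= -/X.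
  have : \sum_(i < N | new_code i) e' <= e / 2.
    apply: (@le_trans _ _ (\sum_(i < N.+1) e')); last first.
      by rewrite sumr_const card_ord -[_ *+ _]mulr_natr divfK.
    rewrite big_mkcond /= big_ord_recr /= -[leLHS]addr0; apply: lerD; last exact: ltW.
    by apply: ler_sum => i _; case: ifP => // _; exact: ltW.
  lra.
(* A vertex with a large ball has none of the listed types, and any other vertex has at most one,
   new codes being pairwise non-isomorphic. *)
have key : X * n.+1%:R + #|large_balls t r K|%:R <= n.+1%:R.
  rewrite /X mulr_suml.
  under eq_bigr do rewrite /ball_frequency divfK ?pnatr_eq0// -sum1_card natr_sum big_mkcond.
  rewrite exchange_big /= -sum1_card natr_sum [X in _ + X]big_mkcond -big_split /=.
  rewrite -[leRHS](_ : \sum_(v : 'I_n.+1) 1 = n.+1%:R); last by rewrite sumr_const card_ord.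
  apply: ler_sum => v _; rewrite inE.
  have [big|small] := ltnP K #|ball_set t v r|.
    rewrite big1 ?add0r// => i _; rewrite inE; case: asboolP => // vi.
    by have := card_ball_set vi (hK i (ltn_ord i)); rewrite leqNgt big.
  rewrite addr0.
  have [[i ni vi]|none] := pselect (exists2 i : 'I_N, new_code i &
      rooted_iso (graph_ball t v r) (coded_graph i)); last first.
    rewrite big1 ?ler01// => i ni; rewrite inE; case: asboolP => // vi.
    by case: none; exists i.
  rewrite (bigD1 i)//= big1 ?addr0; first by case: ifP => _; rewrite ?ler01.
  move=> j /andP[nj ji]; rewrite inE; case: asboolP => // vj.
  by case/eqP: ji; apply/val_inj; exact: new_code_uniq nj ni vj vi.
have : (1 - e) * n.+1%:R <= X * n.+1%:R by rewrite ler_wpM2r.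
by rewrite mulrBl mul1r; move: key; lra.
Qed.

End Tightness.

(** * Sequences with product weights are independent and identically distributed *)

Section IndependentSequence.
Local Open Scope classical_set_scope.
Local Open Scope ring_scope.
Variables (R : realType) (a : nat -> R).
Hypothesis a_ge0 : forall k, 0 <= a k.
Hypothesis a_sum : series a @ \oo --> (1 : R).

Lemma nneseries_of_series (u : nat -> R) (l : R) :
  series u @ \oo --> l -> (\sum_(k <oo) (u k)%:E = l%:E)%E.
Proof.
move=> ul; apply/cvg_lim => //.
have -> : (fun n => \sum_(0 <= k < n) (u k)%:E)%E = EFin \o series u.
  by apply/funext => n; rewrite /= sumEFin.
by apply/fine_cvgP; split; [exact: nearW|exact: ul].
Qed.

Definition mass (A : set nat) : R := fine (\sum_(k <oo) (a k * (k \in A)%:R)%:E)%E.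

Lemma massE A : (\sum_(k <oo) (a k * (k \in A)%:R)%:E)%E = (mass A)%:E.
Proof.
rewrite /mass fineK// ge0_fin_numE; last first.
  by apply: nneseries_ge0 => k _ _; rewrite lee_fin mulr_ge0.
apply: (@le_lt_trans _ _ (\sum_(k <oo) (a k)%:E)%E).
  apply: lee_nneseries => [k _ _|k _]; rewrite lee_fin ?mulr_ge0//.
  by rewrite -[leRHS]mulr1; apply: ler_wpM2l => //; case: (_ \in _).
by rewrite (nneseries_of_series a_sum) ltry.
Qed.

Lemma massT : mass setT = 1.
Proof.
apply: EFin_inj; rewrite -massE -(nneseries_of_series a_sum).
by apply: eq_eseriesr => k _; rewrite in_setT mulr1.
Qed.

Lemma mass_ge0 A : 0 <= mass A.
Proof. by rewrite -lee_fin -massE; apply: nneseries_ge0 => k _ _; rewrite lee_fin mulr_ge0. Qed.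

Variables (d : measure_display) (Om : measurableType d) (Q : probability Om R)
  (Y : nat -> {RV Q >-> nat}).
Hypothesis Y_prefix : forall w,
  measurable [set om | mkseq (fun i => Y i om) (size w) = w] /\
  Q [set om | mkseq (fun i => Y i om) (size w) = w] = (\prod_(x <- w) a x)%:E.

Lemma mkseq_rcons (f : nat -> nat) w x :
  mkseq f (size (rcons w x)) = rcons w x <-> mkseq f (size w) = w /\ f (size w) = x.
Proof.
rewrite size_rcons mkseqS; split; last by move=> [-> ->].
by move=> /eqP; rewrite eqseq_rcons => /andP[/eqP ? /eqP ?].
Qed.

(** The exact prefix [u] makes induction on [l] possible: the first constrained letter is summed
    over and moved into the prefix. *)
Definition prefix_event u l (A : nat -> set nat) : set Om :=
  [set om | mkseq (fun i => Y i om) (size u) = u /\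
            forall i, (i < l)%N -> A i (Y (size u + i)%N om)].

Lemma prefix_event_prob u l A :
  measurable (prefix_event u l A) /\
  Q (prefix_event u l A) = (\prod_(x <- u) a x * \prod_(i < l) mass (A i))%:E.
Proof.
elim: l u A => [|l IH] u A.
  have -> : prefix_event u 0 A = [set om | mkseq (fun i => Y i om) (size u) = u].
    by apply/seteqP; split=> om /=; [case | split].
  by rewrite big_ord0 mulr1; exact: Y_prefix.
pose F s := if s \in A 0%N then prefix_event (rcons u s) l (fun i => A i.+1) else set0.
have E : prefix_event u l.+1 A = \bigcup_s F s.
  apply/seteqP; split=> om /=.
    move=> [omu h]; exists (Y (size u) om) => //.
    have h0 := h 0%N (ltn0Sn l); rewrite addn0 in h0.
    rewrite /F mem_set//; split; first by apply/mkseq_rcons.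
    by move=> i il; rewrite size_rcons addSnnS; exact: h.
  move=> [s _]; rewrite /F; case: ifP => // /set_mem sA [/mkseq_rcons[omu Ys] h].
  split=> // -[|i] il; first by rewrite addn0 Ys.
  by rewrite addnS -addSn -(size_rcons u s); exact: h.
have mF s : measurable (F s).
  by rewrite /F; case: ifP => _; [exact: (IH _ _).1 | exact: measurable0].
have tF : trivIset setT F.
  move=> s s' _ _ [om []]; rewrite /F; case: ifP => // _ [/mkseq_rcons[_ e] _].
  by case: ifP => // _ [/mkseq_rcons[_ e'] _]; rewrite -e -e'.
rewrite E; split; first exact: bigcupT_measurable.
rewrite (measure_bigcup Q setT F)//.
set q := \prod_(x <- u) a x; rewrite big_ord_recl /=; set c := \prod_(i < l) _.
have qc0 : 0 <= q * c.
  by apply: mulr_ge0; apply: prodr_ge0 => // i _; exact: mass_ge0.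
transitivity (\sum_(s <oo) ((q * c)%:E * (a s * (s \in A 0%N)%:R)%:E))%E.
  rewrite (eq_eseriesl (Q := xpredT)); last by move=> s; rewrite in_setT.
  apply: eq_eseriesr => s _; rewrite /F; case: ifP => _; last by rewrite measure0 mulr0 mule0.
  rewrite (IH _ _).2 -EFinM -cats1 big_cat big_seq1 mulr1 -/q; congr (_%:E).
  by rewrite mulrAC.
rewrite nneseriesZl; last by move=> k _; rewrite lee_fin mulr_ge0.
by rewrite massE -EFinM mulrAC -mulrA; congr (_%:E); rewrite mulrA.
Qed.

(** Positions outside [J] are constrained by the full set, of mass one, so that the event becomes a
    [prefix_event] of length one more than the maximum of [J]. *)
Lemma bigcap_prob (J : {fset nat}) A :
  Q (\bigcap_(i in [set` J]) (Y i @^-1` A i)) = (\prod_(i <- J) mass (A i))%:E.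
Proof.
pose l := (\max_(i <- J) i).+1.
have Jl i : i \in J -> (i < l)%N by move=> iJ; rewrite ltnS; exact: leq_bigmax_seq.
pose A' i := if i \in J then A i else setT.
have -> : \bigcap_(i in [set` J]) (Y i @^-1` A i) = prefix_event [::] l A'.
  apply/seteqP; split=> om /= h.
    split=> // i il; rewrite /A' add0n; case: ifP => // iJ; exact: h.
  by move=> i /= iJ; have := h.2 i (Jl i iJ); rewrite /A' iJ.
rewrite (prefix_event_prob _ _ _).2 big_nil mul1r; congr (_%:E).
rewrite (eq_bigr (fun i : 'I_l => if (i : nat) \in J then mass (A i) else 1)); last first.
  by move=> i _; rewrite /A'; case: ifP => // _; exact: massT.
rewrite -(big_mkord xpredT (fun i => if i \in J then mass (A i) else 1)) -big_mkcond -big_filter.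
apply: perm_big; apply: uniq_perm; rewrite ?filter_uniq ?iota_uniq ?fset_uniq// => i.
rewrite mem_filter mem_index_iota /=; have [iJ|//] := boolP (i \in J).
exact: Jl.
Qed.

Lemma marginal_prob i (A : set nat) : Q (Y i @^-1` A) = (mass A)%:E.
Proof.
have := bigcap_prob [fset i]%fset (fun=> A); rewrite big_seq_fset1 => <-; congr (Q _).
by apply/seteqP; split=> [om h j|om h]; [rewrite /= inE => /eqP -> | apply: (h i); rewrite /= inE].
Qed.

Lemma sequence_independent : mutually_independent Y.
Proof.
move=> J A _; rewrite bigcap_prob -prodEFin; apply: eq_bigr => i _.
exact/esym/marginal_prob.
Qed.

Lemma sequence_same i : same_distribution (Y i) (Y 0%N).
Proof. by move=> A _; rewrite /distribution /pushforward !marginal_prob. Qed.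

Lemma point_prob k (v : 'I_k -> nat) :
  Q [set om | forall i : 'I_k, Y i om = v i] = (\prod_i a (v i))%:E.
Proof.
pose w := [seq v i | i <- enum 'I_k].
have wk : size w = k by rewrite size_map size_enum_ord.
have nw (i : 'I_k) : nth 0%N w i = v i by rewrite (nth_map i) ?size_enum_ord ?nth_ord_enum.
have := (Y_prefix w).2; rewrite wk big_map big_enum => <-.
congr (Q _); apply/seteqP; split=> om /= h.
  apply: (@eq_from_nth _ 0%N); rewrite size_mkseq ?wk// => i ik.
  by rewrite nth_mkseq// (nw (Ordinal ik)) -(h (Ordinal ik)).
by move=> i; rewrite -nw -h nth_mkseq.
Qed.

End IndependentSequence.

(** * Convergence in distribution from convergence of point probabilities *)

Section WindowMean.
Local Open Scope classical_set_scope.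
Local Open Scope ring_scope.
Context {R : realType} {d : measure_display} {Om : measurableType d}.
Variable P : probability Om R.

Lemma mean_ge_window (I : finType) (A : I -> set Om) (c : I -> R) (Z : Om -> R) :
  (forall i, measurable (A i)) -> trivIset setT A -> measurable_fun setT Z ->
  (forall om, 0 <= Z om) -> (forall i om, A i om -> Z om = c i) ->
  (\sum_i (c i * fine (P (A i)))%:E <= 'E_P[Z])%E.
Proof.
move=> mA tA mZ Z0 Zc; rewrite expectation.unlock.
have c0 i om : A i om -> 0 <= c i by move=> /Zc <-.
apply: (@le_trans _ _ (\int[P]_om (\sum_i (Z om * \1_(A i) om)%:E))%E); last first.
  apply: (@ge0_le_integral _ _ _ P setT measurableT).
  - by move=> om _; apply: sume_ge0 => i _; rewrite lee_fin mulr_ge0.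
  - apply: emeasurable_sum => i; apply/measurable_EFinP; apply: measurable_funM => //.
  - exact/measurable_EFinP.
  move=> om _; rewrite sumEFin lee_fin.
  have [[i Ai]|none] := pselect (exists i, A i om); last first.
    rewrite big1// => i _; rewrite indicE memNset ?mulr0// => Ai.
    by apply: none; exists i.
  rewrite (bigD1 i)//= big1 ?addr0; first by rewrite indicE mem_set// mulr1.
  move=> j ji; rewrite indicE memNset ?mulr0// => Aj; case/eqP: ji.
  by apply: tA => //; exists om.
rewrite (@ge0_integral_sum _ _ _ P setT measurableT); last 2 first.
- move=> i; apply/measurable_EFinP; apply: measurable_funM => //.
- by move=> i om _; rewrite lee_fin mulr_ge0.
apply: lee_sum => i _.
have [[om0 Ai0]|none] := pselect (exists om, A i om); last first.
  have -> : A i = set0 by apply/seteqP; split=> // om Ai; case: none; exists om.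
  rewrite measure0 mulr0; apply: integral_ge0 => om _; by rewrite lee_fin mulr_ge0.
rewrite (eq_integral (fun om => (c i)%:E * (\1_(A i) om)%:E)%E); last first.
  move=> om _; rewrite -EFinM indicE; congr (_%:E).
  by have [/set_mem/Zc ->|_] := boolP (om \in A i); rewrite // !mulr0.
rewrite ge0_integralZl//; last 2 first.
- exact/measurable_EFinP.
- by rewrite lee_fin; exact: c0 Ai0.
by rewrite integral_indic// setIT EFinM fineK// fin_num_measure.
Qed.

(** The lower bound [mean_ge_window] is applied to the nonnegative variables Z + M and M - Z. *)
Lemma mean_window (I : finType) (A : I -> set Om) (c : I -> R) (Z : Om -> R) (M : R) :
  (forall i, measurable (A i)) -> trivIset setT A -> measurable_fun setT Z ->
  (forall om, `|Z om| <= M) -> (forall i om, A i om -> Z om = c i) ->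
  ('E_P[Z])%E \is a fin_num /\
  `|fine ('E_P[Z])%E - \sum_i c i * fine (P (A i))| <= M * (1 - \sum_i fine (P (A i))).
Proof.
move=> mA tA mZ ZM Zc.
have M0 : 0 <= M by exact: le_trans (normr_ge0 _) (ZM point).
have bZ : [bounded Z om | om in setT].
  by exists M; split; [exact: num_real | move=> x Mx om _; exact: le_trans (ltW Mx)].
have iZ : P.-integrable setT (EFin \o Z).
  apply: measurable_bounded_integrable => //.
  exact: (le_lt_trans (probability_le1 P measurableT) (ltry 1)).
have LZ : Z \in Lfun P 1 by exact/Lfun1_integrable.
have fZ := expectation_fin_num LZ; split=> //.
have LM : cst M \in Lfun P 1 by exact: Lfun_cst.
have h1 := @mean_ge_window _ A (fun i => c i + M) (Z \+ cst M) mA tA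
  (measurable_funD mZ (measurable_cst M)) _ _.
have h2 := @mean_ge_window _ A (fun i => M - c i) (cst M \- Z) mA tA
  (measurable_funB (measurable_cst M) mZ) _ _.
have {}h1 : \sum_i (c i + M) * fine (P (A i)) <= fine ('E_P[Z])%E + M.
  rewrite -lee_fin EFinD fineK// -sumEFin -(expectation_cst P M) -expectationD//.
  apply: h1 => [om|i om /Zc e]; last by rewrite /= e.
  by have := ZM om; rewrite /= ler_norml; lra.
have {}h2 : \sum_i (M - c i) * fine (P (A i)) <= M - fine ('E_P[Z])%E.
  rewrite -lee_fin EFinB fineK// -sumEFin -(expectation_cst P M) -expectationB//.
  apply: h2 => [om|i om /Zc e]; last by rewrite /= e.
  by have := ZM om; rewrite /= ler_norml; lra.
move: h1 h2; under eq_bigr do rewrite mulrDl.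
under [X in _ -> is_true (X <= _) -> _]eq_bigr do rewrite mulrBl.
rewrite big_split sumrB -!mulr_sumr /= mulrBr mulr1 ler_norml.
move: (\sum_i c i * _) (M * \sum_i _) => x y; lra.
Qed.

End WindowMean.

Section DiscreteConvergence.
Local Open Scope classical_set_scope.
Local Open Scope ring_scope.
Context {R : realType}.

Section OneSpace.
Context {d : measure_display} {Om : measurableType d}.
Variables (P : probability Om R) (k : nat) (X : 'I_k -> {RV P >-> nat}).

Lemma measurable_point (v : 'I_k -> nat) : measurable [set om | forall i, X i om = v i].
Proof.
have -> : [set om | forall i, X i om = v i] = \bigcap_(i in [set: 'I_k]) [set om | X i om = v i].
  by apply/seteqP; split=> om /= h i; [move=> _|]; exact: h.
apply: fin_bigcap_measurable => [|i _]; first exact: finite_finset.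
exact: measurable_nat_fiber.
Qed.

Lemma measurable_discrete (g : 'rV[R]_k -> R) :
  measurable_fun setT (fun om => g (\row_i (X i om)%:R)).
Proof.
move=> _ Y mY; rewrite setTI.
have -> : (fun om => g (\row_i (X i om)%:R)) @^-1` Y =
    \bigcup_(v in [set v : {ffun 'I_k -> nat} | Y (g (\row_i (v i)%:R))])
      [set om | forall i, X i om = v i].
  apply/seteqP; split=> om /=.
    move=> h; exists [ffun i => X i om] => [|i]; last by rewrite ffunE.
    by rewrite /= (_ : \row_i _ = \row_i (X i om)%:R)//; apply/rowP => i; rewrite !mxE ffunE.
  move=> [v /= h e]; rewrite (_ : \row_i _ = \row_i (v i)%:R)//.
  by apply/rowP => i; rewrite !mxE e.
apply: bigcup_measurable_countable => v _; exact: measurable_point.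
Qed.

Lemma discrete_mean_window B (f : 'rV[R]_k -> R) (M : R) : (forall x, `|f x| <= M) ->
  let p (w : {ffun 'I_k -> 'I_B}) := fine (P [set om | forall i, X i om = w i]) in
  let Z := f \o (fun om => \row_i (X i om)%:R) in
  ('E_P[Z])%E \is a fin_num /\
  `|fine ('E_P[Z])%E - \sum_(w : {ffun 'I_k -> 'I_B}) f (\row_i (w i)%:R) * p w| <= M * (1 - \sum_(w : {ffun 'I_k -> 'I_B}) p w).
Proof.
move=> fM p Z.
apply: (@mean_window _ _ _ _ _ (fun w : {ffun 'I_k -> 'I_B} => [set om | forall i, X i om = w i])).
- by move=> w; exact: measurable_point.
- by move=> w w' _ _ [om [/= h h']]; apply/ffunP => i; apply: val_inj; rewrite /= -h h'.
- exact: measurable_discrete.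
- by move=> om; exact: fM.
- by move=> w om /= h; rewrite /Z /=; congr f; apply/rowP => i; rewrite !mxE h.
Qed.

End OneSpace.

(** The limit law is a probability, so a finite box carries nearly all of it. Inside the box
    finitely many point probabilities converge; hence the mass outside is also small for large [n],
    and a bounded function does not see it. *)
Lemma cvg_in_distribution_points (a : nat -> R) k
    (d : nat -> measure_display) (Om : forall n, measurableType (d n))
    (P : forall n, probability (Om n) R) (X : forall n, 'I_k -> {RV (P n) >-> nat})
    (d' : measure_display) (Om' : measurableType d') (Q : probability Om' R)
    (Y : 'I_k -> {RV Q >-> nat}) :
  series a @ \oo --> (1 : R) ->
  (forall v : 'I_k -> nat,
     fine (P n [set om | forall i, X n i om = v i]) @[n --> \oo] --> \prod_i a (v i)) ->
  (forall v : 'I_k -> nat, Q [set om | forall i, Y i om = v i] = (\prod_i a (v i))%:E) ->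
  cvg_in_distribution P (fun n om => \row_i (X n i om)%:R) Q (fun om => \row_i (Y i om)%:R).
Proof.
move=> a1 Xa Ya f _ [M0 [_ fM0]].
pose M := `|M0| + 1.
have M_gt0 : 0 < M by rewrite ltr_wpDl.
have fM x : `|f x| <= M.
  by apply: fM0 => //; rewrite /M (le_lt_trans (ler_norm _))// ltrDl.
pose p n B (w : {ffun 'I_k -> 'I_B}) := fine (P n [set om | forall i, X n i om = w i]).
pose q B (w : {ffun 'I_k -> 'I_B}) := \prod_i a (w i).
have EQ B := @discrete_mean_window _ _ Q k Y B f M fM.
have EP n B := @discrete_mean_window _ _ (P n) k (X n) B f M fM.
have fQ := (EQ 0%N).1; have fP n := (EP n 0%N).1.
rewrite -(fineK fQ); apply/fine_cvgP; split; first exact: nearW.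
have mass1 : \sum_(w : {ffun 'I_k -> 'I_B}) q B w @[B --> \oo] --> (1 : R).
  have -> : (fun B => \sum_(w : {ffun 'I_k -> 'I_B}) q B w) = (fun B => \prod_(i < k) series a B).
    apply/funext => B; rewrite /series /= big_mkord /q.
    by rewrite (bigA_distr_bigA (fun (i : 'I_k) (j : 'I_B) => a j)).
  have := @cvg_bigprod R _ (index_enum 'I_k) xpredT (fun _ B => series a B) (fun=> 1) (fun _ _ => a1).
  by rewrite big1_eq.
apply/cvgrPdist_le => e e0.
(* The mass outside the box costs e/2 for the [n]-th law, whose mass in the box is also only
   approximate, and e/4 for the limit; the sum over the box costs e/4. *)
pose e' := e / 4 / M.
have e'0 : 0 < e' by rewrite !divr_gt0.
have [B _ /(_ B (leqnn B)) /=] := (cvgrPdist_le _ _).1 mass1 e' e'0.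
rewrite ler_norml => hB.
have e4 : 0 < e / 4 by rewrite divr_gt0.
have c1 : \sum_(w : {ffun 'I_k -> 'I_B}) f (\row_i (w i)%:R) * p n B w @[n --> \oo] -->
    \sum_(w : {ffun 'I_k -> 'I_B}) f (\row_i (w i)%:R) * q B w.
  by apply: cvg_bigsum => w _; apply: cvgMr; exact: Xa.
have c2 : \sum_(w : {ffun 'I_k -> 'I_B}) p n B w @[n --> \oo] --> \sum_(w : {ffun 'I_k -> 'I_B}) q B w.
  by apply: cvg_bigsum => w _; exact: Xa.
have [_ hQ] := EQ B.
have Eq : \sum_(w : {ffun 'I_k -> 'I_B}) fine (Q [set om | forall i, Y i om = w i]) = \sum_(w : {ffun 'I_k -> 'I_B}) q B w.
  by apply: eq_bigr => w _; rewrite Ya.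
have Eq' : \sum_(w : {ffun 'I_k -> 'I_B}) f (\row_i (w i)%:R) * fine (Q [set om | forall i, Y i om = w i]) =
    \sum_(w : {ffun 'I_k -> 'I_B}) f (\row_i (w i)%:R) * q B w.
  by apply: eq_bigr => w _; rewrite Ya.
rewrite Eq Eq' in hQ.
near=> n.
have [_ hP] := EP n B.
have h1 : `|\sum_(w : {ffun 'I_k -> 'I_B}) f (\row_i (w i)%:R) * q B w - \sum_(w : {ffun 'I_k -> 'I_B}) f (\row_i (w i)%:R) * p n B w| <= e / 4.
  by near: n; exact: (cvgrPdist_le _ _).1 c1 _ e4.
have h2 : `|\sum_(w : {ffun 'I_k -> 'I_B}) q B w - \sum_(w : {ffun 'I_k -> 'I_B}) p n B w| <= e'.
  by near: n; exact: (cvgrPdist_le _ _).1 c2 _ e'0.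
move: hP hQ h1 h2 hB; rewrite -/(p n B).
rewrite -[\sum_(w : {ffun 'I_k -> 'I_B}) _ * fine _]/(\sum_(w : {ffun 'I_k -> 'I_B}) f (\row_i (w i)%:R) * p n B w).
rewrite -[\sum_(w : {ffun 'I_k -> 'I_B}) fine _]/(\sum_(w : {ffun 'I_k -> 'I_B}) p n B w).
set EPn := fine _; set S := \sum_(w : {ffun 'I_k -> 'I_B}) f _ * p n B w; set s := \sum_(w : {ffun 'I_k -> 'I_B}) p n B w.
set S' := \sum_(w : {ffun 'I_k -> 'I_B}) f _ * q B w; set s' := \sum_(w : {ffun 'I_k -> 'I_B}) q B w.
move=> hP hQ h1; rewrite ler_norml => h2 hB.
have M1 : M * (1 - s) <= M * (e' + e').
  by rewrite ler_pM2l//; lra.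
have M2 : M * (1 - s') <= M * e' by rewrite ler_pM2l//; lra.
have Me : M * e' = e / 4 by rewrite mulrC divfK// gt_eqF.
move: M1 M2 hP hQ h1; rewrite mulrDr Me !ler_norml; lra.
Unshelve. all: by end_near. Qed.

End DiscreteConvergence.

(** * From convergence of the trees to convergence of the degrees *)

Section SecondDirection.
Local Open Scope classical_set_scope.
Local Open Scope ring_scope.
Variables (R : realType) (d : nat -> measure_display)
  (Om : forall n : nat, measurableType (d n))
  (P : forall n : nat, probability (Om n) R)
  (D : forall n : nat, 'I_n -> {RV (P n) >-> nat})
  (T : forall n : nat, {RV (P n) >-> lgraph n}).
Hypothesis H : forall n : nat, (2 <= n)%N ->
    [/\ random_degree_sequence (@D n), exchangeable (@D n) &
        uniform_tree_given (@D n) (@T n)].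

Lemma first_degrees_vector ds k (v : 'I_k -> nat) n : size ds = k ->
  (forall i, v i = nth 0%N ds i) ->
  P (k + n)%N [set w | forall i : 'I_k, D (lshift n i) w = v i] =
  P (size ds + n)%N [set w | forall i : 'I_(size ds), D (lshift n i) w = nth 0%N ds i].
Proof.
move=> dk; case: _ / dk v => v ve; congr (P _ _).
by apply/seteqP; split=> w /= h i; rewrite h ve.
Qed.

Theorem cvg_tree_iid_mean_two :
  cvg_to_infinite_random_tree T -> cvg_to_iid_of_mean_two D.
Proof.
move=> [rho rhoP].
pose mu n : lgraph n.+1 -> R := law (@T n.+1).
have mu_law := mu_tree_law H.
have ball_cvg r F : (0 < r)%N -> finite_rooted_graph F ->
    whp_cvg mu (fun n t => ball_frequency R r F t) (ball_probability rho r F).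
  move=> r0 fF e e0; have := rhoP e r F e0 r0 fF; rewrite -cvg_shiftS => /fine_cvgP[_].
  apply: cvg_trans; apply: near_eq_cvg; exists 1%N => // n /= n0.
  have [//|a b c] := H (n := n.+1).
  rewrite (law_sum (@T n.+1)
    (fun t => e < `|ball_frequency R r F t - ball_probability rho r F|)) /=.
  rewrite /bad_prob; apply: eq_bigr => t _; congr (_ * _%:R); congr nat_of_bool.
  by rewrite ltNge; apply/idP/asboolP => /negP.
pose a k := ball_probability rho 1 (word_tree [:: k]).
have dc := degree_cvg mu_law ball_cvg.
have tight := large_balls_tight mu_law ball_cvg.
have a_ge0 k : 0 <= a k by exact: (degree_limit_ge0 mu_law dc).
have a0 : a 0%N = 0 by exact: (degree_limit0 mu_law dc).
have a_sum : series a @ \oo --> (1 : R) by exact: (degree_limit_sum mu_law dc tight).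
have a_mean : series (fun k => k%:R * a k) @ \oo --> (2 : R).
  exact: (degree_limit_mean mu_law dc tight).
have pmf := degree_prob_cvg mu_law dc.
pose q (w : seq nat) := \prod_(x <- w) a x.
have q_ge0 w : 0 <= q w by apply: prodr_ge0.
have q_nil : q [::] = 1 by rewrite /q big_nil.
have q_step w : series (fun s => q (rcons w s)) @ \oo --> q w.
  have -> : series (fun s => q (rcons w s)) = (fun n => q w * series a n).
    apply/funext => n; rewrite /series /= mulr_sumr; apply: eq_bigr => s _.
    by rewrite /q -cats1 big_cat big_seq1.
  by rewrite -[X in _ --> X]mulr1; exact: cvgMr.
(* Product weights make the sequence independent with law [a]. Since [a 0 = 0], positivity of the
   weights of all occurring prefixes excludes the value 0 everywhere, so [Y 0] can serve as the
   common variable. *)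
have [d' [Om' [Q [Y [Y_pos Y_prefix]]]]] := realization q_ge0 q_nil q_step.
exists d', Om', Q, (Y 0%N), d', Om', Q, Y; split.
- split.
    move=> om; rewrite lt0n; apply/eqP => Y0; have := Y_pos om 1%N.
    by rewrite /q /= big_seq1 Y0 a0 ltxx.
  rewrite expectation_nat -(nneseries_of_series a_mean); apply: eq_eseriesr => k _.
  congr (_ * _)%:E; rewrite /pmf_nat.
  have := (Y_prefix [:: k]).2; rewrite /q big_seq1 => /(congr1 fine) /= <-.
  congr (fine (Q _)); apply/seteqP; split=> om; rewrite /mkseq /=; [by move=> -> | by case].
- exact: (sequence_independent a_ge0 a_sum Y_prefix).
- exact: (sequence_same a_ge0 a_sum Y_prefix).
- move=> k; apply: (cvg_in_distribution_points a_sum).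
    move=> v; pose ds := [seq v i | i <- enum 'I_k].
    have := (cvg_of_first_degrees H ds (\prod_(x <- ds) a x)).2 (pmf ds).
    rewrite [X in _ --> X -> _]big_map [X in _ --> X -> _]big_enum.
    have ve (i : 'I_k) : v i = nth 0%N ds i.
      by rewrite (nth_map i) ?size_enum_ord ?nth_ord_enum.
    have dsk : size ds = k by rewrite size_map size_enum_ord.
    rewrite (_ : (fun n => fine (P (k + n)%N [set om | forall i : 'I_k, D (lshift n i) om = v i])) =
      (fun n => fine (P (size ds + n)%N
        [set w | forall i : 'I_(size ds), D (lshift n i) w = nth 0%N ds i]))); last first.
      by apply/funext => n; rewrite (first_degrees_vector n dsk ve).
    by rewrite (eq_bigl xpredT).
  move=> v; exact: (point_prob Y_prefix).
Qed.

End SecondDirection.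

Theorem theorem2 (R : realType)
    (d : nat -> measure_display) (Om : forall n : nat, measurableType (d n))
    (P : forall n : nat, probability (Om n) R)
    (D : forall n : nat, 'I_n -> {RV (P n) >-> nat})
    (T : forall n : nat, {RV (P n) >-> lgraph n}) :
  (forall n : nat, (2 <= n)%N ->
    [/\ random_degree_sequence (D n), exchangeable (D n) &
        uniform_tree_given (D n) (T n)]) ->
  cvg_to_infinite_random_tree T <-> cvg_to_iid_of_mean_two D.
Proof.
by move=> H; split; [exact: cvg_tree_iid_mean_two | exact: iid_mean_two_cvg_tree].
Qed.
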